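(* For every integer $n\ge 0$, \[ M2\mathrm{spt}(3n+1)\equiv 0 \pmod 3,\qquad M2\mathrm{spt}(5n+1)\equiv 0 \pmod 5,\qquad M2\mathrm{spt}(5n+3)\equiv 0\pmod 5 . \]
   Context: $M2\mathrm{spt}(n)$ denotes the total number of smallest parts, summed over all partitions of $n$ that have no repeated odd parts and whose smallest part is even. Equivalently, \[ \sum_{n\ge1} M2\mathrm{spt}(n)q^n=\sum_{n=1}^\infty \frac{q^{2n}(-q^{2n+1};q^2)_\infty}{(1-q^{2n})^2(q^{2n+2};q^2)_\infty}, \] where $(a;q)_\infty=\prod_{k\ge0}(1-aq^k)$. *)

(* Defs.v *)
From mathcomp Require Import all_boot.
Set Implicit Arguments. Unset Strict Implicit. Unset Printing Implicit Defensive.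

(* A partition of n is encoded by its multiplicity function
   m : {ffun 'I_n -> 'I_n.+1}, where m i is the number of parts equal to i.+1
   (every part of a partition of n lies in 1..n and occurs at most n times). *)

Definition is_partition_of (n : nat) (m : {ffun 'I_n -> 'I_n.+1}) : bool :=
  \sum_(i < n) i.+1 * m i == n.

Definition no_rep_odd (n : nat) (m : {ffun 'I_n -> 'I_n.+1}) : bool :=
  [forall i : 'I_n, odd i.+1 ==> (m i <= 1)].

Definition is_smallest (n : nat) (m : {ffun 'I_n -> 'I_n.+1}) (i : 'I_n) : bool :=
  (0 < m i) && [forall j : 'I_n, (j < i) ==> (m j == 0 :> nat)].

Definition smallest_even (n : nat) (m : {ffun 'I_n -> 'I_n.+1}) : bool :=
  [exists i : 'I_n, is_smallest m i && ~~ odd i.+1].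

Definition num_smallest (n : nat) (m : {ffun 'I_n -> 'I_n.+1}) : nat :=
  \sum_(i < n | is_smallest m i) m i.

Definition M2spt (n : nat) : nat :=
  \sum_(m : {ffun 'I_n -> 'I_n.+1}
         | [&& is_partition_of m, no_rep_odd m & smallest_even m])
    num_smallest m.

(* Main.v *)
(* Write [T k = k (k + 1) / 2], [psi = sum_k x^(T k)] and [M = sum_n (-1)^n M2spt(n) x^n],
   i.e. [q = - x].  A conjugate Bailey pair turns the generating function into
   [psi M = E + A] with the Lambert series [E = sum_i i x^(2i) / (1 - x^(2i))] and an Appell
   sum [A = sum_l A_l], where the exponents of [A_l] have the form [T l - T j].  Comparing
   the coefficients of [y^(2l+1)] in the product of [sum_k x^(T k) y^(2k+1)] with Lambert
   series in [y] evaluates [psi sum_l f(l) A_l] for every weight [f], up to one constant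
   series times [sum_l f(l) x^(T l)]; the weight [1] determines that constant through [M].

   Let [f] be the indicator of [(2 l + 1)^2 = C] modulo a prime [p].  As
   [8 (T l - T j) = (2 l + 1)^2 - (2 j + 1)^2] and the coefficient of [x^(T l - T j)] carries
   the factor [2 j + 1], the weighted Appell sum vanishes modulo [p] on many residue classes
   of exponents.  On those classes one gets linear equations between the class parts of [M],
   of Lambert series and of theta series.  For [p = 3] they give the result at once, since
   [E] vanishes on the class of 1.  For [p = 5] one also needs the Appell sums with the
   factor [(2 j + 1)^3], whose constant brings in a second unknown series [N].  If [a], [b],
   [c] are the parts of [psi] with [(2 k + 1)^2 = 1, 4, 0], then [a b + c^2 = x psi^10] and
   [c = x^3 psi^25] modulo 5, so [a / psi], [b / psi], [c / psi] are polynomials in a single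
   series [m]; the class parts of [1 / psi = psi^4 / psi^5] then are too, up to the factor
   [1 / psi].  All equations have coefficients in [F_5[m]], and an explicit combination
   of them leaves only a nonzero multiple of the part of [M] in the class of 1 (or 3). *)
From Stdlib Require Import ZArith Lia Ring Ring_theory InitialRing.
Require Import Defs.
Set Implicit Arguments.

(** * Elimination over a ring of characteristic 5 *)

(** The sign in [q = - x] turns the factors [1 + q^(2k+1)] of the generating function into
    [1 - x^(2k+1)], which the product for [psi] cancels, so that only finite products survive. The
    obstacle is then the division by [psi], which mixes residue classes. Writing
    [1 / psi = psi^(p-1) / psi^p] confines the mixing to the numerator, since Frobenius puts [psi^p]
    on multiples of [p]. Modulo 5 the factor [2j+1] gives nine equations (three values of [C], three
    classes) for eleven unknown series: five classes of [E], one of the cubic Lambert series, two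
    series from [rho], three classes of [M]. The factor [(2j+1)^3] adds nine equations and only
    three unknowns, the classes of [N], because [i^5 = i] brings back the same Lambert series. That
    one series [m] suffices is special to characteristic 5: [a / psi] and [b / psi] are the roots of
    a quadratic over [F_5[y]], [y = x psi^8], whose discriminant becomes a square times [1 - 2y]. *)

(* Stdlib's [ring] with integer coefficients compared modulo 5. *)
Definition eqb5 (x y : Z) := Z.eqb (Z.modulo (x - y) 5) 0.

Section Ring5.
Variables (S : Type) (rO rI : S) (add mul sub : S -> S -> S) (opp : S -> S).
Variable pow : S -> nat -> S.
Hypothesis S_ring : ring_theory rO rI add mul sub opp eq.
Hypothesis S_pow : power_theory rI mul eq N.to_nat pow.
Hypothesis char5 : add rI (mul (add rI rI) (add rI rI)) = rO.

(** Integers that agree modulo 5 differ by 5 times a quotient. [char5] has the shape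
    [1 + (1 + 1) (1 + 1)] because [gen_phiZ] maps 5 to that term. *)
Lemma ring5_morph : ring_morph rO rI add mul sub opp eq
  Z0 (Zpos xH) Z.add Z.mul Z.sub Z.opp eqb5 (gen_phiZ rO rI add mul opp).
Proof.
destruct (gen_phiZ_morph (Eqsth S) (Eq_ext add mul opp) S_ring) as [p0 p1 pD pB pM pN _].
split; auto.
intros x y xy%Z.eqb_eq.
assert (E : x = Z.add y (Z.mul 5 (Z.div (x - y) 5))) by (generalize (Z.div_mod (x - y) 5); lia).
rewrite E, pD, pM; simpl; rewrite char5.
now rewrite (ARmul_0_l (Rth_ARth (Eqsth S) (Eq_ext add mul opp) S_ring)),
  (ARadd_0_r (Eqsth S) (Rth_ARth (Eqsth S) (Eq_ext add mul opp) S_ring)).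
Qed.

Notation "x + y" := (add x y).
Notation "x * y" := (mul x y).
Notation "x - y" := (sub x y).
Notation "- x" := (opp x).
Notation "x ^ n" := (pow x n%nat).
Notation "0" := rO.
Notation "1" := rI.
Notation "2" := (add rI rI).
Notation "3" := (add rI (add rI rI)).
Notation "4" := (add rI (add rI (add rI rI))).
Ltac cst5 t := match t with
  | rO => constr:(Z0) | rI => constr:(Zpos xH)
  | add rI rI => constr:(Zpos (xO xH))
  | add rI (add rI rI) => constr:(Zpos (xI xH))
  | _ => constr:(NotConstant) end.
Ltac pow5 t := match isnatcst t with
  | true => eval cbv in (N.of_nat t) | _ => constr:(NotConstant) end.
Add Ring ring5 : S_ring
  (morphism (ring5_morph), constants [cst5], power_tac S_pow [pow5]).

Definition hat_a m := (m - 2) ^ 4 * (m + 2) * (m + 1).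
Definition hat_b m := (m - 1) * (m - 2) * (m + 2) ^ 4.
Definition hat_c m := 3 * (m - 1) ^ 3 * (m + 1) ^ 3.

(* With [y = a b + c^2] and [m = (a - b) / (1 - y)] one gets [m^2 = 1 - 2 y]. *)
Lemma hatsE (a b c y i m : S) : a + b + c = 1 -> a * b + c ^ 2 = y -> y ^ 3 = c ->
  (1 - y) * i = 1 -> m = (a - b) * i ->
  a = hat_a m /\ b = hat_b m /\ c = hat_c m.
Proof.
intros abc aby yc yi mE.
assert (ab : a - b = m * (1 - y)).
{ transitivity ((a - b) * ((1 - y) * i)); [rewrite yi|rewrite mE]; ring. }
(* The discriminant of the quadratic with roots [a], [b] is [(1 - y^3)^2 - 4 (y - y^6)], which
   equals [(1 - y)^2 (1 - 2y)] modulo 5. *)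
assert (m2 : m ^ 2 = 1 - 2 * y).
{ transitivity (((a + b + c - c) ^ 2 - 4 * (a * b + c ^ 2 - c ^ 2)) * i ^ 2); [rewrite mE; ring|].
  rewrite abc, aby, <- yc.
  transitivity ((1 - 2 * y) * ((1 - y) * i) ^ 2); [|rewrite yi]; ring. }
(* Here and below [3] is the inverse of 2. *)
assert (yE : y = 3 * (1 - m ^ 2)) by (rewrite m2; ring).
assert (aE : a = 3 * ((a + b + c) - c + (a - b))) by ring.
assert (bE : b = 3 * ((a + b + c) - c - (a - b))) by ring.
rewrite abc, ab, <- yc, yE in aE. rewrite abc, ab, <- yc, yE in bE.
rewrite <- yc, yE.
split; [rewrite aE|split; [rewrite bE|]]; unfold hat_a, hat_b, hat_c; ring.
Qed.

Variables (m D0 t1 t4 : S) (E M N : nat -> S).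
Let a := hat_a m.
Let b := hat_b m.
Let c := hat_c m.

(** Periodic, so that the class [n - i] can be written [n + 4 i] below. *)
Fixpoint sel5 (x0 x1 x2 x3 x4 : S) n := match n with
  | 0%nat => x0 | 1%nat => x1 | 2%nat => x2 | 3%nat => x3 | 4%nat => x4
  | Datatypes.S (Datatypes.S (Datatypes.S (Datatypes.S (Datatypes.S k)))) =>
      sel5 x0 x1 x2 x3 x4 k
  end.
Definition recip5 := sel5
  (- ((m - 2) * (m + 2) ^ 4 * (m + 1) ^ 4))
  (2 * (m - 1) * (m - 2) ^ 3 * (m + 2) ^ 2 * (m + 1) ^ 3)
  (- ((m - 1) ^ 2 * (m + 1) ^ 2))
  (3 * (m - 1) ^ 3 * (m - 2) ^ 2 * (m + 2) ^ 3 * (m + 1))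
  ((m - 1) ^ 4 * (m - 2) ^ 4 * (m + 2)).

(* The parts of [(a + b + c)^4] by the residue of the exponent, for [a], [b], [c]
   carried by the exponents congruent to 0, 1, 3. *)
Lemma recip5E :
  a ^ 4 + 3 * 4 * a * b ^ 2 * c + 4 * b * c ^ 3 = recip5 0 /\
  4 * a ^ 3 * b + 4 * b ^ 3 * c + 2 * 3 * a ^ 2 * c ^ 2 = recip5 1 /\
  2 * 3 * a ^ 2 * b ^ 2 + 3 * 4 * a * b * c ^ 2 + c ^ 4 = recip5 2 /\
  4 * a * b ^ 3 + 4 * a ^ 3 * c + 2 * 3 * b ^ 2 * c ^ 2 = recip5 3 /\
  b ^ 4 + 3 * 4 * a ^ 2 * b * c + 4 * a * c ^ 3 = recip5 4.
Proof.
unfold recip5, a, b, c, hat_a, hat_b, hat_c; simpl.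
repeat split; ring.
Qed.

Definition num5 := sel5 0 1 2 3 4.

(* [recip5 n / psi] and [phi5 n / psi] are the class parts of [1 / psi] and of
   [sum_k (2 k + 1)^2 x^(T k) / psi^2]; [lamb5] expresses those of the Lambert series with
   coefficients [i^3] by those with coefficients [i]. *)
Definition phi5 n := (1 + 2 * num5 n) * recip5 n.
Definition lamb5 n := match n with 0%nat => D0 | _ => 2 * num5 n ^ 3 * E n end.
Definition conv5 (f Q : nat -> S) n := f 0%nat * Q n + f 1%nat * Q (n + 4)%nat +
  f 2%nat * Q (n + 8)%nat + f 3%nat * Q (n + 12)%nat + f 4%nat * Q (n + 16)%nat.
(** If [Q n / psi] are the class parts of a series, these are the class parts of its product with a
    combination of theta parts; the shifts 0, 4, 12 undo the exponents 0, 1, 3 modulo 5. *)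
Definition lin5 (Q : nat -> S) (x1 x4 x0 : nat) n := num5 x1 * a * Q n +
  num5 x4 * b * Q (n + 4)%nat + num5 x0 * c * Q (n + 12)%nat.
Definition lint5 (Q : nat -> S) (x1 x4 : nat) n := num5 x1 * t1 * Q n +
  num5 x4 * t4 * Q (n + 4)%nat.

Definition rho5_row (C : nat) (Q : nat -> S) n := match C with
  | 0%nat => lint5 Q 3 4 n + lin5 Q 0 0 0 n
  | 1%nat => lint5 Q 1 3 n + lin5 Q 0 1 2 n
  | _ => lint5 Q 1 3 n + lin5 Q 0 0 1 n
  end.
Definition rho5_row3 (C : nat) (Q : nat -> S) n := match C with
  | 0%nat => lint5 Q 2 4 n + lin5 Q 0 0 0 n
  | 1%nat => lint5 Q 1 4 n + lin5 Q 0 1 3 n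
  | _ => lint5 Q 2 2 n + lin5 Q 0 0 1 n
  end.
(** [U] and [V] come from the Lambert series with coefficients [i] and [i^3]. As [i^5 = i] modulo 5,
    the weight [i^3] needs the same table with [U] and [V] exchanged, as in [rowN5]. *)
Definition omega5_row (C : nat) (U V : nat -> S) n := match C with
  | 0%nat => lin5 U 3 3 0 n + lin5 V 2 3 0 n
  | 1%nat => lin5 U 3 1 1 n + lin5 V 3 0 4 n
  | _ => lin5 U 1 3 1 n + lin5 V 0 2 1 n
  end.
Definition hat5 (C : nat) := match C with 0%nat => c | 1%nat => a | _ => b end.
Definition exp5 (C : nat) := match C with 0%nat => 3%nat | 1%nat => 0%nat | _ => 1%nat end.

(* [C = 0, 1, 4] stands for the square of [2 k + 1] modulo 5, [exp5 C] for the class of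
   [T k], [hat5 C] for [theta_C / psi].  The rows are the equations for [theta_C M] and
   [theta_C N] on the class of [exp5 C + n], with [M n] and [N n] the class parts of [M]
   and [N] times [psi]. *)
Definition rowM5 (C n : nat) := hat5 C * M n + rho5_row C recip5 (exp5 C + n) +
  omega5_row C (conv5 E recip5) (conv5 lamb5 recip5) (exp5 C + n) - 3 * hat5 C * conv5 E recip5 n +
  num5 n * hat5 C * recip5 n.
Definition rowN5 (C n : nat) := hat5 C * N n +
  4 * (rho5_row3 C recip5 (exp5 C + n) + omega5_row C (conv5 lamb5 recip5) (conv5 E recip5) (exp5 C + n)) -
  3 * (rho5_row C phi5 (exp5 C + n) + omega5_row C (conv5 E phi5) (conv5 lamb5 phi5) (exp5 C + n)).

Ltac expand_rows := cbv [rowM5 rowN5 rho5_row rho5_row3 omega5_row hat5 exp5 lin5 lint5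
  conv5 lamb5 phi5 num5 recip5 sel5 Nat.add a b c hat_a hat_b hat_c].

(* Found by eliminating, over the field [F_5(m)], the classes of [E], the series [D0],
   [t1], [t4] and the other classes of [M] and [N] from the rows [n = 1, 2, 3]. *)
Lemma certificate1 :
  (1 + 2*m^5 + 3*m^10) * (m - 1)^3 * (m - 2) * (m + 1) * M 1%nat =
  (2 + 2*m^5 + 3*m^10 + m^15) * (m - 2)^6 * (m + 1)^3 * rowM5 0 1 +
  (3 + 2*m^10 + m^15) * (m - 1)^3 * (m - 2)^2 * (m + 2)^4 * rowM5 1 1 +
  (3 + m^10) * m^10 * (m - 1)^2 * (m + 2) * (m + 1) * rowM5 4 1 +
  2 * (m - 1)^4 * (m - 2)^4 * (m + 2)^12 * (m + 1)^4 * rowM5 0 2 +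
  2 * (m - 1)^17 * (m + 2)^6 * (m + 1) * rowM5 1 2 +
  (1 + m^5 + 2*m^10) * (m - 1)^6 * (m - 2)^3 * (m + 2)^3 * (m + 1)^2 * rowM5 4 2 +
  2 * m^10 * (m - 1)^3 * (m - 2)^7 * (m + 2)^4 * rowM5 0 3 +
  (2*m^10 + 3*m^5 - 1) * m^5 * (m - 1) * (m - 2)^3 * (m + 2)^3 * (m + 1)^2 * rowM5 1 3 +
  2 * m^5 * (m - 2)^11 * (m + 1)^8 * rowM5 4 3 +
  3 * (m - 2) * (m + 2)^5 * (m + 1)^3 * rowN5 0 1 +
  (m - 1)^2 * (m + 2) * (m + 1)^6 * rowN5 4 1.
Proof.
expand_rows.
ring.
Qed.

(** The same elimination aimed at class 3. The terms free of unknowns, from [rho5_row] and from the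
    derivative of [1 / psi], must cancel as well. *)
Lemma certificate3 :
  - ((m - 1)^7 * (m + 2)^4 * (m + 1)^4 * M 3%nat) =
  m^5 * (m - 1)^4 * (m + 2)^4 * (m + 1)^6 * rowM5 1 1 -
  m^5 * (m - 1)^3 * (m - 2)^3 * (m + 2) * (m + 1)^7 * rowM5 4 1 +
  2 * m^20 * (m - 2)^2 * (m + 2)^2 * rowM5 0 2 +
  (2*m^10 - 1) * (m - 1)^8 * (m - 2)^3 * (m + 2) * (m + 1)^2 * rowM5 1 2 +
  (1 + 3*m^5 + 2*m^10 + 2*m^15) * (m - 1)^2 * (m - 2) * (m + 2)^3 * (m + 1)^3 * rowM5 4 2 +
  3 * m^5 * (m - 1)^9 * (m + 2)^4 * (m + 1)^6 * rowM5 0 3 +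
  (3*m^10 - m^5 - 1) * (m - 1)^2 * (m - 2) * (m + 2)^8 * (m + 1)^3 * rowM5 1 3 +
  (3 + 2*m^5 + 3*m^10) * (m - 1) * (m - 2)^9 * (m + 1)^4 * rowM5 4 3 +
  (2 - m^5 + m^10) * (m - 2)^2 * (m + 2)^7 * rowN5 0 2 +
  (2*m^10 + 3*m^5 - 1) * (m - 1)^2 * (m - 2) * (m + 2)^3 * (m + 1)^3 * rowN5 4 2 +
  (m - 1)^2 * (m - 2)^6 * (m + 2)^3 * (m + 1)^8 * rowN5 1 3 -
  (m - 1) * (m - 2)^9 * (m + 1)^9 * rowN5 4 3.
Proof.
expand_rows.
ring.
Qed.
End Ring5.

From HB Require Import structures.
From mathcomp Require Import all_boot all_order all_algebra boolp zify ring.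
Unset Strict Implicit. Unset Printing Implicit Defensive.
Import GRing.Theory.
Local Open Scope ring_scope.

(** * Formal power series *)

Definition fps (R : Type) := nat -> R.

HB.instance Definition _ (R : Type) := gen_eqMixin (fps R).
HB.instance Definition _ (R : Type) := gen_choiceMixin (fps R).

Section Fps.
Variable R : comNzRingType.
Implicit Types f g h : fps R.

Lemma fpsP f g : (forall n, f n = g n) -> f = g.
Proof. by move=> fg; apply: funext. Qed.

Definition fps_zero : fps R := fun=> 0.
Definition fps_opp f : fps R := fun n => - f n.
Definition fps_add f g : fps R := fun n => f n + g n.
Definition fps_one : fps R := fun n => (n == 0)%:R.
Definition fps_mul f g : fps R := fun n => \sum_(i < n.+1) f i * g (n - i)%N.

Fact fps_addA : associative fps_add.
Proof. by move=> f g h; apply: fpsP => n; apply: addrA. Qed.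
Fact fps_addC : commutative fps_add.
Proof. by move=> f g; apply: fpsP => n; apply: addrC. Qed.
Fact fps_add0 : left_id fps_zero fps_add.
Proof. by move=> f; apply: fpsP => n; apply: add0r. Qed.
Fact fps_addN : left_inverse fps_zero fps_opp fps_add.
Proof. by move=> f; apply: fpsP => n; apply: addNr. Qed.

HB.instance Definition _ :=
  GRing.isZmodule.Build (fps R) fps_addA fps_addC fps_add0 fps_addN.

(* Below any bound [N], products of series are products of truncations, so the
   ring laws are inherited from polynomials. *)
Definition trunc N f : {poly R} := \poly_(i < N) f i.

Lemma coef_trunc N f i : (i < N)%N -> (trunc N f)`_i = f i.
Proof. by move=> iN; rewrite coef_poly iN. Qed.

Lemma coef_truncM N f g i : (i < N)%N -> (trunc N f * trunc N g)`_i = fps_mul f g i.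
Proof.
move=> iN; rewrite coefM; apply: eq_bigr => j _.
have jN : (j < N)%N by apply: leq_trans iN; exact: ltn_ord.
by rewrite !coef_trunc // (leq_ltn_trans (leq_subr _ _) iN).
Qed.

Fact fps_mulA : associative fps_mul.
Proof.
move=> f g h; apply: fpsP => n.
have low (p q p' q' : {poly R}) : (forall i, (i <= n)%N -> p`_i = p'`_i) ->
    (forall i, (i <= n)%N -> q`_i = q'`_i) -> (p * q)`_n = (p' * q')`_n.
  move=> pp qq; rewrite !coefM; apply: eq_bigr => i _.
  by rewrite pp ?qq // ?leq_subr // -ltnS.
have <- := coef_truncM f (fps_mul g h) (ltnSn n).
have <- := coef_truncM (fps_mul f g) h (ltnSn n).
rewrite (low _ _ (trunc n.+1 f) (trunc n.+1 g * trunc n.+1 h)) //; last first.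
  by move=> i ltin; rewrite coef_trunc ?ltnS // coef_truncM.
rewrite mulrA; apply: low => // i lein.
by rewrite coef_truncM // coef_trunc.
Qed.

Fact fps_mulC : commutative fps_mul.
Proof.
move=> f g; apply: fpsP => n; have ltnn := ltnSn n.
by rewrite -(coef_truncM f g ltnn) mulrC coef_truncM.
Qed.

Fact fps_mul1 : left_id fps_one fps_mul.
Proof.
move=> f; apply: fpsP => n; rewrite /fps_mul big_ord_recl /= subn0 /fps_one mul1r.
by rewrite big1 ?addr0 // => i _; rewrite mul0r.
Qed.

Fact fps_mulDl : left_distributive fps_mul fps_add.
Proof.
move=> f g h; apply: fpsP => n; rewrite /fps_mul /fps_add -big_split.
by apply: eq_bigr => i _; rewrite mulrDl.
Qed.

Fact fps_1neq0 : fps_one != 0 :> fps R.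
Proof. by apply/eqP => /(congr1 (@^~ 0%N)) /eqP; rewrite /fps_one oner_eq0. Qed.

HB.instance Definition _ := GRing.Zmodule_isComNzRing.Build (fps R)
  fps_mulA fps_mulC fps_mul1 fps_mulDl fps_1neq0.

Lemma fps0E n : (0 : fps R) n = 0. Proof. by []. Qed.
Lemma fpsDE f g n : (f + g) n = f n + g n. Proof. by []. Qed.
Lemma fpsNE f n : (- f) n = - f n. Proof. by []. Qed.
Lemma fpsBE f g n : (f - g) n = f n - g n. Proof. by []. Qed.
Lemma fps1E n : (1 : fps R) n = (n == 0)%:R. Proof. by []. Qed.
Lemma fpsME f g n : (f * g) n = \sum_(i < n.+1) f i * g (n - i)%N. Proof. by []. Qed.

Lemma fps_sumE (I : Type) (r : seq I) (P : pred I) (F : I -> fps R) n :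
  (\sum_(i <- r | P i) F i) n = \sum_(i <- r | P i) F i n.
Proof. by elim/big_rec2: _ => // i y1 y2 _ <-. Qed.

Lemma fpsMnE f k n : (f *+ k) n = f n *+ k.
Proof. by elim: k => // k IH; rewrite !mulrS fpsDE IH. Qed.

Lemma fpsnatE k n : (k%:R : fps R) n = if n == 0%N then k%:R else 0.
Proof. by rewrite fpsMnE fps1E; case: n => //= n; rewrite mul0rn. Qed.

Lemma fpsnatM k f n : (k%:R * f) n = k%:R * f n.
Proof. by rewrite !mulr_natl fpsMnE. Qed.

Definition X (e : nat) : fps R := fun n => (n == e)%:R.

Lemma X0 : X 0 = 1. Proof. by []. Qed.

Lemma XME e f n : (X e * f) n = if (e <= n)%N then f (n - e)%N else 0.
Proof.
rewrite fpsME /X; case: leqP => [len|ltn].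
  rewrite (bigD1 (Ordinal (len : (e < n.+1)%N))) //= eqxx mul1r big1 ?addr0 //.
  move=> i; rewrite -val_eqE /= => /negbTE ->; exact: mul0r.
by rewrite big1 // => i _; rewrite ltn_eqF ?mul0r // (leq_trans (ltn_ord i)).
Qed.

Lemma XD d e : X (d + e) = X d * X e.
Proof.
apply: fpsP => n; rewrite XME /X; case: leqP => [|ltn].
  by move=> /subnKC {1}<-; rewrite eqn_add2l.
by rewrite ltn_eqF // (leq_trans ltn) // leq_addr.
Qed.

Lemma XX e k : X e ^+ k = X (e * k).
Proof. by elim: k => [|k IH]; rewrite ?muln0 // exprS IH mulnS XD. Qed.

(** [geo e] is [X^e / (1 - X^e)] when [0 < e]. *)
Definition geo (e : nat) : fps R := fun n => ((0 < n) && (e %| n))%N%:R.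

Lemma geoE e : (0 < e)%N -> geo e = X e * (1 + geo e).
Proof.
move=> e_gt0; apply: fpsP => n; rewrite XME fpsDE fps1E /geo.
case: (leqP e n) => [len|ltn]; last first.
  by case: n ltn => // n ltn; rewrite gtnNdvd.
rewrite (leq_trans e_gt0 len) /= subn_eq0 subn_gt0 dvdn_subl //.
case: (ltngtP n e) len => // [_|->] _; first by rewrite add0r.
by rewrite dvdnn addr0.
Qed.

Lemma geo_inv e : (0 < e)%N -> (1 - X e) * (1 + geo e) = 1.
Proof. by move=> /geoE E; rewrite mulrBl mul1r -E; ring. Qed.

End Fps.

(** * Infinite sums of series *)

Section Isum.
Variable R : comNzRingType.
Implicit Types (f g : fps R) (F G : nat -> fps R).

Definition low (e : nat) f := forall n, (n < e)%N -> f n = 0.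

Lemma lowW d e f : (d <= e)%N -> low e f -> low d f.
Proof. by move=> de fe n nd; apply: fe; apply: leq_trans nd de. Qed.

Lemma lowX e d : (d <= e)%N -> low d (X R e).
Proof. by move=> de n nd; rewrite /X ltn_eqF // (leq_trans nd). Qed.

Lemma lowMl e f g : low e g -> low e (f * g).
Proof.
move=> ge n ne; rewrite fpsME big1 // => i _.
by rewrite ge ?mulr0 // (leq_ltn_trans (leq_subr _ _) ne).
Qed.

Lemma lowMr e f g : low e f -> low e (f * g).
Proof. by rewrite mulrC; apply: lowMl. Qed.

Lemma lowM d e f g : low d f -> low e g -> low (d + e) (f * g).
Proof.
move=> fd ge n nde; rewrite fpsME big1 // => i _.
have [id|di] := ltnP i d; first by rewrite fd ?mul0r.
by rewrite ge ?mulr0 // ltn_subLR ?(leq_trans nde) ?leq_add2r // -ltnS.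
Qed.

Lemma lowD e f g : low e f -> low e g -> low e (f + g).
Proof. by move=> fe ge n ne; rewrite fpsDE fe ?ge ?addr0. Qed.

Lemma low_geo e : (0 < e)%N -> low e (geo R e).
Proof. by move=> e0; rewrite geoE //; apply/lowMr/lowX. Qed.

Definition summable F := forall n, exists K, forall k, (K <= k)%N -> F k n = 0.

Lemma summable_low d F : (forall k, low (k - d) (F k)) -> summable F.
Proof. by move=> Fd n; exists (n + d).+1 => k nk; apply: Fd; lia. Qed.

Lemma summableD F G : summable F -> summable G -> summable (fun k => F k + G k).
Proof.
move=> Fs Gs n; have [K FK] := Fs n; have [L GL] := Gs n.
by exists (maxn K L) => k; rewrite geq_max => /andP[Kk Lk]; rewrite fpsDE FK ?GL ?addr0.
Qed.

Lemma summable_shift i F : summable F -> summable (fun k => F (k + i)%N).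
Proof. by move=> Fs n; have [K FK] := Fs n; exists K => k Kk; apply: FK; lia. Qed.

Lemma summableN F : summable F -> summable (fun k => - F k).
Proof. by move=> Fs n; have [K FK] := Fs n; exists K => k Kk; rewrite fpsNE FK ?oppr0. Qed.

Lemma summableMl F (c : nat -> fps R) : (exists d, forall k, low (k - d) (F k)) ->
  summable (fun k => c k * F k).
Proof. by move=> [d Fd]; apply: (@summable_low d) => k; apply/lowMl. Qed.

Lemma summableMl' f F : summable F -> summable (fun k => f * F k).
Proof.
move=> Fs n.
have [K FK] : exists K, forall m k, (m <= n)%N -> (K <= k)%N -> F k m = 0.
  elim: n => [|n [K FK]].
    by have [K FK] := Fs 0%N; exists K => m k; rewrite leqn0 => /eqP -> /FK.
  have [L FL] := Fs n.+1; exists (maxn K L) => m k mn.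
  rewrite geq_max => /andP[Kk Lk]; move: mn; rewrite leq_eqVlt => /orP[/eqP ->|].
    exact: FL.
  by rewrite ltnS => /FK; apply.
by exists K => k Kk; rewrite fpsME big1 // => i _; rewrite FK ?mulr0 // leq_subr.
Qed.

(** Coefficientwise; a coefficient whose terms do not vanish eventually gets the default 0, hence
    the [summable] hypotheses below. *)
Definition isum F : fps R := fun n =>
  if pselect (exists K, forall k, (K <= k)%N -> F k n = 0) is left ex
  then \sum_(k < projT1 (cid ex)) F k n else 0.

Lemma isumE F n K : (forall k, (K <= k)%N -> F k n = 0) ->
  isum F n = \sum_(k < K) F k n.
Proof.
move=> FK; rewrite /isum; case: pselect => [ex|]; last by case; exists K.
case: cid => L /= FL.
have ext A B : (A <= B)%N -> (forall k, (A <= k)%N -> F k n = 0) ->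
    \sum_(k < A) F k n = \sum_(k < B) F k n.
  move=> AB FA; rewrite (big_ord_widen _ (fun k => F k n) AB) big_mkcond.
  by apply: eq_bigr => i _; case: ltnP => // /FA.
by rewrite (ext _ (maxn L K) (leq_maxl _ _) FL) (ext K _ (leq_maxr L K) FK).
Qed.

Lemma eq_isum F G : (forall k, F k = G k) -> isum F = isum G.
Proof. by move=> FG; congr isum; apply: funext. Qed.

Lemma isumD F G : summable F -> summable G -> isum (fun k => F k + G k) = isum F + isum G.
Proof.
move=> Fs Gs; apply: fpsP => n; have [K FK] := Fs n; have [L GL] := Gs n.
rewrite fpsDE !(@isumE _ n (maxn K L)) -?big_split // => k;
  rewrite geq_max => /andP[Kk Lk]; rewrite ?fpsDE ?FK ?GL ?addr0 //.
Qed.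

Lemma isumMl f F : summable F -> isum (fun k => f * F k) = f * isum F.
Proof.
move=> Fs; apply: fpsP => n.
have [K FK] : exists K, forall m k, (m <= n)%N -> (K <= k)%N -> F k m = 0.
  elim: n => [|n [K FK]].
    by have [K FK] := Fs 0%N; exists K => m k; rewrite leqn0 => /eqP -> /FK.
  have [L FL] := Fs n.+1; exists (maxn K L) => m k mn.
  rewrite geq_max => /andP[Kk Lk]; move: mn; rewrite leq_eqVlt => /orP[/eqP ->|].
    exact: FL.
  by rewrite ltnS => /FK; apply.
rewrite (@isumE _ n K) => [|k Kk]; last first.
  by rewrite fpsME big1 // => i _; rewrite FK ?mulr0 // leq_subr.
rewrite fpsME; under eq_bigr do rewrite fpsME.
rewrite exchange_big /=; apply: eq_bigr => i _.
by rewrite -big_distrr /= (@isumE _ _ K) // => k; apply: FK; apply: leq_subr.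
Qed.

Lemma isumMr f F : summable F -> isum (fun k => F k * f) = isum F * f.
Proof. by move=> Fs; rewrite mulrC -isumMl //; apply: eq_isum => k; rewrite mulrC. Qed.

Lemma isum_shift i F : summable F ->
  isum F = \sum_(k < i) F k + isum (fun k => F (k + i)%N).
Proof.
move=> Fs; apply: fpsP => n; have [K FK] := Fs n.
rewrite fpsDE fps_sumE (@isumE _ n (i + K)) => [|k Kk]; last by apply: FK; lia.
rewrite (@isumE _ n K) => [|k Kk]; last by apply: FK; lia.
by rewrite big_split_ord; congr (_ + _); apply: eq_bigr => k _; rewrite /= addnC.
Qed.

Lemma isum_exch (G : nat -> nat -> fps R) :
  (forall n, exists K, forall k l, (K <= k)%N || (K <= l)%N -> G k l n = 0) ->
  isum (fun k => isum (G k)) = isum (fun l => isum (G^~ l)).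
Proof.
move=> Gs; apply: fpsP => n; have [K GK] := Gs n.
have E k : isum (G k) n = \sum_(l < K) G k l n.
  by apply: isumE => l Kl; apply: GK; rewrite Kl orbT.
have E' l : isum (G^~ l) n = \sum_(k < K) G k l n.
  by apply: isumE => k Kk; apply: GK; rewrite Kk.
rewrite !(@isumE _ n K) => [|l Kl|k Kk].
- under eq_bigr do rewrite E; under [RHS]eq_bigr do rewrite E'.
  exact: exchange_big.
- by rewrite E' big1 // => k _; rewrite GK // Kl orbT.
- by rewrite E big1 // => l _; rewrite GK // Kk.
Qed.

Lemma isum_finite n F : (forall k, (n <= k)%N -> F k = 0) -> isum F = \sum_(k < n) F k.
Proof.
move=> F0; apply: fpsP => m; rewrite fps_sumE; apply: isumE => k nk.
by rewrite F0.
Qed.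

End Isum.

(** * Theta and Lambert series *)

(* [T k = k (k + 1) / 2], for integers [k] of either sign. *)
Definition T (k : int) : nat :=
  match k with Posz n => 'C(n.+1, 2) | Negz n => 'C(n.+1, 2) end.

Arguments T : simpl never.

Lemma T2 k : (T k)%:Z * 2 = k * (k + 1).
Proof.
have E n : ('C(n.+1, 2) * 2)%N = (n * n.+1)%N.
  by have := bin_ffact n.+1 2; rewrite !ffactnS ffactn0 muln1 mulnC [RHS]mulnC => <-; rewrite mulnC.
by case: k => n; rewrite /T; move: (E n); lia.
Qed.

Lemma T_opp k : T (- 1 - k) = T k.
Proof. by have := T2 k; have := T2 (-1 - k); nia. Qed.

Lemma T_nat_ge (n : nat) : (n <= T n)%N.
Proof. by have := T2 n; nia. Qed.

Lemma T_ge (k : int) (n : nat) : (n%:Z <= k) || (k <= - 1 - n%:Z) -> (n <= T k)%N.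
Proof. by have := T2 k; nia. Qed.

Section Shift.
Variable R : comNzRingType.
Implicit Types (f : int -> R) (w : nat -> R).
Local Notation X := (X R).
Local Notation geo := (geo R).

Definition cst (c : R) : fps R := fun n => if n == 0%N then c else 0.

Lemma cstM c (f : fps R) n : (cst c * f) n = c * f n.
Proof.
rewrite fpsME big_ord_recl /= subn0 /cst /= big1 ?addr0 // => i _.
by rewrite mul0r.
Qed.

Lemma cst_is_zmod_morphism : zmod_morphism cst.
Proof. by move=> c d; apply: fpsP => -[|n]; rewrite fpsBE /cst ?subr0. Qed.
HB.instance Definition _ := GRing.isZmodMorphism.Build _ _ cst cst_is_zmod_morphism.
Lemma cst_is_monoid_morphism : monoid_morphism cst.
Proof.
split=> [|c d]; first by apply: fpsP => -[].
by apply: fpsP => n; rewrite cstM /cst; case: n => //= n; rewrite mulr0.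
Qed.
HB.instance Definition _ := GRing.isMonoidMorphism.Build _ _ cst cst_is_monoid_morphism.

Definition theta w : fps R := isum (fun k => cst (w k) * X (T k)).

Lemma low_theta_term (w : nat -> R) k : low k (cst (w k) * X (T k)).
Proof. by apply/lowMl/lowX/T_nat_ge. Qed.

Lemma summable_theta w : summable (fun k => cst (w k) * X (T k)).
Proof. by apply: (@summable_low _ 0) => k; rewrite subn0; apply: low_theta_term. Qed.

Lemma eq_theta w w' : w =1 w' -> theta w = theta w'.
Proof. by move=> ww; apply: eq_isum => k; rewrite ww. Qed.

Lemma thetaD w w' : theta (fun k => w k + w' k) = theta w + theta w'.
Proof.
rewrite -isumD; try exact: summable_theta.
by apply: eq_isum => k; rewrite rmorphD mulrDl.
Qed.

Lemma thetaZ c w : theta (fun k => c * w k) = cst c * theta w.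
Proof.
rewrite -isumMl; last exact: summable_theta.
by apply: eq_isum => k; rewrite rmorphM mulrA.
Qed.

Lemma thetaE w n : theta w n = \sum_(k < n.+1 | T k == n) w k.
Proof.
rewrite /theta (@isumE _ _ _ n.+1) => [|k nk]; last exact: low_theta_term.
rewrite [RHS]big_mkcond; apply: eq_bigr => k _.
by rewrite cstM /X eq_sym; case: eqP; rewrite ?mulr1 ?mulr0.
Qed.

Definition psi : fps R := theta (fun=> 1).

Lemma summable_sub (l : int) (n : nat) : (`|l| <= n)%N ->
  forall c : nat -> fps R, summable (fun i => c i * X (T (l - i%:Z))).
Proof.
move=> ln c; apply: (@summable_low _ n.+1) => i; apply/lowMl/lowX/T_ge; lia.
Qed.

Lemma summable_add (l : int) (n : nat) : (`|l| <= n)%N ->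
  forall c : nat -> fps R, summable (fun i => c i * X (T (l + i%:Z))).
Proof.
move=> ln c; apply: (@summable_low _ n.+1) => i; apply/lowMl/lowX/T_ge; lia.
Qed.

Variable p : nat.
Hypothesis p_odd : odd p.

Let ex0p : ((0%N ^ p)%:R : fps R) = 0. Proof. by rewrite exp0n ?odd_gt0. Qed.

(* [lam l] is the coefficient of [y^(2l+1)] in the product of the theta series
   [sum_k x^T(k) y^(2k+1)] with the Lambert series [sum_i i^p y^(2i) / (1 - x^(2i))]
   (all nonzero [i]), from which the corresponding value at [x^(2i) = 0] has been removed. *)
Definition lam_term (l : int) (i : nat) : fps R :=
  (i ^ p)%:R * (X (T (l + i%:Z)) + geo (2 * i) * (X (T (l - i%:Z)) + X (T (l + i%:Z)))).
Definition lam_term' (l : int) (i : nat) : fps R :=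
  (i ^ p)%:R * (X (T (l - i%:Z)) + geo (2 * i) * (X (T (l - i%:Z)) + X (T (l + i%:Z)))).
Definition lam l := isum (lam_term l).

(** Coefficient form of the quasi-periodicity under [y -> x y]: going from [l] to [l + 2] raises
    [T (l + i)] and [T (l - i)] by [2l + 3 + 2i] and [2l + 3 - 2i], and
    [geo (2i) = x^(2i) (1 + geo (2i))] absorbs [x^(2i)]. The lone summand moves from [l + i] to
    [l - i], hence [lam_term']. *)
Lemma lam_term_shift (l : int) (m i : nat) : m%:Z = 2 * l + 3 ->
  lam_term (l + 2) i = X m * lam_term' l i.
Proof.
move=> mE; case: i => [|i]; first by rewrite /lam_term /lam_term' ex0p !mul0r mulr0.
rewrite /lam_term /lam_term'; set g := geo _.
have gE : g = X (2 * i.+1) * (1 + g) by apply: geoE.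
have E1 : X (T (l + 2 + i.+1%:Z)) = X m * X (2 * i.+1) * X (T (l + i.+1%:Z)).
  rewrite -!XD; congr X.
  by have := T2 (l + 2 + i.+1%:Z); have := T2 (l + i.+1%:Z); nia.
have E2 : X (2 * i.+1) * X (T (l + 2 - i.+1%:Z)) = X m * X (T (l - i.+1%:Z)).
  rewrite -!XD; congr X.
  by have := T2 (l + 2 - i.+1%:Z); have := T2 (l - i.+1%:Z); nia.
have -> (c : fps R) : c * (X (T (l + 2 + i.+1%:Z)) + g * (X (T (l + 2 - i.+1%:Z)) + X (T (l + 2 + i.+1%:Z))))
    = c * (X (T (l + 2 + i.+1%:Z)) * (1 + g) + g * X (T (l + 2 - i.+1%:Z))) by ring.
have -> : g * X (T (l + 2 - i.+1%:Z)) = (1 + g) * (X m * X (T (l - i.+1%:Z))).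
  by rewrite {1}gE -E2; ring.
have -> : X (T (l + 2 + i.+1%:Z)) * (1 + g) = X m * X (T (l + i.+1%:Z)) * g.
  by rewrite E1 {2}gE; ring.
by ring.
Qed.

Lemma low_lam_term (l : nat) i : low i (lam_term l i).
Proof.
case: i => [|i]; first by move=> n; rewrite ltn0.
apply/lowMl/lowD; first by apply/lowX/T_ge; lia.
apply: (@lowW _ _ (2 * i.+1)); first lia.
by apply/lowMr/low_geo; lia.
Qed.

Lemma summable_lam_term (l : nat) : summable (lam_term l).
Proof. by apply: (@summable_low _ 0) => k; rewrite subn0; apply: low_lam_term. Qed.

(** At [l = -1] the symmetry [T (- 1 - k) = T k] turns [lam_term'] into [lam_term] at 0. Thus even
    and odd [l] depend on the single constant [lam 0]. *)
Lemma lam1 : lam 1 = X 1 * lam 0.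
Proof.
rewrite -isumMl; last exact: (@summable_lam_term 0).
apply: eq_isum => i; transitivity (lam_term (-1 + 2) i) => //; rewrite (@lam_term_shift _ 1) //.
congr (_ * _); rewrite /lam_term /lam_term' T_opp add0r sub0r.
by rewrite -(T_opp (- i%:Z)) opprK; ring.
Qed.

Lemma natX_intr (i : nat) : (((i%:Z) ^+ p)%:~R : fps R) = (i ^ p)%:R.
Proof. by rewrite natrX rmorphXn. Qed.

(** As [p] is odd, the two sums combine into [(l - j)^p x^(T j)] over all integers [j], and
    [T (- 1 - j) = T j] folds this onto [j >= 0]. For [p = 1] the weight is the constant
    [2l + 1]. *)
Lemma isum_diff (l : nat) :
  isum (fun i => (i ^ p)%:R * X (T (l%:Z - i%:Z))) -
  isum (fun i => (i ^ p)%:R * X (T (l%:Z + i%:Z))) =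
  theta (fun j => ((l%:Z - j%:Z) ^+ p + (l + j).+1%:Z ^+ p)%:~R).
Proof.
pose g (j : nat) : fps R := ((j%:Z - l%:Z) ^+ p)%:~R * X (T j).
have gs : summable g by apply: (@summable_low _ 0) => k; apply/lowMl/lowX; rewrite subn0 T_nat_ge.
have -> : isum (fun i => (i ^ p)%:R * X (T (l%:Z + i%:Z))) = isum g - \sum_(j < l) g j.
  rewrite (isum_shift l gs) addrC addKr; apply: eq_isum => i; rewrite /g.
  by rewrite PoszD addrK natX_intr (addrC l%:Z).
rewrite (isum_shift l.+1); last exact: (@summable_sub l l).
have -> : \sum_(i < l.+1) (i ^ p)%:R * X (T (l%:Z - i%:Z)) = - \sum_(j < l) g j.
  rewrite big_ord_recl exp0n ?odd_gt0 //.
  rewrite mul0r add0r -sumrN [RHS](reindex_inj rev_ord_inj); apply: eq_bigr => i _.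
  rewrite lift0 /g (_ : nat_of_ord (rev_ord i) = (l - i.+1)%N) // -mulNr.
  congr (_ * X (T _)); last by have := ltn_ord i; lia.
  have -> : (l - i.+1)%N%:Z - l%:Z = - i.+1%:Z by have := ltn_ord i; lia.
  by rewrite exprNn -signr_odd p_odd expr1 mulN1r mulrNz opprK natX_intr.
rewrite opprB addrACA addNr add0r.
rewrite -[X in _ + X]mulN1r -isumMl // -isumD.
- apply: eq_isum => j; rewrite rmorph_int /g mulN1r -mulNr.
  have -> : l%:Z - (j + l.+1)%N%:Z = - 1 - j%:Z by lia.
  rewrite T_opp -mulrDl; congr (_ * _).
  rewrite intrD natX_intr addrC addnS (addnC j); congr (_ + _).
  by rewrite -mulrNz -[j%:Z - _]opprB exprNn -signr_odd p_odd expr1 mulN1r opprK.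
- exact: (summable_shift l.+1 (@summable_sub l l (leqnn _) (fun i => (i ^ p)%:R))).
- by apply: summableMl; exists 0%N => k; rewrite subn0; apply/lowMl/lowX/T_nat_ge.
Qed.
End Shift.

(** * Appell sums and the coefficients [lam] *)

Section Appell.
Variable R : comNzRingType.
Local Notation X := (X R).
Local Notation geo := (geo R).
Local Notation psi := (psi R).
Local Notation lam := (lam R).

Lemma lam_shift (p l : nat) : odd p -> lam p (l + 2)%N =
  X (2 * l + 3) * (lam p l + theta (fun j => ((l%:Z - j%:Z) ^+ p + (l + j).+1%:Z ^+ p)%:~R)).
Proof.
move=> p_odd; rewrite -isum_diff //.
pose u (i : nat) := (i ^ p)%:R * X (T (l%:Z - i%:Z)).
pose v (i : nat) := (i ^ p)%:R * X (T (l%:Z + i%:Z)).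
have us : summable u by apply: (@summable_sub R l l (leqnn _) (fun i => (i ^ p)%:R)).
have vs : summable v by apply: (@summable_add R l l (leqnn _) (fun i => (i ^ p)%:R)).
have ls : summable (lam_term R p l) by apply: summable_lam_term.
have l's : summable (lam_term' R p l).
  have -> : lam_term' R p l = fun i => lam_term R p l i + (u i + - v i).
    by apply: funext => i; rewrite /lam_term /lam_term' /u /v; ring.
  by do 2?apply: summableD => //; apply: summableN.
have E : isum (lam_term' R p l) + isum v = lam p l + isum u.
  rewrite -!isumD //; apply: eq_isum => i.
  by rewrite /lam_term /lam_term' /u /v; ring.
have <- : isum (lam_term' R p l) = lam p l + (isum u - isum v).
  by rewrite addrA -E addrK.
rewrite -isumMl //; apply: eq_isum => i.
by rewrite PoszD (@lam_term_shift _ _ _ _ (2 * l + 3)).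
Qed.


(* The Appell sum with numerators [w]: for [w l = 2 l + 1] the coefficient sum
   [sum_l appell w l] is [sum (2 k + 1) x^(n (2 n + 2 k + 1))] over [n >= 1] and [k >= 0]. *)
Fixpoint appell (w : nat -> R) (l : nat) : fps R :=
  if l is l'.+2 then X (2 * l' + 3) * (appell w l' + cst (w l')) else 0.

Lemma low_appell w l : low l (appell w l).
Proof.
elim/ltn_ind: l => -[|[|l]] _ //=.
by apply/lowMr/lowX; lia.
Qed.

Lemma summable_appell (w f : nat -> R) : summable (fun l => cst (f l) * appell w l).
Proof. by apply: (@summable_low _ 0) => l; rewrite subn0; apply/lowMl/low_appell. Qed.


(** The right side obeys the recursion of [appell] times [psi], because [T (l + 2) = T l + 2l + 3]
    and the correction in [lam_shift] is [(2l + 1) psi]; subtracting [x^(T l) lam 0] makes it vanish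
    at [l = 0, 1]. *)
Lemma psi_appell l : psi * appell (fun k => (2 * k + 1)%:R) l =
  lam 1 l - X (T l) * lam 1 0.
Proof.
elim/ltn_ind: l => -[|[|l]] IH.
- by rewrite /= mulr0 X0 mul1r subrr.
- by rewrite /= mulr0 lam1 // subrr.
rewrite -[l.+2]addn2 lam_shift //.
have -> : theta (fun j : nat => ((l%:Z - j%:Z) ^+ 1 + (l + j).+1%:Z ^+ 1)%:~R) =
    (2 * l + 1)%:R * psi.
  rewrite -(rmorph_nat (@cst R)) -thetaZ; apply: eq_theta => j.
  by rewrite mulr1 !expr1 pmulrn; congr _%:~R; lia.
have -> : X (T (l + 2)%N) = X (2 * l + 3) * X (T l).
  by rewrite -XD; congr X; have := T2 l; have := T2 (l + 2)%N; nia.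
rewrite addn2 /= mulrCA mulrDr IH ?(leqnSn l) // rmorph_nat; ring.
Qed.

Definition phi2 := theta (fun k => (2 * k + 1)%:R ^+ 2 : R).

(** For [p = 3] the correction contains, besides [(2l + 1)^3 psi], the term [3 (2l + 1) phi2]; a
    multiple of the case [p = 1] removes it, at the price of a second factor [psi]. *)
Lemma psi_appell3 l : psi ^+ 2 * appell (fun k => (2 * k + 1)%:R ^+ 3) l =
  4 * psi * lam 3 l - 3 * phi2 * lam 1 l
   - X (T l) * (4 * psi * lam 3 0 - 3 * phi2 * lam 1 0).
Proof.
elim/ltn_ind: l => -[|[|l]] IH.
- by rewrite /= mulr0 X0 mul1r subrr.
- by rewrite /= mulr0 !lam1 //; ring.
rewrite -[l.+2]addn2 !lam_shift //.
have -> : theta (fun j : nat => ((l%:Z - j%:Z) ^+ 1 + (l + j).+1%:Z ^+ 1)%:~R) =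
    (2 * l + 1)%:R * psi.
  rewrite -(rmorph_nat (@cst R)) -thetaZ; apply: eq_theta => j.
  by rewrite mulr1 !expr1 pmulrn; congr _%:~R; lia.
set t3 := theta (fun j => _).
(* With [u = 2l + 1] and [v = 2j + 1], the weight is [((u - v)^3 + (u + v)^3) / 8 = (u^3 + 3 u v^2)
   / 4]. *)
have E3 : 4 * t3 = (2 * l + 1)%:R ^+ 3 * psi + 3 * (2 * l + 1)%:R * phi2.
  rewrite -!(rmorph_nat (@cst R)) -rmorphXn -rmorphM -!thetaZ -thetaD.
  apply: eq_theta => j.
  rewrite mulr1 intrD !rmorphXn /= intrB -!pmulrn -[(l + j).+1]addn1 !natrD; ring.
have -> : X (T (l + 2)%N) = X (2 * l + 3) * X (T l).
  by rewrite -XD; congr X; have := T2 l; have := T2 (l + 2)%N; nia.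
rewrite addn2 /= mulrCA mulrDr IH ?(leqnSn l) // rmorphXn rmorph_nat.
have -> : 4 * psi * (X (2 * l + 3) * (lam 3 l + t3)) =
  X (2 * l + 3) * psi * (4 * lam 3 l + 4 * t3) by ring.
rewrite E3; ring.
Qed.

End Appell.

(** * Weighted sums over [l] *)

Section Weighted.
Variable R : comNzRingType.
Local Notation X := (X R).
Local Notation geo := (geo R).
Local Notation psi := (psi R).
Local Notation lam := (lam R).
Variable f : int -> R.
Hypothesis f_even : forall l, f (- 1 - l) = f l.

(** The exponents [T (l - i)] with [l < i], reflected by [k -> - 1 - k], supply exactly the [k < i]
    that [T (l + i)] misses; evenness of [f] matches the weights. *)
Lemma theta_translate (i : nat) :
  isum (fun l : nat => cst (f l) * (X (T (l%:Z - i%:Z)) + X (T (l%:Z + i%:Z)))) =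
  theta (fun k : nat => f (k%:Z - i%:Z) + f (k%:Z + i%:Z)).
Proof.
have s1 : summable (fun l : nat => cst (f l) * X (T (l%:Z - i%:Z))).
  by apply: (@summable_low _ i) => l; apply/lowMl/lowX/T_ge; lia.
have s2 : summable (fun l : nat => cst (f l) * X (T (l%:Z + i%:Z))).
  by apply: (@summable_low _ 0) => l; apply/lowMl/lowX/T_ge; lia.
under eq_isum do rewrite mulrDr.
rewrite isumD // (isum_shift i s1) thetaD addrAC; congr (_ + _); last first.
  by apply: eq_isum => k; rewrite PoszD addrK.
rewrite [RHS](isum_shift i (@summable_theta _ _)); congr (_ + _); last first.
  by apply: eq_isum => k; rewrite PoszD addrK.
rewrite (reindex_inj rev_ord_inj); apply: eq_bigr => k _.
rewrite (_ : nat_of_ord (rev_ord k) = (i - k.+1)%N) // -f_even.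
by congr (cst (f _) * X _); last rewrite -T_opp; [|congr T]; have := ltn_ord k; lia.
Qed.

Variable p : nat.
Hypothesis p_odd : odd p.

(** [rho] gathers the summands [x^(T (l + i))] of [lam] by [k = l + i]; [omega] gathers those with a
    factor [geo]. *)
Definition rho : fps R :=
  theta (fun k => \sum_(l < k.+1) f l%:Z * ((k - l) ^ p)%:R).
Definition omega : fps R := isum (fun i => (i ^ p)%:R * geo (2 * i) *
  theta (fun k => f (k%:Z - i%:Z) + f (k%:Z + i%:Z))).

Lemma low_isum e (F : nat -> fps R) : (forall k, low e (F k)) -> low e (isum F).
Proof. by move=> Fe n ne; rewrite (@isumE _ _ _ 0) ?big_ord0 // => k _; apply: Fe. Qed.

Lemma isum_lam : isum (fun l : nat => cst (f l) * lam p l) = rho + omega.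
Proof.
pose u (l i : nat) := (i ^ p)%:R * X (T (l%:Z + i%:Z)).
pose v (l i : nat) := (i ^ p)%:R * geo (2 * i) * (X (T (l%:Z - i%:Z)) + X (T (l%:Z + i%:Z))).
have ul l i : low (l + i) (u l i) by apply/lowMl/lowX/T_ge; lia.
have vl l i : low (maxn l i) (v l i).
  case: i => [|i]; first by rewrite /v exp0n ?odd_gt0 // !mul0r.
  rewrite /v -mulrA mulrDr; apply/lowMl/lowD.
    apply: (@lowW _ _ (2 * i.+1 + (l - i.+1))); first lia.
    by apply: lowM; [apply: low_geo|apply/lowX/T_ge]; lia.
  apply: (@lowW _ _ (2 * i.+1 + l)); first lia.
  by apply: lowM; [apply: low_geo|apply/lowX/T_ge]; lia.
have us l : summable (u l).
  by apply: (@summable_low _ 0) => i; apply: lowW (ul l i); lia.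
have vs l : summable (v l).
  by apply: (@summable_low _ 0) => i; apply: lowW (vl l i); lia.
have lamE l : lam p l%:Z = isum (u l) + isum (v l).
  by rewrite -isumD //; apply: eq_isum => i; rewrite /lam_term /u /v; ring.
under eq_isum do rewrite lamE mulrDr.
rewrite isumD; first congr (_ + _).
- under eq_isum => l.
    rewrite -isumMl //.
    have -> : isum (fun k => cst (f l%:Z) * u l k) = isum (fun k => 
      cst (if (l <= k)%N then f l%:Z * ((k - l) ^ p)%:R else 0) * X (T k%:Z)).
      rewrite [RHS](isum_shift l (@summable_theta _ _)) big1 ?add0r => [|k _]; last first.
        by rewrite leqNgt ltn_ord /= raddf0 mul0r.
      apply: eq_isum => i; rewrite leq_addl addnK rmorphM rmorph_nat /u mulrA PoszD.
      by rewrite (addrC i%:Z).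
    over.
  rewrite isum_exch; last first.
    move=> n; exists n.+1 => l k lk; case: ifP => [lek|_]; last by rewrite raddf0 mul0r.
    by apply: (@low_theta_term _ (fun=> _)); lia.
  apply: eq_isum => k; rewrite isumMr; last first.
    by move=> n; exists k.+1 => l kl; rewrite leqNgt kl /= raddf0.
  congr (_ * _); rewrite (@isum_finite _ k.+1) => [|l kl]; last first.
    by rewrite leqNgt kl /= raddf0.
  by rewrite rmorph_sum; apply: eq_bigr => l _; rewrite -ltnS ltn_ord.
- under eq_isum => l do rewrite -isumMl //.
  rewrite isum_exch => [|n]; last first.
    by exists n.+1 => l i li; apply: (lowMl _ (vl l i)); lia.
  apply: eq_isum => i; rewrite -theta_translate -isumMl; last first.
    have h (c : nat -> fps R) : summable (fun l => c l * X (T (l%:Z - i%:Z))).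
      by apply: (@summable_low _ i) => l; apply/lowMl/lowX/T_ge; lia.
    have h' (c : nat -> fps R) : summable (fun l => c l * X (T (l%:Z + i%:Z))).
      by apply: (@summable_low _ i) => l; apply/lowMl/lowX/T_ge; lia.
    by under eq_fun do rewrite mulrDr; apply: summableD.
  by apply: eq_isum => l; rewrite /v; ring.
- by apply: (@summable_low _ 0) => l; apply/lowMl/low_isum => i; apply: lowW (ul l i); lia.
- by apply: (@summable_low _ 0) => l; apply/lowMl/low_isum => i; apply: lowW (vl l i); lia.
Qed.

End Weighted.

Section Identities.
Variables (R : comNzRingType) (f : int -> R).
Hypothesis f_even : forall l, f (- 1 - l) = f l.
Local Notation psi := (psi R).

Definition appell_sum (w : nat -> R) : fps R :=
  isum (fun l : nat => cst (f l) * appell w l).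

Lemma summable_lam p : odd p -> summable (fun l : nat => cst (f l) * lam R p l%:Z).
Proof.
move=> p_odd; apply: (@summable_low _ 0) => l; rewrite subn0.
apply/lowMl/low_isum => -[|i]; first by rewrite /lam_term exp0n ?odd_gt0 // mul0r.
apply/lowMl/lowD; first by apply/lowX/T_ge; lia.
rewrite mulrDr; apply: lowD.
  apply: (@lowW _ _ (2 * i.+1 + (l - i.+1))); first lia.
  by apply: lowM; [apply: low_geo|apply/lowX/T_ge]; lia.
by apply/lowMl/lowX/T_ge; lia.
Qed.

Let sA w := summable_appell w (fun l : nat => f l).
Let sT := summable_theta (fun l : nat => f l).

Lemma psi_appell_sum : psi * appell_sum (fun k => (2 * k + 1)%:R) =
  rho f 1 + omega f 1 - theta (fun l : nat => f l) * lam R 1 0.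
Proof.
rewrite -isum_lam //; apply/eqP; rewrite eq_sym subr_eq; apply/eqP.
rewrite -(isumMr (lam R 1 0) sT) -(isumMl psi (sA _)) -isumD.
- by apply: eq_isum => l; rewrite mulrCA psi_appell; ring.
- exact: summableMl' _ (sA _).
- by under eq_fun do rewrite mulrC; apply: summableMl' _ sT.
Qed.

Lemma psi_appell_sum3 : psi ^+ 2 * appell_sum (fun k => (2 * k + 1)%:R ^+ 3) =
  4 * psi * (rho f 3 + omega f 3) - 3 * phi2 R * (rho f 1 + omega f 1) -
  theta (fun l : nat => f l) * (4 * psi * lam R 3 0 - 3 * phi2 R * lam R 1 0).
Proof.
rewrite -!isum_lam //; apply/eqP; rewrite eq_sym !subr_eq; apply/eqP.
set K := (_ - _ in X in _ = X).
rewrite -(isumMr K sT) -(isumMl (psi ^+ 2) (sA _)).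
rewrite -(isumMl _ (@summable_lam 1 isT)) -(isumMl _ (@summable_lam 3 isT)) -!isumD.
- by apply: eq_isum => l; rewrite !(mulrCA _ (cst _)) psi_appell3 /K; ring.
- apply: summableD; first exact: summableMl' _ (sA _).
  by under eq_fun do rewrite mulrC; apply: summableMl' _ sT.
- exact: summableMl' _ (summable_lam _).
- exact: summableMl' _ (sA _).
- by under eq_fun do rewrite mulrC; apply: summableMl' _ sT.
Qed.

End Identities.

(** * The Bailey pair *)

Section Bailey.
Variable R : comNzRingType.
Local Notation X := (X R).
Local Notation geo := (geo R).
Local Notation psi := (psi R).
Implicit Types f g h : fps R.

Definition eqm (N : nat) f g := forall n, (n < N)%N -> f n = g n.
Lemma eqmW M N f g : (M <= N)%N -> eqm N f g -> eqm M f g.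
Proof. by move=> MN fg n nM; apply/fg/(leq_trans nM). Qed.
Lemma eqm_trans N f g h : eqm N f g -> eqm N g h -> eqm N f h.
Proof. by move=> fg gh n nN; rewrite fg ?gh. Qed.
Lemma eqm_low N f g : eqm N f g <-> low N (f - g).
Proof.
split=> fg n nN; first by rewrite fpsBE fg ?subrr.
by apply/eqP; rewrite -subr_eq0 -fpsBE fg.
Qed.
Lemma eqmD N f f' g g' : eqm N f f' -> eqm N g g' -> eqm N (f + g) (f' + g').
Proof. by move=> ff gg n nN; rewrite !fpsDE ff ?gg. Qed.
Lemma eqmM N f f' g g' : eqm N f f' -> eqm N g g' -> eqm N (f * g) (f' * g').
Proof.
move=> ff gg n nN; rewrite !fpsME; apply: eq_bigr => i _.
have iN : (i < N)%N by apply: leq_ltn_trans nN; rewrite -ltnS.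
by rewrite ff // gg // (leq_ltn_trans (leq_subr _ _)).
Qed.
Lemma eqm_sum N (I : Type) (r : seq I) (P : pred I) (F G : I -> fps R) :
  (forall i, P i -> eqm N (F i) (G i)) ->
  eqm N (\sum_(i <- r | P i) F i) (\sum_(i <- r | P i) G i).
Proof. by move=> FG; apply: (big_ind2 (eqm N)) => //; move=> *; apply: eqmD. Qed.
Lemma eqm_prod N (I : Type) (r : seq I) (P : pred I) (F G : I -> fps R) :
  (forall i, P i -> eqm N (F i) (G i)) ->
  eqm N (\prod_(i <- r | P i) F i) (\prod_(i <- r | P i) G i).
Proof. by move=> FG; apply: (big_ind2 (eqm N)) => //; move=> *; apply: eqmM. Qed.
Lemma eqm1D N f : low N f -> eqm N (1 + f) 1.
Proof. by move=> f0 n nN; rewrite fpsDE f0 ?addr0. Qed.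
Lemma eqm1B N f : low N f -> eqm N (1 - f) 1.
Proof. by move=> f0 n nN; rewrite fpsBE f0 ?subr0. Qed.
(* Multiplication by a series of order [d] gains [d] coefficients of precision. *)
Lemma eqm_lowM d N f g h : low d h -> eqm N f g -> eqm (d + N) (h * f) (h * g).
Proof. by move=> hd /eqm_low fg; apply/eqm_low; rewrite -mulrBr; apply: lowM. Qed.

(* [Qp n], [J n], [I n] are [(x^2; x^2)_n], [1 / (x^2; x^2)_n], [1 / (x; x)_n]. *)
Definition Qp n : fps R := \prod_(k < n) (1 - X (2 * k + 2)).
Definition J n : fps R := \prod_(k < n) (1 + geo (2 * k + 2)).
Definition I n : fps R := \prod_(k < n) (1 + geo k.+1).

Lemma QpS n : Qp n.+1 = Qp n * (1 - X (2 * n + 2)). Proof. by rewrite /Qp big_ord_recr. Qed.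
Lemma JS n : J n.+1 = J n * (1 + geo (2 * n + 2)). Proof. by rewrite /J big_ord_recr. Qed.
Lemma IS n : I n.+1 = I n * (1 + geo n.+1). Proof. by rewrite /I big_ord_recr. Qed.

Lemma QpJ n : Qp n * J n = 1.
Proof.
elim: n => [|n IH]; first by rewrite /Qp /J !big_ord0 mulr1.
by rewrite QpS JS mulrACA IH mul1r geo_inv //; lia.
Qed.

Lemma J_pred n : J n.+1 * (1 - X (2 * n.+1)) = J n.
Proof.
rewrite JS (_ : 2 * n.+1 = 2 * n + 2)%N; last lia.
by rewrite -mulrA (mulrC (1 + _)) geo_inv ?mulr1 //; lia.
Qed.

(** A Bailey pair in base [x^2]: for [n = 2s] and [a = s - r] or [s + r], it pairs
    [beta_s = 1 / (x; x)_(2s)] with [alpha_r = x^(T (2r-1)) + x^(T (2r))]. *)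
Lemma bailey n : I n = \sum_(a < n.+1) X (T (n%:Z - 2 * a%:Z - 1)) * (J a * J (n - a)).
Proof.
pose t (m a : nat) := X (T (m%:Z - 2 * a%:Z - 1)).
rewrite -[RHS]/(\sum_(a < n.+1) t n a * (J a * J (n - a))).
pose F m := \sum_(a < m.+1) t m a * (J a * J (m - a)).
elim: n => [|n IH].
  by rewrite /I big_ord0 big_ord1 /J !big_ord0 /t !mulr1.
suff rec : F n.+1 * (1 - X n.+1) = F n.
  rewrite IS IH -/(F n) -rec -/(F n.+1) -mulrA geo_inv // mulr1 //.
rewrite mulrBr mulr1.
(* Reversing the sum turns the factor [x^(n+1)] into [x^(2(n+1-a))], and [1 - x^(2(n+1-a))] cancels
   the last factor of [J (n+1-a)]. *)
have -> : F n.+1 * X n.+1 = \sum_(a < n.+2) t n.+1 a * X (2 * (n.+1 - a)) * (J a * J (n.+1 - a)).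
  rewrite /F mulr_suml [RHS](reindex_inj rev_ord_inj); apply: eq_bigr => a _.
  have lea : (a <= n.+1)%N by rewrite -ltnS.
  rewrite (_ : nat_of_ord (rev_ord a) = n.+1 - a)%N // subKn // (mulrC (J (_ - _))).
  rewrite [LHS]mulrAC /t -!XD; congr (X _ * _).
  have := T2 (n.+1%:Z - 2 * a%:Z - 1).
  by have := T2 (n.+1%:Z - 2 * (n.+1 - a)%N%:Z - 1); nia.
rewrite -sumrB big_ord_recr /= subnn muln0 X0 mulr1 subrr addr0.
rewrite /F [RHS](reindex_inj rev_ord_inj); apply: eq_bigr => a _.
have lea : (a <= n)%N by rewrite -ltnS.
rewrite (_ : nat_of_ord (rev_ord a) = n - a)%N // subKn // -mulrBl -{1}[t _ _]mulr1 -mulrBr.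
rewrite subSn // -(J_pred (n - a)).
have -> : t n (n - a)%N = t n.+1 a.
  congr X; have := T2 (n%:Z - 2 * (n - a)%N%:Z - 1).
  by have := T2 (n.+1%:Z - 2 * a%:Z - 1); nia.
ring.
Qed.

(* [U s r] is [(Q)_s^2 / ((Q)_{s-r} (Q)_{s+r})] and telescopes the conjugate pair. *)
Definition U s r : fps R := Qp s ^+ 2 * (J (s - r) * J (s + r)).

Lemma U_step s r : (r <= s)%N ->
  X (2 * r) * (U s.+1 r - U s r) =
  (1 - X (2 * r)) ^+ 2 * (X (2 * s.+1) * Qp s ^+ 2 * (J (s.+1 - r) * J (s.+1 + r))).
Proof.
move=> rs; rewrite /U subSn // addSn -(J_pred (s - r)) -(J_pred (s + r)) QpS.
have -> : X (2 * s + 2) = X (2 * s.+1) by congr X; lia.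
have e1 : X (2 * r) * X (2 * (s - r).+1) = X (2 * s.+1) by rewrite -XD; congr X; lia.
have e2 : X (2 * (s + r).+1) = X (2 * r) * X (2 * s.+1) by rewrite -XD; congr X; lia.
rewrite e2.
transitivity (Qp s ^+ 2 * J (s - r).+1 * J (s + r).+1 *
  (X (2 * r) * (1 - X (2 * s.+1)) ^+ 2 -
   (X (2 * r) - X (2 * r) * X (2 * (s - r).+1)) * (1 - X (2 * r) * X (2 * s.+1)))); first ring.
by rewrite e1; ring.
Qed.

Lemma U_start r : (0 < r)%N ->
  X (2 * r) * U r r =
  (1 - X (2 * r)) ^+ 2 * (X (2 * r) * Qp r.-1 ^+ 2 * (J (r - r) * J (r + r))).
Proof.
case: r => // r _; rewrite /U QpS /=.
by have -> : X (2 * r + 2) = X (2 * r.+1); [congr X; lia|ring].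
Qed.

(** The conjugate Bailey pair [delta_s = x^(2s) (x^2; x^2)_(s-1)^2],
    [gamma_r = x^(2r) / (1 - x^(2r))^2] in finite form: the summands are differences of [U], and
    [U N r] tends to 1. *)
Lemma conj_bailey N r : (0 < r <= N)%N ->
  \sum_(r <= s < N.+1) X (2 * s) * Qp s.-1 ^+ 2 * (J (s - r) * J (s + r)) =
  geo (2 * r) * (1 + geo (2 * r)) * U N r.
Proof.
move=> /andP[r0 rN]; rewrite {1}geoE; last lia.
set g := geo _; have gi : (1 - X (2 * r)) * (1 + g) = 1 by apply: geo_inv; lia.
suff E : (1 - X (2 * r)) ^+ 2 *
    \sum_(r <= s < N.+1) X (2 * s) * Qp s.-1 ^+ 2 * (J (s - r) * J (s + r)) = X (2 * r) * U N r.
  transitivity ((1 + g) ^+ 2 * (X (2 * r) * U N r)); last ring.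
  by rewrite -E mulrA -exprMn (mulrC (1 + g)) gi expr1n mul1r.
elim: N rN => [|N IH] rN; first lia.
rewrite big_nat_recr //= mulrDr.
have [rN'|Nr] := leqP r N; first by rewrite IH // -U_step //; ring.
have -> : r = N.+1 by lia.
by rewrite big_geq // mulr0 add0r -U_start.
Qed.

(** At [r = 0] the factor [1 - x^(2r)] vanishes and nothing telescopes; these summands are kept and
    add up to a Lambert series. *)
Lemma conj_bailey0 s : (0 < s)%N ->
  X (2 * s) * Qp s.-1 ^+ 2 * (J s * J s) = geo (2 * s) * (1 + geo (2 * s)).
Proof.
case: s => // s _; rewrite {1}[in RHS]geoE /=; last lia.
rewrite JS (_ : 2 * s + 2 = 2 * s.+1)%N; last lia.
transitivity (X (2 * s.+1) * (Qp s * J s) ^+ 2 * (1 + geo (2 * s.+1)) ^+ 2); first ring.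
by rewrite QpJ; ring.
Qed.

Lemma Qp_eqm a b : (a <= b)%N -> eqm (2 * a + 2) (Qp b) (Qp a).
Proof.
elim: b => [|b IH] ab; first by have -> : a = 0%N by lia.
have [ab'|ba] := leqP a b; last by have -> : a = b.+1 by lia.
rewrite QpS -[Qp a]mulr1; apply: eqmM; first exact: IH.
by apply/eqm1B/lowX; lia.
Qed.

Lemma J_eqm a b : (a <= b)%N -> eqm (2 * a + 2) (J b) (J a).
Proof.
elim: b => [|b IH] ab; first by have -> : a = 0%N by lia.
have [ab'|ba] := leqP a b; last by have -> : a = b.+1 by lia.
rewrite JS -[J a]mulr1; apply: eqmM; first exact: IH.
by apply/eqm1D; apply: (@lowW _ _ (2 * b + 2)); [lia|apply: low_geo; lia].
Qed.

Lemma U_eqm N r : (r <= N)%N -> eqm (2 * (N - r) + 2) (U N r) 1.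
Proof.
move=> rN; have -> : U N r = (Qp N * J (N - r)) * (Qp N * J (N + r)) by rewrite /U; ring.
have -> : 1 = (Qp (N - r) * J (N - r)) * (Qp N * J N) by rewrite !QpJ mulr1.
apply: eqmM; apply: eqmM => //; first by apply: Qp_eqm; lia.
by apply: eqmW (J_eqm _); lia.
Qed.

(** [U N r] is 1 only up to order [2(N - r) + 2]; a factor of order at least [2r - 1] restores the
    lost precision. *)
Lemma XU_eqm N r e : (r <= N)%N -> (2 * r <= e + 1)%N ->
  eqm (2 * N + 1) (X e * U N r) (X e).
Proof.
move=> rN re; rewrite -[X in eqm _ _ X]mulr1.
apply: (@eqmW _ (e + (2 * (N - r) + 2))); first lia.
by apply: eqm_lowM; [apply: lowX|apply: U_eqm].
Qed.

Lemma bailey_even s : I (2 * s) = J s * J s +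
  \sum_(1 <= r < s.+1) (X (T (2 * r%:Z - 1)) + X (T (2 * r)%N)) * (J (s - r) * J (s + r)).
Proof.
rewrite bailey -(big_mkord xpredT
  (fun a => X (T ((2 * s)%N%:Z - 2 * a%:Z - 1)) * (J a * J (2 * s - a)))).
rewrite (big_cat_nat (n := s)) //=; last lia.
rewrite (big_cat_nat (n := s.+1) (m := s)) //=; last lia.
rewrite big_nat1 addrCA; congr (_ + _).
  rewrite (_ : 2 * s - s = s)%N; last lia.
  by rewrite (_ : (2 * s)%N%:Z - 2 * s%:Z - 1 = -1) ?mul1r //; lia.
rewrite [in RHS]big_add1 /=; under [RHS]eq_bigr do rewrite mulrDl.
rewrite big_split; congr (_ + _).
  rewrite !big_mkord (reindex_inj rev_ord_inj); apply: eq_bigr => a _ /=.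
  have := ltn_ord a => lea; rewrite (_ : 2 * s - (s - a.+1) = s + a.+1)%N; last lia.
  by congr (X (T _) * _); lia.
rewrite -{1}[s.+1]add0n big_addn (_ : (2 * s).+1 - s.+1 = s)%N; last lia.
rewrite !big_mkord; apply: eq_bigr => a _; have := ltn_ord a => lea.
rewrite (_ : 2 * s - (a + s.+1) = s - a.+1)%N; last lia.
rewrite (_ : a + s.+1 = s + a.+1)%N; last lia.
rewrite (mulrC (J _)) -T_opp; congr (X (T _) * _); lia.
Qed.

Definition O n : fps R := \prod_(k < n) (1 + geo (2 * k).+1).

Lemma I_even n : I (2 * n) = J n * O n.
Proof.
elim: n => [|n IH]; first by rewrite /I /J /O !big_ord0 mulr1.
rewrite (_ : 2 * n.+1 = (2 * n).+2)%N; last lia.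
rewrite !IS IH JS /O big_ord_recr /= -/(O n) (_ : 2 * n + 2 = (2 * n).+2)%N; last lia.
ring.
Qed.

Lemma psi_eqm N : eqm N psi (\sum_(k < N) X (T k)).
Proof.
move=> n nN; rewrite fps_sumE /psi /theta (@isumE _ _ _ N) => [|k Nk].
  by apply: eq_bigr => k _; rewrite rmorph1 mul1r.
by apply: low_theta_term; apply: leq_trans Nk.
Qed.

(* Gauss's product for the theta series [psi]. *)
Lemma psi_product N : eqm (2 * N + 1) (Qp N * O N) psi.
Proof.
have -> : Qp N * O N = Qp N ^+ 2 * I (2 * N).
  by rewrite I_even -[LHS]mul1r -(QpJ N); ring.
rewrite bailey_even; have -> : psi = 0 + psi by rewrite add0r.
apply: (@eqm_trans _ _ (\sum_(k < 2 * N + 1) X (T k))); last first.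
  by move=> n nN; rewrite add0r (psi_eqm nN).
have -> M : \sum_(k < 2 * M + 1) X (T k) =
    1 + \sum_(1 <= r < M.+1) (X (T (2 * r%:Z - 1)) + X (T (2 * r)%N)).
  elim: M => [|M IH]; first by rewrite big_ord1 big_geq ?addr0.
  rewrite (_ : 2 * M.+1 + 1 = (2 * M + 1).+2)%N; last lia.
  rewrite !big_ord_recr /= IH [in RHS]big_nat_recr //= -!addrA; congr (_ + (_ + (X _ + X _))).
    by congr T; lia.
  by congr (T (Posz _)); lia.
rewrite mulrDr (_ : Qp N ^+ 2 * (J N * J N) = (Qp N * J N) ^+ 2); last ring.
rewrite QpJ expr1n mulr_sumr; apply: eqmD => //.
rewrite big_nat_cond [X in eqm _ _ X]big_nat_cond; apply: eqm_sum => r.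
move=> /andP[/andP[r0 rN] _].
rewrite (_ : _ * _ = X (T (2 * r%:Z - 1)) * U N r + X (T (2 * r)%N) * U N r); last first.
  by rewrite /U; ring.
apply: eqmD; apply: XU_eqm => //.
  have : (2 * r - 1 <= T (2 * r%:Z - 1))%N by apply: T_ge; lia.
  lia.
have : (2 * r <= T (2 * r)%N)%N by apply: T_ge; lia.
lia.
Qed.

Definition lambert p : fps R := isum (fun i => (i ^ p)%:R * geo (2 * i)).

Lemma geo_isum e : (0 < e)%N -> geo e = isum (fun k => X (e * k.+1)).
Proof.
move=> e0; apply: fpsP => n; rewrite (@isumE _ _ _ n) => [|k nk]; last first.
  by apply: (@lowX _ _ (n.+1)) => //; nia.
rewrite /geo /X; case: (boolP ((0 < n) && _)%N) => [/andP[n0 /dvdnP[q qe]]|en].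
  have q0 : (0 < q)%N by nia.
  have qn : (q.-1 < n)%N by nia.
  rewrite (bigD1 (Ordinal qn)) //= big1 => [|k kq]; rewrite ?addr0.
    by rewrite prednK // {1}qe mulnC eqxx.
  rewrite (_ : _ == _ = false) //; apply/negP => /eqP nE; case/eqP: kq.
  apply: val_inj => /=; have /eqP := etrans (esym qe) nE.
  by rewrite mulnC eqn_pmul2l // => /eqP ->.
rewrite big1 // => k _; rewrite (_ : _ == _ = false) //; apply/negP => /eqP nE.
by rewrite nE muln_gt0 e0 dvdn_mulr in en.
Qed.

Lemma geo2_isum e : (0 < e)%N -> geo e * (1 + geo e) = isum (fun k => k.+1%:R * X (e * k.+1)).
Proof.
move=> e0; pose D : nat -> fps R := fun k => k.+1%:R * X (e * k.+1).
have Ds : summable D.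
  by apply: (@summable_low _ 0) => k; apply/lowMl/lowX; nia.
have Gs : summable (fun k => X (e * k.+1)).
  by apply: (@summable_low _ 0) => k; apply/lowX; nia.
have E : isum D = X e * isum D + geo e.
  rewrite (geo_isum e0) (isum_shift 1 Gs) {1}(isum_shift 1 Ds) !big_ord1 addrCA.
  rewrite (_ : D _ = X (e * 1)); last by rewrite /D mul1r.
  congr (_ + _); rewrite -isumMl // -isumD; last exact: (summable_shift 1 Gs).
    by apply: eq_isum => k; rewrite /D addn1 mulnS XD [k.+2%:R]mulrS; ring.
  exact: summableMl'.
have E' : (1 - X e) * isum D = geo e by rewrite mulrBl mul1r [X in X - _]E; ring.
transitivity ((1 - X e) * (1 + geo e) * isum D); last by rewrite geo_inv ?mul1r.
by rewrite mulrAC E'.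
Qed.

(** Each [geo] is expanded as a geometric series and [i] is summed first. *)
Lemma lambert_sum : lambert 1 = isum (fun k => geo (2 * k.+1) * (1 + geo (2 * k.+1))).
Proof.
transitivity (isum (fun i => isum (fun k => i%:R * X (2 * i * k.+1)))).
  apply: eq_isum => -[|i]; rewrite expn1; first by
    rewrite mul0r (@isum_finite _ 0) ?big_ord0 // => k; rewrite mul0r.
  rewrite geo_isum // isumMl //; apply: (@summable_low _ 0) => k; apply/lowX; nia.
rewrite isum_exch => [|n].
  apply: eq_isum => k; rewrite geo2_isum //.
  rewrite (@isum_shift _ 1) ?big_ord1 ?mul0r ?add0r; last first.
    by apply: (@summable_low _ 0) => i; apply/lowMl/lowX; nia.
  by apply: eq_isum => i; rewrite addn1; congr (_ * X _); nia.
exists n.+1 => -[|i] k nik; first by rewrite mul0r.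
by apply: (@lowMl _ (n.+1)) => //; apply: lowX; nia.
Qed.

Lemma lambert_eqm N : eqm N.+1
  (\sum_(1 <= s < N.+1) geo (2 * s) * (1 + geo (2 * s))) (lambert 1).
Proof.
move=> n nN; rewrite lambert_sum big_add1 big_mkord fps_sumE /=; symmetry.
by apply: isumE => k Nk; apply: (@lowMr R (2 * k.+1)); [apply: low_geo; lia|lia].
Qed.

Definition weight (k : nat) : R := (2 * k + 1)%:R.
Definition appell_total : fps R := isum (fun l => appell weight l).

(** The exponent is [T l - T (l - 2n) = n (2l - 2n + 1)], shifted to [n.+1]. *)
Lemma appellE w l : appell w l = \sum_(n < l) if (2 * n.+1 <= l)%N then
  cst (w (l - 2 * n.+1)%N) * X (n.+1 * (2 * l - 2 * n.+1 + 1)) else 0.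
Proof.
elim/ltn_ind: l => -[|[|l]] IH; rewrite ?big_ord0 ?big_ord1 //.
rewrite big_ord_recl big_ord_recr /= IH // mulrDr [LHS]addrC [in X in X + _](mulrC _ (cst _)); congr (_ + _).
  by rewrite muln1; congr (cst (w _) * X _); lia.
rewrite [if _ then _ else 0]ifF ?addr0; last by rewrite /bump /=; lia.
rewrite mulr_sumr; apply: eq_bigr => n _ /=; rewrite /bump /= add1n.
rewrite (_ : (2 * n.+2 <= l.+2) = (2 * n.+1 <= l))%N; last by lia.
case: ifP => nl; last by rewrite mulr0.
rewrite mulrCA -XD; congr (cst (w _) * X _); nia.
Qed.

(** With [k = l - 2r] and [y = x^(2r)] the inner sum is [x^(T (2r))] times
    [sum_k (2k + 1) y^k = (1 + y) / (1 - y)^2]; then [T (2r) = T (2r-1) + 2r] is used to pull out a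
    factor [y]. *)
Lemma appell_total_sum : appell_total = isum (fun n =>
  (X (T (2 * n.+1%:Z - 1)) + X (T (2 * n.+1)%N)) * (geo (2 * n.+1) * (1 + geo (2 * n.+1)))).
Proof.
pose t l n := if (2 * n.+1 <= l)%N then
  cst (weight (l - 2 * n.+1)%N) * X (n.+1 * (2 * l - 2 * n.+1 + 1)) else 0.
transitivity (isum (fun l => isum (t l))).
  apply: eq_isum => l; rewrite appellE (@isum_finite _ l) // => n ln.
  by rewrite /t leqNgt ifF //; lia.
rewrite isum_exch => [|N]; last first.
  exists N.+1 => l n lnN; rewrite /t; case: ifP => // nl.
  by apply: (@lowMl _ N.+1) => //; apply: lowX; nia.
apply: eq_isum => n; set r := n.+1; set g := geo _.
have gE : g = X (2 * r) * (1 + g) by apply: geoE.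
have ts : summable (t^~ n).
  move=> N; exists N.+1 => l lN; rewrite /t; case: ifP => // nl.
  by apply: (@lowMl _ N.+1) => //; apply: lowX; nia.
rewrite (isum_shift (2 * r) ts) big1 ?add0r => [|k _]; last first.
  by rewrite /t ifF //; have := ltn_ord k; lia.
have T1 : X (T (2 * r%:Z - 1)) * X (2 * r) = X (T (2 * r)%N).
  by rewrite -XD; congr X; have := T2 (2 * r%:Z - 1); have := T2 (2 * r)%N; nia.
have sg (c : nat -> fps R) i : summable (fun k => c k * X (2 * r * (k + i))).
  by apply: (@summable_low _ 0) => k; apply/lowMl/lowX; nia.
transitivity (X (T (2 * r)%N) * isum (fun k => (2 * k + 1)%:R * X (2 * r * (k + 0)))).
  rewrite -isumMl //; apply: eq_isum => k; rewrite /t leq_addl addnK mulrCA -XD addn0.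
  rewrite rmorph_nat; congr (_ * X _).
  by have := T2 (2 * r)%N; nia.
rewrite (isum_shift 1) // big_ord1 mul1r muln0 X0.
have -> : isum (fun k => (2 * (k + 1) + 1)%:R * X (2 * r * (k + 1 + 0))) =
    2 * (g * (1 + g)) + g.
  rewrite geo2_isum // /g geo_isum // -isumMl -?isumD.
  - by apply: eq_isum => k; rewrite addn0 (addn1 k) natrD natrM; ring.
  - by apply: summableMl'; apply: (@summable_low _ 0) => k; apply/lowMl/lowX; nia.
  - by apply: (@summable_low _ 0) => k; apply/lowX; nia.
  - by apply: (@summable_low _ 0) => k; apply/lowMl/lowX; nia.
have E : X (T (2 * r%:Z - 1)) * (g * (1 + g)) = X (T (2 * r)%N) * (1 + g) ^+ 2.
  by rewrite -T1 {1}gE; ring.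
by rewrite [RHS]mulrDl E; ring.
Qed.

Lemma appell_total_eqm N : eqm N.+1 (\sum_(1 <= r < N.+1)
  (X (T (2 * r%:Z - 1)) + X (T (2 * r)%N)) * (geo (2 * r) * (1 + geo (2 * r)))) appell_total.
Proof.
move=> n nN; rewrite appell_total_sum big_add1 big_mkord fps_sumE; symmetry.
by apply: isumE => k Nk; apply: (@lowMl R (2 * k.+1)); [apply/lowMr/low_geo; lia|lia].
Qed.

(** Bailey's lemma: after [bailey_even], the sums over [r] and [s] are exchanged and [s] is summed
    by the conjugate pair. The terms [r = 0] give the Lambert series, the others the Appell sum. *)
Lemma bailey_sum N : eqm N.+1
  (\sum_(1 <= s < N.+1) X (2 * s) * Qp s.-1 ^+ 2 * I (2 * s))
  (lambert 1 + appell_total).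
Proof.
have -> : \sum_(1 <= s < N.+1) X (2 * s) * Qp s.-1 ^+ 2 * I (2 * s) =
   \sum_(1 <= s < N.+1) geo (2 * s) * (1 + geo (2 * s)) +
   \sum_(1 <= r < N.+1) (X (T (2 * r%:Z - 1)) + X (T (2 * r)%N)) *
     (geo (2 * r) * (1 + geo (2 * r)) * U N r).
  under eq_bigr => s _ do rewrite bailey_even mulrDr.
  rewrite big_split; congr (_ + _).
    by rewrite !big_nat; apply: eq_bigr => s /andP[s0 _]; rewrite conj_bailey0.
  transitivity (\sum_(1 <= s < N.+1) \sum_(1 <= r < N.+1 | (r < s.+1)%N)
      (X (T (2 * r%:Z - 1)) + X (T (2 * r)%N)) *
      (X (2 * s) * Qp s.-1 ^+ 2 * (J (s - r) * J (s + r)))).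
    rewrite !big_nat; apply: eq_bigr => s /andP[s0 sN].
    rewrite mulr_sumr (big_nat_widen _ _ N.+1) //=; apply: eq_bigr => r _; ring.
  rewrite (exchange_big_dep_nat xpredT) //= !big_nat; apply: eq_bigr => r /andP[r0 rN].
  rewrite -mulr_sumr -conj_bailey ?r0 //; congr (_ * _).
  by rewrite [RHS](big_nat_widenl _ 1).
apply: eqmD; first exact: lambert_eqm.
apply: eqm_trans (@appell_total_eqm N).
rewrite big_nat_cond [X in eqm _ _ X]big_nat_cond; apply: eqm_sum => r.
move=> /andP[/andP[r0 rN] _].
rewrite -[X in eqm _ _ X]mulr1 mulrA.
apply: (@eqmW _ (2 * r + (2 * (N - r) + 2))); first lia.
apply: eqm_lowM; last by apply: U_eqm; rewrite -ltnS.
by apply/lowMl/lowMr/low_geo; lia.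
Qed.

End Bailey.

(** * The generating function of [M2spt] *)

(** The even smallest part is [i + 1]. It is enough to forbid smaller parts, since a partition with
    [m i = 0] contributes 0. *)
Lemma M2spt_by_smallest n : M2spt n =
  (\sum_(i < n | odd i) \sum_(m : {ffun 'I_n -> 'I_n.+1} |
     [&& is_partition_of m, no_rep_odd m & [forall j : 'I_n, (j < i)%N ==> (m j == 0 :> nat)]])
     m i)%N.
Proof.
pose t (i : 'I_n) (m : {ffun 'I_n -> 'I_n.+1}) : nat := if odd i then
  if [&& is_partition_of m, no_rep_odd m & [forall j : 'I_n, (j < i)%N ==> (m j == 0 :> nat)]]
  then m i : nat else 0%N else 0%N.
transitivity (\sum_(i < n) \sum_m t i m)%N; last first.
  rewrite [RHS]big_mkcond; apply: eq_bigr => i _; rewrite /t.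
  by case: ifP => _; [rewrite [RHS]big_mkcond|rewrite big1].
rewrite exchange_big /M2spt big_mkcond; apply: eq_bigr => m _ /=.
rewrite /num_smallest /t.
case: (boolP (is_partition_of m)) => //= _; last by rewrite big1 // => i _; rewrite if_same.
case: (boolP (no_rep_odd m)) => //= _; last by rewrite big1 // => i _; rewrite if_same.
have uniq_smallest i j : is_smallest m i -> is_smallest m j -> i = j.
  move=> /andP[mi /forallP Hi] /andP[mj /forallP Hj]; apply: val_inj => /=.
  have := Hi j; have := Hj i; rewrite !implybE.
  by case: (ltngtP i j) => //= _; rewrite ?(gtn_eqF mi) ?(gtn_eqF mj).
have E i : is_smallest m i -> smallest_even m = odd i.
  move=> si; apply/existsP/idP => [[j /andP[sj]]|oi]; last by exists i; rewrite si /= oi.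
  by rewrite (uniq_smallest i j) //= negbK.
transitivity (\sum_(i < n) if is_smallest m i && odd i then m i : nat else 0)%N.
  case: (boolP (smallest_even m)) => se.
    rewrite big_mkcond; apply: eq_bigr => i _.
    by case: (boolP (is_smallest m i)) => // /E <-; rewrite se.
  rewrite big1 // => i _; case: (boolP (is_smallest m i)) => //= /E <-.
  by rewrite (negbTE se).
apply: eq_bigr => i _; rewrite /is_smallest.
by case: (odd i); rewrite ?andbF // andbT; case: posnP => [->|_] //=; rewrite if_same.
Qed.

Section GeneratingFunction.
Variable R : comNzRingType.
Local Notation X := (X R).
Local Notation geo := (geo R).
Local Notation psi := (psi R).

(* The generating function of [M2spt] at [q = - x]. *)
Definition Mser : fps R := fun n => (-1) ^+ n * (M2spt n)%:R.

Definition Y e : fps R := (-1) ^+ e * X e.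

Lemma YD d e : Y (d + e) = Y d * Y e.
Proof. by rewrite /Y XD exprD; ring. Qed.

Lemma Y_sum (I : Type) (r : seq I) (P : pred I) (F : I -> nat) :
  Y (\sum_(i <- r | P i) F i) = \prod_(i <- r | P i) Y (F i).
Proof. by apply: (big_morph Y YD); rewrite /Y mul1r. Qed.

Lemma YE e n : Y e n = if n == e then (-1) ^+ n else 0.
Proof.
rewrite /Y -(rmorphN1 (@cst R)) -rmorphXn cstM /X.
by case: eqP => [->|_]; rewrite ?mulr1 ?mulr0.
Qed.

(* The weight of [t] parts of size [j + 1] when the smallest part is [i + 1]. *)
Definition part_weight (i j t : nat) : nat :=
  if (j < i)%N then nat_of_bool (t == 0%N) else if j == i then t
  else nat_of_bool (~~ odd j ==> (t <= 1)%N).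

Lemma Mser_coef n : Mser n = (\sum_(i < n | odd i) \prod_(j < n)
  \sum_(t < n.+1) (part_weight i j t)%:R * Y (j.+1 * t)) n.
Proof.
rewrite fps_sumE /Mser M2spt_by_smallest natr_sum mulr_sumr; apply: eq_bigr => i oi.
rewrite bigA_distr_bigA fps_sumE natr_sum mulr_sumr big_mkcond; apply: eq_bigr => m _.
rewrite big_split /= -natr_prod -Y_sum fpsnatM YE eq_sym -/(is_partition_of m).
case: (is_partition_of m) => /=; last by rewrite mulr0.
suff -> : (\prod_(j < n) part_weight i j (m j) =
   if no_rep_odd m && [forall j : 'I_n, (j < i)%N ==> (m j == 0 :> nat)] then (m i : nat) else 0)%N.
  by case: ifP => _; rewrite ?mul0r // mulrC.
rewrite (bigD1 i) //= {1}/part_weight ltnn eqxx.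
case: ifP => [/andP[/forallP nr /forallP z]|].
  rewrite big1 ?muln1 // => j ji; rewrite /part_weight.
  case: ltnP => ij; first by rewrite (implyP (z j) ij).
  by rewrite -val_eqE in ji; have := nr j; rewrite (negbTE ji) /= => ->.
move=> /negbT; rewrite negb_and => /orP[|] /forallPn [j]; rewrite negb_imply.
  case: (eqVneq j i) => [->|ji]; first by rewrite /= oi.
  move=> /andP[oj mj]; rewrite (bigD1 j) //= /part_weight.
  case: ltnP => ij.
    have -> : (m j == 0 :> nat) = false by apply/negbTE; apply: contraNneq mj => ->.
    by rewrite mul0n muln0.
  rewrite -val_eqE in ji; move: oj => /= oj.
  by rewrite (negbTE ji) oj (negbTE mj) mul0n muln0.
move=> /andP[ji mj]; rewrite (bigD1 j) //=; last by rewrite -val_eqE ltn_eqF.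
by rewrite /part_weight ji (negbTE mj) mul0n muln0.
Qed.


(** The factor of the parts [j + 1] at [q = - x]: an even part is free, an odd part occurs at most
    once and its [1 + q^(j+1)] becomes [1 - x^(j+1)]. *)
Definition phi (j : nat) : fps R := if odd j then 1 + geo j.+1 else 1 - X j.+1.

Lemma part_factor n i j : (i <= j)%N -> (j < n)%N -> odd i ->
  eqm n.+1 (\sum_(t < n.+1) (part_weight i j t)%:R * Y (j.+1 * t))
    (if j == i then geo i.+1 * (1 + geo i.+1) else phi j).
Proof.
move=> ij jn oi; have Ye t : odd j -> Y (j.+1 * t) = X (j.+1 * t).
  by move=> oj; rewrite /Y -signr_odd oddM /= oj mul1r.
rewrite /part_weight ltnNge ij /=; case: eqVneq => [ji|ji].
  have oj : odd j by rewrite ji.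
  under eq_bigr do rewrite Ye //.
  rewrite ji geo2_isum // big_ord_recl mul0r add0r => m mn.
  rewrite fps_sumE; symmetry; apply: isumE => k nk.
  by apply: (@lowMl _ n.+1) => //; apply: lowX; nia.
rewrite /phi; case: ifP => oj.
  under eq_bigr do rewrite Ye // mul1r.
  rewrite geo_isum // big_ord_recl muln0 X0 => m mn.
  rewrite !fpsDE fps_sumE; congr (_ + _); symmetry; apply: isumE => k nk.
  by apply: (@lowX _ _ n.+1) => //; nia.
case: n jn => // n jn; rewrite !big_ord_recl big1 ?addr0 => [|t _]; last by rewrite mul0r.
rewrite /= !mul1r muln0 /Y X0 mul1r muln1.
by rewrite -signr_odd /= oj expr1 mulN1r.
Qed.

Lemma Mser_eqm N : eqm N.+1 Mser (\sum_(1 <= s < N.+1)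
  geo (2 * s) * (1 + geo (2 * s)) *
  \prod_(s <= k < N) ((1 - X (2 * k + 1)) * (1 + geo (2 * k + 2)))).
Proof.
move=> n nN; pose f i := geo i.+1 * (1 + geo i.+1) * \prod_(i.+1 <= j < 2 * N) phi j.
have phi1 j : eqm j.+1 (phi j) 1.
  by rewrite /phi; case: ifP => _; [apply/eqm1D/low_geo|apply/eqm1B/lowX].
have -> : Mser n = (\sum_(i < n | odd i) f i) n.
  rewrite Mser_coef; apply: (@eqm_sum _ n.+1) => // i oi; rewrite /f.
  have iN : (i < 2 * N)%N by have := ltn_ord i; lia.
  pose S j := \sum_(t < n.+1) (part_weight i j t)%:R * Y (j.+1 * t).
  rewrite -[\prod_(j < n) _]/(\prod_(j < n) S j) -(big_mkord xpredT).
  rewrite (big_cat_nat (n := i)) //=; last exact: ltnW.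
  rewrite big_nat big1 ?mul1r => [|j /= ji]; last first.
    rewrite /S big_ord_recl big1 ?addr0 => [|t _]; last by rewrite /part_weight ji mul0r.
    by rewrite /part_weight ji muln0 /Y X0 !mulr1.
  rewrite big_ltn //; apply: eqmM.
    by have := part_factor (leqnn i) (ltn_ord i) oi; rewrite eqxx.
  rewrite [X in eqm _ _ X](big_cat_nat (n := n)) //=; last lia.
  rewrite -[X in eqm _ X _]mulr1; apply: eqmM.
    rewrite big_nat_cond [X in eqm _ _ X]big_nat_cond; apply: eqm_prod.
    move=> j /andP[/andP[ij jn] _].
    by have := part_factor (ltnW ij) jn oi; rewrite gtn_eqF.
  (* Parts larger than [n] do not affect the coefficient of [x^n], so the product may run up to
     [2 N]. *)
  have h : eqm n.+1 (\prod_(n <= j < 2 * N) 1) (\prod_(n <= j < 2 * N) phi j).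
    rewrite big_nat_cond [X in eqm _ _ X]big_nat_cond; apply: eqm_prod => j.
    move=> /andP[/andP[nj _] _] m mn; rewrite (phi1 j) // (leq_trans mn) //.
  by rewrite big1 in h.
have -> : (\sum_(i < n | odd i) f i) n = (\sum_(0 <= i < 2 * N | odd i) f i) n.
  have [nN2|nN2] := leqP n (2 * N); last lia.
  rewrite (big_cat_nat (n := n)) //= fpsDE big_mkord -[LHS]addr0; congr (_ + _).
  rewrite fps_sumE big_nat_cond big1 // => i /andP[/andP[ni _] _].
  by apply: (@lowMr _ i.+1) => //; apply/lowMr/low_geo.
have E K : \sum_(0 <= i < 2 * K) (if odd i then f i else 0) =
    \sum_(1 <= s < K.+1) f (2 * s).-1.
  elim: K => [|K IH]; first by rewrite !big_geq.
  rewrite mulnS addnC addn2 [in RHS]big_nat_recr //= -IH.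
  rewrite 2?[in LHS]big_nat_recr //= oddM /= addr0.
  by congr (_ + f _); lia.
rewrite big_mkcond E.
rewrite !fps_sumE big_nat [RHS]big_nat; apply: eq_bigr => s /andP[s0 sN].
rewrite /f prednK; last lia.
have E2 K : (s <= K)%N -> \prod_(2 * s <= j < 2 * K) phi j =
    \prod_(s <= k < K) ((1 - X (2 * k + 1)) * (1 + geo (2 * k + 2))).
  elim: K => [|K IH] sK; first by rewrite !big_geq //; lia.
  have [sK'|Ks] := leqP s K; last by rewrite !big_geq //; lia.
  rewrite mulnS addnC addn2 2?[in LHS]big_nat_recr //=; try lia.
  rewrite [in RHS]big_nat_recr //= IH // -mulrA addn1 addn2; congr (_ * (_ * _)).
    by rewrite /phi oddM.
  by rewrite /phi /= oddM.
by rewrite E2.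
Qed.

(** Gauss's product for [psi] cancels the factors from [s] on and leaves
    [(x^2; x^2)_s / (x; x^2)_s], which makes each summand that of [bailey_sum]. *)
Lemma psi_Mser : psi * Mser = lambert R 1 + appell_total R.
Proof.
apply: fpsP => N; rewrite -(@bailey_sum _ N N) //.
have H : eqm N.+1 (psi * Mser) (Qp R N * O R N * \sum_(1 <= s < N.+1)
    geo (2 * s) * (1 + geo (2 * s)) *
    \prod_(s <= k < N) ((1 - X (2 * k + 1)) * (1 + geo (2 * k + 2)))).
  apply: eqmM; last exact: Mser_eqm.
  by move=> n nN; rewrite (@psi_product R N) //; lia.
rewrite H // mulr_sumr; apply: (congr1 (fun f : fps R => f N)); rewrite big_nat [RHS]big_nat.
apply: eq_bigr => s /andP[s0 sN]; rewrite I_even.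
have -> : Qp R N * O R N * (geo (2 * s) * (1 + geo (2 * s)) *
    \prod_(s <= k < N) ((1 - X (2 * k + 1)) * (1 + geo (2 * k + 2)))) =
  Qp R s * O R s * (geo (2 * s) * (1 + geo (2 * s))).
  have : (s <= N)%N by [].
  elim: N sN {H} => [|N IH] sN; first lia.
  case: (leqP s N) => [sN' _|Ns sN']; last first.
    have -> : s = N.+1 by lia.
    by rewrite big_geq //; rewrite mulr1.
  rewrite -[RHS]IH // big_nat_recr //= QpS /O big_ord_recr /= -/(O R N).
  have g1 : (1 - X (2 * N + 2)) * (1 + geo (2 * N + 2)) = 1 by apply: geo_inv; lia.
  have g2 : (1 - X (2 * N + 1)) * (1 + geo (2 * N + 1)) = 1 by apply: geo_inv; lia.
  rewrite -(addn1 (2 * N)).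
  set P := \prod_(s <= i < N) _.
  transitivity (Qp R N * O R N * (geo (2 * s) * (1 + geo (2 * s)) * P) *
     ((1 - X (2 * N + 2)) * (1 + geo (2 * N + 2))) *
     ((1 - X (2 * N + 1)) * (1 + geo (2 * N + 1)))); first ring.
  by rewrite g1 g2 !mulr1.
case: s s0 sN => // s _ _; rewrite [s.+1.-1]/=.
have e : (2 * s + 2 = 2 * s.+1)%N by lia.
have g1 : (1 - X (2 * s.+1)) * (1 + geo (2 * s.+1)) = 1 by apply: geo_inv; lia.
have gE : geo (2 * s.+1) = X (2 * s.+1) * (1 + geo (2 * s.+1)) by apply: geoE; lia.
have JE : Qp R s * J R s.+1 = 1 + geo (2 * s.+1) by rewrite JS mulrA QpJ mul1r e.
transitivity (Qp R s * O R s.+1 * geo (2 * s.+1) * ((1 - X (2 * s.+1)) * (1 + geo (2 * s.+1)))).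
  by rewrite QpS e; ring.
transitivity (X (2 * s.+1) * Qp R s * O R s.+1 * (Qp R s * J R s.+1)); last ring.
by rewrite g1 mulr1 {1}gE JE; ring.
Qed.

End GeneratingFunction.

(** * Residue classes of exponents *)

Section Classes.
Variables (R : comNzRingType) (l : nat).
Implicit Types f g : fps R.

Definition cl (r : nat) f : fps R := fun n => if n == r %[mod l] then f n else 0.
Definition pure (r : nat) f := forall n, n != r %[mod l] -> f n = 0.

Lemma clD r f g : cl r (f + g) = cl r f + cl r g.
Proof. by apply: fpsP => n; rewrite fpsDE /cl; case: ifP => // _; rewrite addr0. Qed.

Lemma clN r f : cl r (- f) = - cl r f.
Proof. by apply: fpsP => n; rewrite fpsNE /cl; case: ifP => // _; rewrite oppr0. Qed.

Lemma cl0 r : cl r 0 = 0.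
Proof. by apply: fpsP => n; rewrite /cl if_same. Qed.

Lemma clDl r f : cl (r + l) f = cl r f.
Proof. by rewrite /cl modnDr. Qed.

Lemma cl_pure r f : pure r f -> cl r f = f.
Proof. by move=> fr; apply: fpsP => n; rewrite /cl; case: eqP => // /eqP /fr ->. Qed.

Lemma cl_pure0 r d f : pure d f -> (r != d %[mod l]) -> cl r f = 0.
Proof.
move=> fd rd; apply: fpsP => n; rewrite /cl; case: eqP => // nr.
by apply: fd; rewrite nr.
Qed.

Lemma pure_cl r f : pure r (cl r f).
Proof. by move=> n nr; rewrite /cl (negbTE nr). Qed.

Lemma pureM d e f g : pure d f -> pure e g -> pure (d + e) (f * g).
Proof.
move=> fd ge n nde; rewrite fpsME big1 // => i _.
have [id|di] := eqVneq (i %% l)%N (d %% l)%N; last by rewrite fd ?mul0r.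
rewrite ge ?mulr0 //; apply: contraNneq nde => nie.
have {1}-> : n = (i + (n - i))%N by rewrite subnKC // -ltnS.
by rewrite -modnDm id nie modnDm.
Qed.

Lemma pureX d f k : pure d f -> pure (k * d) (f ^+ k).
Proof.
move=> fd; elim: k => [|k IH]; last by rewrite exprS mulSn; apply: pureM.
by move=> [|n] //; rewrite mul0n mod0n eqxx.
Qed.

Lemma pureD d f g : pure d f -> pure d g -> pure d (f + g).
Proof. by move=> fd gd n nd; rewrite fpsDE fd ?gd ?addr0. Qed.

Lemma cl_pureM d f g r : pure d f -> cl (d + r) (f * g) = f * cl r g.
Proof.
move=> fd; apply: fpsP => n; rewrite /cl; case: eqP => [nE|/eqP nr]; last first.
  by rewrite (pureM fd (@pure_cl r g)).
rewrite !fpsME; apply: eq_bigr => i _.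
have [id|di] := eqVneq (i %% l)%N (d %% l)%N; last by rewrite fd ?mul0r.
congr (_ * _); rewrite /cl ifT //.
have iE : (i + (n - i) = d + r %[mod l])%N by rewrite subnKC // -ltnS.
have : (d + (n - i) == d + r %[mod l])%N.
  by rewrite -iE -(modnDml d) -id modnDml.
by rewrite eqn_modDl.
Qed.

Lemma pure_nat n d f : pure d f -> pure d (n%:R * f).
Proof. by move=> fd m md; rewrite fpsnatM fd ?mulr0. Qed.

Lemma pure_inv f g : pure 0 f -> f * g = 1 -> pure 0 g.
Proof.
move=> f0 fg; have e : f * cl 0 g = 1.
  rewrite -(cl_pureM g 0 f0) fg; apply: fpsP => n; rewrite /cl fps1E.
  by case: n => [|n]; rewrite ?eqxx ?if_same.
have <- : cl 0 g = g by rewrite -[LHS]mul1r -fg mulrAC e mul1r.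
exact: pure_cl.
Qed.

Lemma pure_theta (w : nat -> R) d :
  (forall k : nat, w k != 0 -> T k = d %[mod l]) -> pure d (theta w).
Proof.
move=> wd n nd; rewrite thetaE big1 // => k /eqP kn.
by apply/eqP; apply: contraNT nd => /wd <-; rewrite kn.
Qed.

Hypothesis l_gt0 : (0 < l)%N.

Lemma cl_sum f : f = \sum_(r < l) cl r f.
Proof.
apply: fpsP => n; rewrite fps_sumE (bigD1 (Ordinal (ltn_pmod n l_gt0))) //=.
rewrite /cl modn_mod eqxx big1 ?addr0 // => r; rewrite -val_eqE /= => rn.
by rewrite ifF // (modn_small (ltn_ord r)) eq_sym; apply/negbTE.
Qed.

(** The index [r + (l - 1) * i] is [r - i] modulo [l]. *)
Lemma clM r f g : cl r (f * g) = \sum_(i < l) cl i f * cl (r + (l - 1) * i) g.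
Proof.
rewrite {1}(cl_sum f) mulr_suml.
have : forall s : seq 'I_l, cl r (\sum_(i <- s) cl i f * g) =
    \sum_(i <- s) cl i f * cl (r + (l - 1) * i) g.
  elim=> [|i s IH]; first by rewrite !big_nil cl0.
  rewrite !big_cons clD IH; congr (_ + _).
  rewrite -(cl_pureM _ _ (@pure_cl i f)).
  rewrite (_ : i + (r + (l - 1) * i) = r + i * l)%N; last by nia.
  by rewrite /cl -modnDmr modnMl addn0.
by apply.
Qed.

End Classes.

Lemma appell_supp (R : comNzRingType) (w : nat -> R) l n : appell w l n != 0 ->
  exists2 j, w j != 0 & (n + T j = T l)%N.
Proof.
elim/ltn_ind: l n => -[|[|l]] IH n /=; rewrite ?fps0E ?eqxx //.
have TE : T l.+2 = (T l + (2 * l + 3))%N by have := T2 l; have := T2 l.+2; nia.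
rewrite XME; case: leqP => [ln|]; last by rewrite eqxx.
rewrite fpsDE; have [->|] := eqVneq (appell w l (n - (2 * l + 3))%N) 0; last first.
  by move=> /IH [] // j wj jE _; exists j => //; lia.
rewrite add0r /cst; case: (eqVneq (n - (2 * l + 3))%N 0%N) => [nE wl|_]; last by rewrite eqxx.
by exists l => //; lia.
Qed.


Lemma fps_mulf_eq0 (F : fieldType) (f g : fps F) : f != 0 -> f * g = 0 -> g = 0.
Proof.
move=> f0 fg0.
have /ex_minnP [d fd dmin] : exists n, f n != 0.
  apply: contrapT => fn; case/eqP: f0; apply: fpsP => n; apply/eqP.
  by apply: contrapT => /negP ?; apply: fn; exists n.
suff g0 n : g n = 0 by apply: fpsP.
elim/ltn_ind: n => n IH; have := congr1 (@^~ (d + n)%N) fg0; rewrite fpsME /=.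
rewrite (bigD1 (Ordinal (leq_addr n d : (d < (d + n).+1)%N))) //= addKn big1 ?addr0.
  by move=> /eqP; rewrite mulf_eq0 (negbTE fd) => /eqP.
move=> i; rewrite -val_eqE /= => id.
have [lt_id|le_di] := ltnP i d.
  by have -> : f i = 0; [apply/eqP; apply: contraTT lt_id => /dmin; rewrite -leqNgt|rewrite mul0r].
by rewrite IH ?mulr0 //; have := ltn_ord i; lia.
Qed.

Lemma fps_expf_neq0 (F : fieldType) (f : fps F) k : f != 0 -> f ^+ k != 0.
Proof.
move=> f0; elim: k => [|k IH]; last first.
  by rewrite exprS; apply: contra_neq IH => /(fps_mulf_eq0 f0).
by rewrite expr0; apply/eqP => /(congr1 (@^~ 0%N)) /eqP; rewrite fps1E oner_eq0.
Qed.

(** * Inverses, the derivation, and elimination of the constant *)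

Section Inverse.
Variable R : comNzRingType.

(** The inverse is the geometric series in [1 - f], whose [k]-th term has order at least [k]. *)
Lemma fps_inverse (f : fps R) : f 0%N = 1 -> exists g, f * g = 1.
Proof.
move=> f0; pose F k := (1 - f) ^+ k.
have lowF k : low k (F k).
  elim: k => [|k IH]; first by move=> n; rewrite ltn0.
  rewrite /F exprS -add1n; apply: lowM => // n; rewrite ltnS leqn0 => /eqP ->.
  by rewrite fpsBE f0 subrr.
have Fs : summable F by apply: (@summable_low _ 0) => k; rewrite subn0.
exists (isum F); have : isum F = 1 + (1 - f) * isum F.
  rewrite {1}(isum_shift 1 Fs) big_ord1 /F expr0 -isumMl //; congr (_ + _).
  by apply: eq_isum => k; rewrite addn1 exprS.
move=> E; have -> : f * isum F = isum F - (1 - f) * isum F by ring.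
by rewrite {1}E addrK.
Qed.

Lemma psi0 : psi R 0%N = 1.
Proof. by rewrite /psi thetaE big_mkcond big_ord1. Qed.

(** The derivation [x d/dx]. *)
Definition der (f : fps R) : fps R := fun n => n%:R * f n.

Lemma derM f g : der (f * g) = der f * g + f * der g.
Proof.
apply: fpsP => n; rewrite fpsDE /der !fpsME mulr_sumr -big_split.
apply: eq_bigr => i _ /=; have {1}-> : n = (i + (n - i))%N by rewrite subnKC // -ltnS.
by rewrite natrD; ring.
Qed.

Lemma der_theta (w : nat -> R) : der (theta w) = theta (fun k => (T k)%:R * w k).
Proof.
apply: fpsP => n; rewrite /der !thetaE mulr_sumr.
by apply: eq_bigr => k /eqP ->.
Qed.

Lemma rho1 : rho (fun=> 1 : R) 1 = der (psi R).
Proof.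
rewrite der_theta; apply: eq_theta => k; rewrite mulr1.
under eq_bigr do rewrite mul1r expn1.
rewrite -natr_sum /T -bin2_sum big_mkord; congr _%:R.
rewrite (reindex_inj rev_ord_inj); apply: eq_bigr => i _ /=.
by have := ltn_ord i; lia.
Qed.

Lemma summable_lambert p : summable (fun i => (i ^ p)%:R * geo R (2 * i)).
Proof.
apply: (@summable_low _ 1) => -[|k] //; apply/lowMl.
by apply: (@lowW _ _ (2 * k.+1)); [lia|apply: low_geo; lia].
Qed.

Lemma omega1 : omega (fun=> 1 : R) 1 = 2 * psi R * lambert R 1.
Proof.
have -> : 2 * psi R = theta (fun=> 1 + 1).
  by rewrite thetaD -/(psi R); ring.
by rewrite mulrC -isumMr //; apply: summable_lambert.
Qed.

Lemma omegaE (f : int -> R) (g1 g3 : nat -> R) p :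
  (forall i k : nat, (i ^ p)%:R * (f (k%:Z - i%:Z) + f (k%:Z + i%:Z)) =
     (i ^ 1)%:R * g1 k + (i ^ 3)%:R * g3 k) ->
  omega f p = theta g1 * lambert R 1 + theta g3 * lambert R 3.
Proof.
move=> fg; have s q g := summableMl' (theta g) (@summable_lambert q).
rewrite -!isumMl; try exact: summable_lambert; rewrite -isumD //.
apply: eq_isum => i; rewrite mulrAC.
have -> : (i ^ p)%:R * theta (fun k : nat => f (k%:Z - i%:Z) + f (k%:Z + i%:Z)) =
    (i ^ 1)%:R * theta g1 + (i ^ 3)%:R * theta g3.
  rewrite -!(rmorph_nat (@cst R)) -!thetaZ -thetaD; exact: eq_theta.
by ring.
Qed.

(** With weight 1 the Appell sum is the whole of [appell_total], which [psi_Mser] expresses through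
    [Mser]: the constant [lam 0] is traded for [Mser]. *)
Lemma psi_lam0 : psi R * lam R 1 0 =
  der (psi R) + 3 * psi R * lambert R 1 - psi R ^+ 2 * Mser R.
Proof.
have := @psi_appell_sum R (fun=> 1) (fun=> erefl).
rewrite rho1 omega1 -/(psi R).
have -> : appell_sum (fun=> 1) (fun k => (2 * k + 1)%:R) = appell_total R.
  by apply: eq_isum => l; rewrite rmorph1 mul1r.
move=> E; have -> : psi R ^+ 2 * Mser R = psi R * lambert R 1 + psi R * appell_total R.
  by rewrite -mulrDr -psi_Mser; ring.
by rewrite E; ring.
Qed.

(* Eliminating the constant [lam 0] between the weights [f] and [1]. *)
Lemma psi2_Mser (f : int -> R) : (forall k, f (- 1 - k) = f k) ->
  theta (fun k : nat => f k) * psi R ^+ 2 * Mser R =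
  psi R ^+ 2 * appell_sum f (fun k => (2 * k + 1)%:R) - psi R * (rho f 1 + omega f 1) +
  theta (fun k : nat => f k) * (der (psi R) + 3 * psi R * lambert R 1).
Proof.
move=> f_even; have E := psi_appell_sum f_even; set t := theta _ in E *.
have -> : psi R ^+ 2 * appell_sum f (fun k => (2 * k + 1)%:R) =
    psi R * (rho f 1 + omega f 1) - t * (psi R * lam R 1 0).
  by rewrite expr2 -mulrA E; ring.
by rewrite psi_lam0; ring.
Qed.

End Inverse.

Section Divisors.
Variable R : comNzRingType.

Lemma lambertE p n : lambert R p n =
  if odd n || (n == 0)%N then 0 else \sum_(d <- divisors n./2) (d ^ p)%:R.
Proof.
rewrite /lambert (@isumE _ _ _ n.+1) => [|k nk]; last first.
  by apply: (@lowMl _ n.+1) => //; apply: (@lowW _ _ (2 * k)); [lia|apply: low_geo; lia].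
under eq_bigr => i _ do rewrite -(rmorph_nat (@cst R)) cstM.
case: ifP => [n0|].
  rewrite big1 // => i _; rewrite /geo (_ : _ && _ = false) ?mulr0 //.
  apply/negP => /andP[n_gt0 /dvdnP[q nE]]; move: n0.
  by rewrite (gtn_eqF n_gt0) orbF nE mulnCA oddM.
move=> /negbT; rewrite negb_or -lt0n => /andP[en n_gt0].
have nE : n = (2 * n./2)%N by rewrite -[LHS]odd_double_half (negbTE en) mul2n.
have m_gt0 : (0 < n./2)%N by lia.
rewrite -(big_mkord xpredT (fun i => (i ^ p)%:R * geo R (2 * i) n)) -/(index_iota 0 n.+1).
rewrite (bigID (fun i => i %| n./2)%N) /= [X in _ + X]big1 ?addr0 => [|i nd]; last first.
  by rewrite /geo {2}nE dvdn_pmul2l // (negbTE nd) andbF mulr0.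
rewrite -big_filter (perm_big (divisors n./2)).
  apply: eq_big_seq => d; rewrite -dvdn_divisors // => dm.
  by rewrite /geo {2}nE dvdn_pmul2l // dm n_gt0 mulr1.
apply: uniq_perm; [exact/filter_uniq/iota_uniq|exact: divisors_uniq|move=> d].
rewrite mem_filter mem_index_iota -dvdn_divisors //=.
by case: (boolP (d %| n./2)%N) => //= /(dvdn_leq m_gt0); lia.
Qed.

Lemma sum_divisors_inv (V : nmodType) (F : nat -> V) n : (0 < n)%N ->
  \sum_(d <- divisors n) F d = \sum_(d <- divisors n) F (n %/ d)%N.
Proof.
move=> n0; rewrite -[RHS](big_map (fun d => n %/ d)%N xpredT F); apply: perm_big.
have K d : (d %| n)%N -> (n %/ (n %/ d) = d)%N.
  move=> dn; rewrite -{1}(divnK dn) mulKn //.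
  by rewrite divn_gt0 ?(dvdn_leq n0 dn) // (dvdn_gt0 n0 dn).
have Kd d : d \in divisors n -> (n %/ d)%N \in divisors n.
  by rewrite -!dvdn_divisors // => dn; rewrite -{2}(divnK dn) dvdn_mulr.
apply: uniq_perm; first exact: divisors_uniq.
  rewrite map_inj_in_uniq ?divisors_uniq // => d e.
  by rewrite -!dvdn_divisors // => dn en de; rewrite -(K d dn) de K.
move=> d; apply/idP/mapP => [dn|[e en ->]]; last exact: Kd.
by exists (n %/ d)%N; rewrite ?Kd // K // dvdn_divisors.
Qed.

End Divisors.

(** * The congruence modulo 3 *)

Section Squares.
Variable F : fieldType.

Definition sqw (C : F) (k : int) : F := ((2 * k + 1)%:~R ^+ 2 == C)%:R.

Lemma sqw_even C k : sqw C (- 1 - k) = sqw C k.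
Proof.
rewrite /sqw; congr (_ == _)%:R.
by rewrite -sqrrN -rmorphN; congr (_%:~R ^+ 2); lia.
Qed.

Lemma T_eq (k : int) : (8 * T k + 1)%:R = (2 * k + 1)%:~R ^+ 2 :> F.
Proof.
rewrite -rmorphXn /= pmulrn; congr _%:~R.
by have := T2 k; nia.
Qed.

Definition th C : fps F := theta (fun k : nat => sqw C k).

End Squares.

Lemma F3_ind (P : 'F_3 -> Prop) : P 0 -> P 1 -> P (- 1) -> forall u, P u.
Proof.
move=> P0 P1 P2 [[|[|[|//]]] i].
- by rewrite (_ : Ordinal i = 0) //; apply: val_inj.
- by rewrite (_ : Ordinal i = 1) //; apply: val_inj.
- by rewrite (_ : Ordinal i = -1) //; apply: val_inj.
Qed.

Lemma eqmod_F (p : nat) (m n : nat) : prime p -> m%:R = n%:R :> 'F_p -> m = n %[mod p].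
Proof. by move=> pp /(congr1 val); rewrite /= !val_Fp_nat. Qed.

Lemma natr_mod (p : nat) (m n : nat) : prime p -> m = n %[mod p] -> m%:R = n%:R :> 'F_p.
Proof. by move=> pp mn; apply: val_inj; rewrite /= !val_Fp_nat. Qed.

(* The exponents of [appell w l] are [T l - T j] with [w j <> 0]. *)
Lemma cl_appell_sum (p r : nat) (C : 'F_p) (w : nat -> 'F_p) : prime p ->
  (forall j : nat, (2 * j%:Z + 1)%:~R = 0 :> 'F_p -> w j = 0) ->
  (forall v : 'F_p, v != 0 -> (8 * r)%:R + v ^+ 2 != C) ->
  cl p r (appell_sum (sqw C) w) = 0.
Proof.
move=> pp w0 Cr; apply: fpsP => n; rewrite /cl; case: eqP => // nr.
rewrite /appell_sum (@isumE _ _ _ n.+1) => [|k nk]; last first.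
  by apply: (@lowMl _ n.+1) => //; apply: (@lowW _ _ k) => //; apply: low_appell.
rewrite big1 // => l _; rewrite cstM; apply/eqP; rewrite mulf_eq0.
apply: contraTT isT; rewrite negb_or => /andP[fl /appell_supp[j wj jl]].
have vj : (2 * j%:Z + 1)%:~R != 0 :> 'F_p by apply: contra_neq wj => /w0.
case/eqP: (Cr _ vj); move: fl; rewrite /sqw; case: (_ =P C) => [<- _|]; last by rewrite eqxx.
rewrite -!T_eq -jl -(natr_mod (m := (8 * n)%N)) //; last first.
  by rewrite -modnMmr nr modnMmr.
by rewrite -natrD; congr _%:R; lia.
Qed.

Section Algebra3.
Variables (R : comNzRingType) (psi a c p E r A0 A1 M : fps R).
Local Notation cl := (cl 3).
Local Notation pure := (pure 3).
Hypothesis char3 : forall x : fps R, 3 * x = 0.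
Hypotheses (a0 : pure 0 a) (c1 : pure 1 c) (r0 : pure 0 r).
Hypotheses (psiE : psi = a + c) (psip : psi * p = 1).
Hypotheses (E1 : cl 1 E = 0) (A0_0 : cl 0 A0 = 0) (A0_2 : cl 2 A0 = 0).
Hypotheses (A1_1 : cl 1 A1 = 0) (A1_2 : cl 2 A1 = 0).
Hypothesis ME : psi * M = E + A0 + A1.
Hypothesis cM : c * psi ^+ 2 * M = psi ^+ 2 * A0 - psi * (r + a * E) + c * (c + 3 * psi * E).

(** Class 1 of [M = X / psi], with [X = psi M], is a sum of three products of classes. Expressed by
    [cl 1 A0] and [G] and multiplied by [a], every term occurs three times. *)
Lemma a_cl1_eq0 : a * cl 1 M = 0.
Proof.
set X := psi * M.
have cX : c * X = a * A0 + c * A0 - r - a * E + c ^+ 2 * p.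
  transitivity (p * (c * psi ^+ 2 * M)); first by rewrite /X -[LHS]mul1r -psip; ring.
  rewrite cM -(mulrA 3) char3 addr0.
  transitivity ((psi * p) * (psi * A0 - r - a * E) + c ^+ 2 * p); first ring.
  by rewrite psip mul1r psiE; ring.
(* [psi^3 = a^3 + c^3] modulo 3 lies on multiples of 3, hence so does [G], and the classes of
   [1 / psi = psi^2 G] can be read off. *)
pose G := p ^+ 3.
have pG : p = a ^+ 2 * G + 2 * (a * c) * G + c ^+ 2 * G.
  transitivity (psi ^+ 2 * G); last by rewrite psiE; ring.
  by rewrite -[LHS]mul1r -(expr1n _ 2) -psip /G; ring.
have psi3_0 : pure 0 (psi ^+ 3).
  have -> : psi ^+ 3 = a ^+ 3 + c ^+ 3 + 3 * (a ^+ 2 * c + a * c ^+ 2).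
    by rewrite psiE; ring.
  rewrite char3 addr0; apply: pureD; first exact: (@pureX _ 3 0 a 3 a0).
  exact: (@pureX _ 3 1 c 3 c1).
have G0 : pure 0 G.
  by apply: (pure_inv psi3_0); rewrite -exprMn psip expr1n.
have c2 : pure 2 (c ^+ 2) by apply: (@pureX _ 3 1 c 2 c1).
have h0 : pure 0 (a ^+ 2 * G) by apply: (pureM (@pureX _ 3 0 a 2 a0) G0).
have h1 : pure 1 (2 * (a * c) * G).
  by rewrite -mulrA; apply: pure_nat; apply: (pureM (pureM a0 c1) G0).
have h2 : pure 2 (c ^+ 2 * G) by apply: (pureM c2 G0).
have p0 : cl 0 p = a ^+ 2 * G.
  by rewrite pG !clD (cl_pure h0) (cl_pure0 h1) // (cl_pure0 h2) // !addr0.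
have p1 : cl 1 p = 2 * (a * c) * G.
  by rewrite pG !clD (cl_pure h1) (cl_pure0 h0) // (cl_pure0 h2) // add0r addr0.
have p2 : cl 2 p = c ^+ 2 * G.
  by rewrite pG !clD (cl_pure h2) (cl_pure0 h1) // (cl_pure0 h0) // !add0r.
have X1 : cl 1 X = cl 1 A0 by rewrite /X ME !clD E1 A1_1 add0r addr0.
have X2 : cl 2 X = cl 2 E by rewrite /X ME !clD A0_2 A1_2 !addr0.
have aE2 : a * cl 2 E = c ^+ 2 * (a ^+ 2 * G).
  have := congr1 (cl 2) cX; rewrite !(clD, clN) (cl_pureM X 1 c1) X1.
  rewrite (cl_pureM A0 2 a0) (cl_pureM A0 1 c1) (cl_pureM E 2 a0) (cl_pureM p 0 c2).
  rewrite (cl_pure0 r0) // A0_2 p0 => e.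
  transitivity (c * cl 1 A0 - c * cl 1 A0 + a * cl 2 E); first ring.
  by rewrite {1}e; ring.
have cX0 : c * cl 0 X = a * cl 1 A0 + c ^+ 2 * (c ^+ 2 * G).
  have := congr1 (cl 1) cX; rewrite !(clD, clN) (cl_pureM X 0 c1).
  rewrite (cl_pureM A0 1 a0) (cl_pureM A0 0 c1) (cl_pureM E 1 a0).
  rewrite -(clDl 3 1 (c ^+ 2 * p)) (cl_pureM p 2 c2) (cl_pure0 r0) // A0_0 E1 p2 => ->.
  by ring.
have -> : M = p * X by rewrite /X mulrA (mulrC p) psip mul1r.
have clM1 (f g : fps R) : cl 1 (f * g) = cl 0 f * cl 1 g + cl 1 f * cl 0 g + cl 2 f * cl 2 g.
  by rewrite clM // !big_ord_recl big_ord0 addr0 addrA.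
rewrite clM1 p0 p1 p2 X1 X2.
transitivity (a ^+ 3 * G * cl 1 A0 + 2 * a ^+ 2 * G * (c * cl 0 X) + c ^+ 2 * G * (a * cl 2 E)).
  by ring.
rewrite cX0 aE2 -[RHS](char3 (a ^+ 3 * G * cl 1 A0 + a ^+ 2 * G * (c ^+ 2 * (c ^+ 2 * G)))).
by ring.
Qed.

End Algebra3.

Section Mod3.
Local Notation F := 'F_3.
Local Notation psi := (psi F).
Local Notation a := (th (1 : F)).
Local Notation c := (th (0 : F)).
Local Notation E := (lambert F 1).
Local Notation M := (Mser F).
Local Notation cl := (cl 3).
Local Notation pure := (pure 3).

Lemma psi3 : psi = a + c.
Proof.
rewrite -thetaD; apply: eq_theta => k; rewrite /sqw.
by elim/F3_ind: (_%:~R); apply/eqP.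
Qed.

Lemma pure_th3 (C : F) (d : nat) : (8 * d + 1)%:R = C -> pure d (th C).
Proof.
move=> dC; apply: pure_theta => k; rewrite /sqw; case: (_ =P C) => [kC _|_]; last by rewrite eqxx.
apply: eqmod_F => //; have := T_eq F k; rewrite kC -dC.
by rewrite natrD [RHS]natrD => /addIr; rewrite !natrM; apply: mulfI.
Qed.

Lemma theta0 : theta (fun=> 0 : F) = 0.
Proof. by apply: fpsP => n; rewrite thetaE big1. Qed.

Lemma omega_mod3 : omega (sqw (0 : F)) 1 = a * E.
Proof.
rewrite (@omegaE _ _ (fun k : nat => sqw (1 : F) k) (fun=> 0)) ?theta0 ?mul0r ?addr0 //.
move=> i k; rewrite mulr0 addr0 expn1 /sqw.
have -> : (2 * (k%:Z - i%:Z) + 1)%:~R = (2 * k%:Z + 1)%:~R - 2 * i%:R :> F.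
  by rewrite mulrBr addrAC rmorphB /= rmorphM.
have -> : (2 * (k%:Z + i%:Z) + 1)%:~R = (2 * k%:Z + 1)%:~R + 2 * i%:R :> F.
  by rewrite mulrDr addrAC rmorphD /= rmorphM.
move: (_%:~R : F) (i%:R : F) => u v.
by elim/F3_ind: u; elim/F3_ind: v; apply/eqP.
Qed.

(** If [T k] is nonzero modulo 3, then 3 divides [2k + 1]; it also divides [2l + 1] for each [l]
    that counts, so it divides [k - l]. *)
Lemma pure_rho3 : pure 0 (rho (sqw (0 : F)) 1).
Proof.
apply: pure_theta => k; apply: contraNeq => Tk; apply/eqP.
have uk : (2 * k%:Z + 1)%:~R = 0 :> F.
  apply/eqP; apply: contraNT Tk => u0; apply/eqP; apply: eqmod_F => //.
  have := T_eq F k; have -> : (2 * k%:Z + 1)%:~R ^+ 2 = 1 :> F.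
    by move: u0; elim/F3_ind: (_%:~R) => //; move=> _; apply/eqP.
  rewrite natrD -[RHS]add0r => /addIr; rewrite natrM => /eqP.
  by rewrite mulf_eq0 => /orP[//|/eqP].
rewrite big1 // => l _; rewrite /sqw; case: (_ =P 0) => [/eqP|_]; last by rewrite mul0r.
rewrite expf_eq0 /= => /eqP ul; rewrite mul1r expn1 natrB; last by rewrite -ltnS.
have : (2 * k%:Z + 1)%:~R = (2 * l%:Z + 1)%:~R :> F by rewrite uk ul.
by rewrite !rmorphD !rmorphM /= => /addIr /mulfI kl; rewrite !pmulrn kl // subrr.
Qed.

(** If [n = 2m] is 1 modulo 3, then [m] is -1, so complementary divisors of [m] have opposite
    residues and the divisor sum equals its own negative. *)
Lemma cl_lambert3 : cl 1 E = 0.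
Proof.
apply: fpsP => n; rewrite /cl; case: eqP => // n1; rewrite fps0E lambertE.
case: ifP => // /negbT; rewrite negb_or => /andP[en n0].
set S := \sum_(d <- _) _; suff SN : S = - S.
  apply/eqP; have : 2%:R * S == 0 by rewrite mulr_natl mulr2n {1}SN addNr.
  by rewrite mulf_eq0.
have nE : n = (2 * n./2)%N by rewrite -[LHS]odd_double_half (negbTE en) mul2n.
have m0 : (0 < n./2)%N by move: n0; rewrite nE; lia.
rewrite {1}/S sum_divisors_inv // -sumrN; apply: eq_big_seq => d.
rewrite -dvdn_divisors // => dm; rewrite !expn1.
have : (n./2 %/ d)%N%:R * d%:R = - 1 :> F.
  rewrite -natrM divnK //; have : 2%:R * (n./2)%:R = 1%:R :> F.
    by rewrite -natrM -nE; apply: natr_mod.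
  by elim/F3_ind: (n./2%:R) => /eqP.
by elim/F3_ind: (d%:R); elim/F3_ind: (_%:R) => /eqP; rewrite // => _; apply/eqP.
Qed.

Lemma char3 (x : fps F) : 3 * x = 0.
Proof. by apply: fpsP => n; rewrite fpsnatM (_ : 3%:R = 0) ?mul0r //; apply: val_inj. Qed.

Lemma Mser_mod3 : cl 1 M = 0.
Proof.
have [p psip] := fps_inverse (psi0 F).
have a0 : pure 0 a by apply: pure_th3.
have c1 : pure 1 c by apply: pure_th3; apply/eqP.
pose w := fun k : nat => (2 * k + 1)%:R : F.
pose A0 := appell_sum (sqw (0 : F)) w; pose A1 := appell_sum (sqw (1 : F)) w.
have w0 (j : nat) : (2 * j%:Z + 1)%:~R = 0 :> F -> w j = 0.
  by move=> <-; rewrite /w pmulrn; congr _%:~R; lia.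
have A0_0 : cl 0 A0 = 0.
  by apply: cl_appell_sum => // v; elim/F3_ind: v.
have A0_2 : cl 2 A0 = 0.
  by apply: cl_appell_sum => // v; elim/F3_ind: v.
have A1_1 : cl 1 A1 = 0.
  by apply: cl_appell_sum => // v; elim/F3_ind: v.
have A1_2 : cl 2 A1 = 0.
  by apply: cl_appell_sum => // v; elim/F3_ind: v.
set X := psi * M.
have XE : X = E + A0 + A1.
  rewrite /X psi_Mser -addrA; congr (_ + _).
  rewrite /A0 /A1 -isumD; try exact: (summable_appell _ (fun k : nat => sqw _ k)).
  apply: eq_isum => k; rewrite -mulrDl -rmorphD /sqw.
  have -> (u : F) : (u ^+ 2 == 0)%:R + (u ^+ 2 == 1)%:R = 1 :> F.
    by elim/F3_ind: u; apply/eqP.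
  by rewrite rmorph1 mul1r.
have der_psi : der psi = c.
  rewrite der_theta; apply: eq_theta => k; rewrite mulr1 /sqw.
  have K (u t : F) : (8%:R * t + 1 == u ^+ 2) ==> (t == (u ^+ 2 == 0)%:R).
    by elim/F3_ind: u; elim/F3_ind: t.
  by apply/eqP/(implyP (K _ _)); rewrite -T_eq natrD natrM.
have a_neq0 : a != 0.
  apply/eqP => /(congr1 (@^~ 0%N)) /eqP; rewrite /th thetaE big_mkcond big_ord1.
  by rewrite /sqw oner_eq0.
apply: (fps_mulf_eq0 a_neq0).
apply: (@a_cl1_eq0 _ psi a c p E (rho (sqw (0 : F)) 1) A0 A1 M).
- exact: char3.
- exact: a0.
- exact: c1.
- exact: pure_rho3.
- exact: psi3.
- exact: psip.
- exact: cl_lambert3.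
- exact: A0_0.
- exact: A0_2.
- exact: A1_1.
- exact: A1_2.
- exact: XE.
have := psi2_Mser (sqw_even (0 : F)); rewrite omega_mod3 der_psi -/(th (0 : F)) => ->.
reflexivity.
Qed.

End Mod3.

Lemma M2spt_cl (p r n : nat) : prime p -> cl p r (Mser 'F_p) = 0 -> n = r %[mod p] ->
  M2spt n = 0 %[mod p].
Proof.
move=> pp /(congr1 (@^~ n)); rewrite /cl => + nr; rewrite nr eqxx /Mser => /eqP.
rewrite mulf_eq0 signr_eq0 /= => /eqP Mn.
exact: (@eqmod_F p _ 0).
Qed.

(** * The congruences modulo 5 *)

Section LacunarySeries.
Variable R : comNzRingType.
Implicit Types (w : nat -> R) (e : nat -> nat).

Definition lac w e : fps R := isum (fun k => cst (w k) * X R (e k)).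

Lemma low_lac w e k : (k <= e k)%N -> low k (cst (w k) * X R (e k)).
Proof. by move=> ek; apply/lowMl/lowX. Qed.

Lemma summable_lac w e : (forall k, (k <= e k)%N) -> summable (fun k => cst (w k) * X R (e k)).
Proof. by move=> ek; apply: (@summable_low _ 0) => k; rewrite subn0; apply: low_lac. Qed.

Lemma lacE w e n N : (forall k, (k <= e k)%N) -> (n < N)%N ->
  lac w e n = \sum_(k < N | e k == n) w k.
Proof.
move=> ek nN; rewrite /lac (@isumE _ _ _ N) => [|k Nk]; last first.
  by apply: (low_lac w (ek k)); lia.
rewrite [RHS]big_mkcond; apply: eq_bigr => k _; rewrite cstM /X eq_sym.
by case: eqP => _; rewrite ?mulr1 ?mulr0.
Qed.

Lemma lacM w w' e e' n N : (forall k, (k <= e k)%N) -> (forall k, (k <= e' k)%N) -> (n < N)%N ->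
  (lac w e * lac w' e') n = \sum_(i < N) \sum_(j < N | (e i + e' j == n)%N) w i * w' j.
Proof.
move=> ek ek' nN; rewrite -isumMr; last exact: summable_lac.
rewrite (@isumE _ _ _ N) => [|k Nk]; last first.
  by apply: (@lowMr _ k); [exact: low_lac|lia].
apply: eq_bigr => i _; rewrite -mulrA cstM XME -mulr_sumr; congr (_ * _).
case: leqP => [ein|nei]; last by rewrite big_pred0 // => j; apply/negbTE; lia.
rewrite (lacE w' ek' (N := N)); last lia.
by apply: eq_bigl => j; lia.
Qed.

End LacunarySeries.

(** An interval stable under [u -> - 1 - u], on which sums over [k >= 0] become half of sums over
    integers. *)
Definition zbox (N : nat) : seq int :=
  [seq k%:Z | k <- iota 0 N] ++ [seq - 1 - k%:Z | k <- iota 0 N].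

Lemma mem_zbox N u : (u \in zbox N) = (- N%:Z <= u < N%:Z).
Proof.
rewrite mem_cat; apply/orP/idP.
  by case=> /mapP[k]; rewrite mem_iota => kN ->; lia.
case: u => k kN; [left|right]; apply/mapP.
  by exists k => //; rewrite mem_iota; lia.
by exists k; rewrite ?mem_iota; lia.
Qed.

Lemma uniq_zbox N : uniq (zbox N).
Proof.
rewrite cat_uniq !map_inj_uniq ?iota_uniq ?andbT /=.
- by apply/hasPn => x /mapP[k _ ->]; apply/negP => /mapP[j _]; lia.
- by move=> i j; lia.
- by move=> i j; lia.
Qed.

Lemma sum_zbox (V : pzRingType) (F : int -> V) N : (forall k, F (- 1 - k) = F k) ->
  \sum_(u <- zbox N) F u = 2%:R * \sum_(k < N) F k%:Z.
Proof.
move=> FN; rewrite big_cat !big_map /=; under [X in _ + X]eq_bigr do rewrite FN.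
by rewrite -(big_mkord xpredT (fun k : nat => F k%:Z)) /index_iota subn0 mulr_natl mulr2n.
Qed.

(* The substitution [u = 2 s - t], [v = s + 2 t + 1] maps [Z^2] onto the pairs with
   [u = 2 v + 3] modulo 5, and [T u + T v = 5 T s + 5 T t + 1]. *)
Lemma sum_lattice5 (V : nmodType) (x : V) n N : (n < N)%N ->
  \sum_(u <- zbox N) \sum_(v <- zbox N | (T u + T v == n)%N && (5 %| u - 2 * v - 3)%Z) x =
  \sum_(s <- zbox N) \sum_(t <- zbox N | (5 * T s + 5 * T t + 1 == n)%N) x.
Proof.
move=> nN.
pose B := [seq (s, t) | s <- zbox N, t <- zbox N].
have BP u v : ((u, v) \in B) = (u \in zbox N) && (v \in zbox N).
  by apply/allpairsP/andP => [[[a b] [? ? [-> ->]]]|[uN vN]] //; exists (u, v).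
have Bu : uniq B by apply: allpairs_uniq; rewrite ?uniq_zbox // => -[? ?] [? ?].
have E (P : int -> int -> bool) :
    \sum_(u <- zbox N) \sum_(v <- zbox N | P u v) x = \sum_(p <- [seq p <- B | P p.1 p.2]) x.
  rewrite big_filter [RHS]big_mkcond /B big_allpairs; apply: eq_bigr => u _.
  by rewrite [LHS]big_mkcond.
rewrite !E; pose f (p : int * int) := (2 * p.1 - p.2, p.1 + 2 * p.2 + 1).
rewrite [RHS](_ : _ = \sum_(p <- map f [seq p <- B | (5 * T p.1 + 5 * T p.2 + 1 == n)%N]) x);
  last by rewrite big_map.
have f_inj : injective f by move=> [a b] [c d] [] *; congr pair; lia.
have TE s t : (T (2 * s - t) + T (s + 2 * t + 1) = 5 * T s + 5 * T t + 1)%N.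
  by have := T2 s; have := T2 t; have := T2 (2 * s - t); have := T2 (s + 2 * t + 1); nia.
have TN u : (T u <= n)%N -> u \in zbox N.
  by rewrite mem_zbox; have := T_ge (k := u) (n := N); lia.
apply: perm_big; apply: uniq_perm.
- exact: filter_uniq.
- by rewrite map_inj_uniq // filter_uniq.
move=> [u v]; rewrite mem_filter BP /=; apply/idP/mapP.
  move=> /andP[/andP[/eqP Tn /dvdzP[q qE]] _].
  have e : (u, v) = f (q * 2 + v + 1, - q - 1) by rewrite /f /=; congr pair; lia.
  exists (q * 2 + v + 1, - q - 1) => //; move: e => [uE vE].
  have := TE (q * 2 + v + 1) (- q - 1); rewrite -uE -vE Tn => TT.
  by rewrite mem_filter BP /= -TT eqxx !TN //; lia.
move=> [[s t]]; rewrite mem_filter BP /= => /andP[/eqP Tn _] [uE vE].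
have TT := TE s t; rewrite -uE -vE Tn in TT.
rewrite TT eqxx !TN ?andbT /=; [|lia|lia].
by apply/dvdzP; exists (- t - 1); lia.
Qed.

Lemma sum_zbox2 (V : pzRingType) (G : int -> int -> V) N :
  (forall u v, G (- 1 - u) v = G u v) -> (forall u v, G u (- 1 - v) = G u v) ->
  \sum_(u <- zbox N) \sum_(v <- zbox N) G u v = 4%:R * \sum_(i < N) \sum_(j < N) G i j.
Proof.
move=> Gl Gr; rewrite sum_zbox => [|u]; last by apply: eq_bigr => v _; rewrite Gl.
under eq_bigr do rewrite sum_zbox //.
by rewrite -mulr_sumr mulrA -natrM.
Qed.

Lemma fps_pchar (p : nat) : prime p -> p \in [pchar fps 'F_p].
Proof.
move=> pp; rewrite inE pp /=; apply/eqP/fpsP => n; rewrite fpsnatE fps0E.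
by case: ifP => // _; have := pchar_Fp pp => /andP[_ /eqP].
Qed.

(** The truncation [g] differs from [f] by a series of order above [n], whose [p]-th power does not
    reach [x^n]. On [g] Frobenius acts term by term and fixes the coefficients. *)
Lemma fps_Frobenius (p : nat) (f : fps 'F_p) n : prime p ->
  (f ^+ p) n = if (p %| n)%N then f (n %/ p)%N else 0.
Proof.
move=> pp; pose ch := fps_pchar pp; have p_gt0 := prime_gt0 pp.
pose g : fps 'F_p := \sum_(i < n.+1) cst (f i) * X 'F_p i.
have gE k : (k <= n)%N -> g k = f k.
  move=> kn; rewrite /g fps_sumE (bigD1 (Ordinal (kn : (k < n.+1)%N))) //= cstM /X eqxx mulr1.
  rewrite big1 ?addr0 // => i; rewrite -val_eqE /= => ik.
  by rewrite cstM /X eq_sym (negbTE ik) mulr0.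
have -> : f ^+ p = g ^+ p + (f - g) ^+ p.
  by rewrite -!(pFrobenius_autE ch) -rmorphD addrC subrK.
have -> : g ^+ p = \sum_(i < n.+1) cst (f i) * X 'F_p (i * p).
  rewrite -(pFrobenius_autE ch) rmorph_sum; apply: eq_bigr => i _.
  rewrite /= pFrobenius_autE exprMn XX -rmorphXn; congr (cst _ * _).
  by rewrite -[f i]natr_Zp -(pFrobenius_autE (pchar_Fp pp)) pFrobenius_aut_nat.
have fg : low n.+1 (f - g) by move=> k kn; rewrite fpsBE gE ?subrr.
have -> : (f - g) ^+ p = (f - g) * (f - g) ^+ p.-1 by rewrite -exprS prednK.
rewrite fpsDE (lowMr _ fg) // addr0 fps_sumE.
under eq_bigr => i _ do rewrite cstM /X.
case: ifP => [/dvdnP[k nE]|np]; last first.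
  rewrite big1 // => i _; case: eqP => [nE|]; last by rewrite mulr0.
  by move/negP: np; case; apply/dvdnP; exists i.
have kn : (k < n.+1)%N by nia.
have -> : (n %/ p)%N = k by rewrite nE mulnK.
rewrite (bigD1 (Ordinal kn)) //= -nE eqxx mulr1 big1 ?addr0 // => i.
rewrite -val_eqE /= => /eqP ik; case: eqP => [ni|]; last by rewrite mulr0.
by case: ik; apply/eqP; rewrite -(eqn_pmul2r p_gt0) -nE -ni.
Qed.

Lemma F5_ind (P : 'F_5 -> Prop) : P 0 -> P 1 -> P 2 -> P 3 -> P 4 -> forall u, P u.
Proof.
move=> P0 P1 P2 P3 P4 [[|[|[|[|[|//]]]]] i].
- by rewrite (_ : Ordinal i = 0) //; apply: val_inj.
- by rewrite (_ : Ordinal i = 1) //; apply: val_inj.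
- by rewrite (_ : Ordinal i = 2) //; apply: val_inj.
- by rewrite (_ : Ordinal i = 3) //; apply: val_inj.
- by rewrite (_ : Ordinal i = 4) //; apply: val_inj.
Qed.

(** * Relations between the theta parts modulo 5 *)

Section Theta5.
Local Notation F := 'F_5.
Local Notation psi := (psi F).
Local Notation a := (th (1 : F)).
Local Notation b := (th (4 : F)).
Local Notation c := (th (0 : F)).

Lemma psi_pow5 : psi ^+ 5 = lac (fun=> 1 : F) (fun k => 5 * T k)%N.
Proof.
apply: fpsP => n; rewrite fps_Frobenius // (lacE _ (N := n.+1)) // => [|k]; last first.
  by have := T_nat_ge k; lia.
have Tge (k : nat) : (k <= T k)%N by exact: T_nat_ge.
case: ifP => [/dvdnP[k ->]|n5]; last first.
  by rewrite big_pred0 // => k; apply/negP => /eqP E; move: n5; rewrite -E dvdn_mulr.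
rewrite mulnK //; transitivity (lac (fun=> 1 : F) (fun k : nat => T k) k) => //.
rewrite (@lacE _ (fun=> 1) (fun k : nat => T k) _ (k * 5).+1) //; last lia.
by apply: eq_bigl => i; apply/eqP/eqP; lia.
Qed.

(** Multiplied by 4, both sides become sums over pairs of integers. The condition of [sum_lattice5]
    says [2u + 1 = 2 (2v + 1)] modulo 5, and the substitution there produces [x psi(x^5)^2]. *)
Lemma theta_lattice5 : a * b + c ^+ 2 = X F 1 * psi ^+ 10.
Proof.
apply: fpsP => n; pose N := n.+1.
have Tge (k : nat) : (k <= T k)%N by exact: T_nat_ge.
have T5 (k : nat) : (k <= 5 * T k)%N by have := Tge k; lia.
have four : 4%:R != 0 :> F by [].
apply: (mulfI four).
have thM (C D : F) : (th C * th D) n =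
    \sum_(i < N) \sum_(j < N | (T i + T j == n)%N) sqw C i * sqw D j.
  exact: (lacM (fun k : nat => sqw C k) (fun k : nat => sqw D k) Tge Tge).
have zM (f g : int -> F) : (forall k, f (- 1 - k) = f k) -> (forall k, g (- 1 - k) = g k) ->
    4%:R * (\sum_(i < N) \sum_(j < N | (T i + T j == n)%N) f i * g j) =
    \sum_(u <- zbox N) \sum_(v <- zbox N | (T u + T v == n)%N) f u * g v.
  move=> fe ge; under [RHS]eq_bigr do rewrite big_mkcond.
  rewrite sum_zbox2 => [|u v|u v]; rewrite ?T_opp ?fe ?ge //.
  by congr (_ * _); apply: eq_bigr => i _; rewrite big_mkcond.
rewrite fpsDE mulrDr expr2 !thM (zM _ _ (sqw_even _) (sqw_even _)) (zM _ _ (sqw_even _) (sqw_even _)).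
have -> : (X F 1 * psi ^+ 10) n = \sum_(i < N) \sum_(j < N | (5 * T i + 5 * T j + 1 == n)%N) 1.
  rewrite XME (exprM psi 5 2) expr2 psi_pow5.
  case: n @N thM zM => [|n] N _ _ /=.
    by rewrite big1 // => i _; rewrite big_pred0 // => j; apply/negbTE; lia.
  rewrite (lacM _ _ T5 T5 (N := N)); last by rewrite /N; lia.
  by apply: eq_bigr => i _; apply: eq_big => [j|j _]; [apply/idP/idP; lia|rewrite mulr1].
have -> : 4%:R * (\sum_(i < N) \sum_(j < N | (5 * T i + 5 * T j + 1 == n)%N) 1 : F) =
    \sum_(s <- zbox N) \sum_(t <- zbox N | (5 * T s + 5 * T t + 1 == n)%N) 1.
  under [RHS]eq_bigr do rewrite big_mkcond.
  rewrite sum_zbox2 => [|u v|u v]; rewrite ?T_opp //.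
  by congr (_ * _); apply: eq_bigr => i _; rewrite big_mkcond.
rewrite -sum_lattice5 //; pose o (u : int) : F := (2 * u + 1)%:~R.
pose I u v : F := (5 %| u - 2 * v - 3)%Z%:R.
have IE u v : I u v = (o u - 2 * o v == 0)%:R.
  rewrite /I (dvdz_pcharf (pchar_Fp (isT : prime 5))) /o !rmorphB !rmorphD !rmorphM /=.
  by elim/F5_ind: (u%:~R); elim/F5_ind: (v%:~R).
pose s0 u : F := sqw 1 u.
(* If [o u] is 1 or -1 and [o v] is 2 or -2, exactly one of [o u = 2 o v] and [o v = 2 o u] holds.
   These pairs make up [a b], and [o u = o v = 0] makes up [c^2]. Exchanging [u] and [v] in the
   second sum restores the single condition. *)
transitivity (\sum_(u <- zbox N) \sum_(v <- zbox N | (T u + T v == n)%N) I u v * (1 - s0 v) +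
    \sum_(u <- zbox N) \sum_(v <- zbox N | (T u + T v == n)%N) I v u * s0 u); last first.
  rewrite [X in _ + X](exchange_big_dep xpredT) //= -big_split; apply: eq_bigr => u _ /=.
  rewrite [X in _ + X](eq_bigl (fun v => T u + T v == n)%N) => [|v]; last by rewrite addnC.
  rewrite -big_split [RHS]big_mkcondr; apply: eq_bigr => v _ /=.
  by rewrite /I; case: ifP => _ /=; ring.
rewrite -!big_split; apply: eq_bigr => u _; rewrite -!big_split; apply: eq_bigr => v _ /=.
rewrite !IE /s0 /sqw -!/(o _); elim/F5_ind: (o u); elim/F5_ind: (o v); exact: val_inj.
Qed.

(** 5 divides [2k + 1] exactly when [k = 5j + 2], and then [T k = 25 T j + 3]; Frobenius twice gives
    [psi^25 = psi(x^25)]. *)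
Lemma th0_pow25 : c = X F 3 * psi ^+ 25.
Proof.
have Tge (k : nat) : (k <= T k)%N by exact: T_nat_ge.
apply: fpsP => n; pose N := n.+1.
transitivity (\sum_(j <- [seq j <- iota 0 N | (25 * T j%:Z + 3 == n)%N]) (1 : F)); last first.
  rewrite big_filter -[X in iota 0 X](subn0 N) -/(index_iota 0 N) big_mkord.
  rewrite XME (exprM psi 5 5) fps_Frobenius // fps_Frobenius //.
  have [[m nE]|nm] := pselect (exists m, n = (25 * m + 3)%N); last first.
    rewrite big_pred0 => [|j]; last first.
      by apply/negP => /eqP jn; case: nm; exists (T j%:Z).
    do 3 case: ifP => // ?; case: nm; exists ((n - 3) %/ 5 %/ 5)%N; lia.
  have [-> -> -> ->] : [/\ (3 <= n)%N, (5 %| n - 3)%N, (5 %| (n - 3) %/ 5)%N &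
      ((n - 3) %/ 5 %/ 5)%N = m] by split; lia.
  transitivity (lac (fun=> 1 : F) (fun k : nat => T k) m) => //.
  rewrite (@lacE _ (fun=> 1) (fun k : nat => T k) _ N) //; last by rewrite /N nE; lia.
  by apply: eq_bigl => j; apply/eqP/eqP; lia.
transitivity (\sum_(k <- [seq k <- iota 0 N | (T k%:Z == n) && (k %% 5 == 2)%N]) (1 : F)).
  rewrite big_filter -[X in iota 0 X](subn0 N) -/(index_iota 0 N) big_mkord big_mkcondr /=.
  transitivity (lac (fun k : nat => sqw (0 : F) k) (fun k : nat => T k) n) => //.
  rewrite (@lacE _ _ (fun k : nat => T k) _ N) //; apply: eq_bigr => k _.
  rewrite /sqw rmorphD rmorphM /= -pmulrn (@natr_mod 5 k (k %% 5)) ?modn_mod //.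
  by case: (k %% 5)%N (ltn_pmod k (isT : (0 < 5)%N)) => [|[|[|[|[|]]]]].
rewrite [RHS](_ : _ = \sum_(k <- [seq (5 * j + 2)%N | j <- iota 0 N & (25 * T j%:Z + 3 == n)%N]) (1 : F));
  last by rewrite big_map.
have TE j : (T (5 * j + 2)%N%:Z = 25 * T j%:Z + 3)%N.
  by have := T2 j; have := T2 (5 * j + 2)%N; nia.
apply: perm_big; apply: uniq_perm.
- exact/filter_uniq/iota_uniq.
- by rewrite map_inj_uniq ?filter_uniq ?iota_uniq // => i j; lia.
move=> k; rewrite mem_filter mem_iota; apply/idP/mapP.
  move=> /andP[/andP[/eqP Tk k5] kN]; have kE : k = (5 * (k %/ 5) + 2)%N by lia.
  exists (k %/ 5)%N => //; rewrite mem_filter mem_iota.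
  by have := TE (k %/ 5)%N; rewrite -kE; lia.
move=> [j]; rewrite mem_filter mem_iota => /andP[/eqP jn jN] kE; have := TE j; rewrite -kE => TT.
have : (k %% 5 == 2)%N by lia.
by have := Tge k; rewrite TT jn eqxx /N => kn ->; lia.
Qed.
End Theta5.

Section ThetaLinear.
Variable R : comNzRingType.
Implicit Types w v : nat -> R.

Lemma thetaMn (n : nat) w : theta (fun k => n%:R * w k) = n%:R * theta w.
Proof. by rewrite thetaZ rmorph_nat. Qed.

Lemma theta_lin3 (y1 y4 y0 : nat) v1 v4 v0 :
  theta (fun k : nat => y1%:R * v1 k + y4%:R * v4 k + y0%:R * v0 k) =
  y1%:R * theta v1 + y4%:R * theta v4 + y0%:R * theta v0.
Proof. by rewrite !thetaD !thetaMn. Qed.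

Lemma theta_lin5 (x1 x4 y1 y4 y0 : nat) w1 w4 v1 v4 v0 :
  theta (fun k : nat => x1%:R * w1 k + x4%:R * w4 k +
    (y1%:R * v1 k + y4%:R * v4 k + y0%:R * v0 k)) =
  x1%:R * theta w1 + x4%:R * theta w4 +
    (y1%:R * theta v1 + y4%:R * theta v4 + y0%:R * theta v0).
Proof. by rewrite thetaD theta_lin3 thetaD !thetaMn. Qed.

End ThetaLinear.

(** * The tables of [rho] and [omega] modulo 5 *)

Section Weights5.
Local Notation F := 'F_5.
Local Notation psi := (psi F).
Local Notation a := (th (1 : F)).
Local Notation b := (th (4 : F)).
Local Notation c := (th (0 : F)).
Local Notation E := (lambert F 1).
Local Notation D := (lambert F 3).

Lemma psi5 : psi = a + b + c.
Proof.
rewrite -!thetaD; apply: eq_theta => k; rewrite /sqw.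
by elim/F5_ind: (_%:~R); apply/eqP.
Qed.

Lemma pure_th5 (C : F) (d : nat) : (8 * d + 1)%:R = C -> pure 5 d (th C).
Proof.
move=> dC; apply: pure_theta => k; rewrite /sqw; case: (_ =P C) => [kC _|_]; last by rewrite eqxx.
apply: eqmod_F => //; have := T_eq F k; rewrite kC -dC.
by rewrite natrD [RHS]natrD => /addIr; rewrite !natrM; apply: mulfI.
Qed.

Lemma omega5 (C : F) p (e1 e4 e0 d1 d4 d0 : nat) :
  (forall u v : F, v ^+ p * (((u - 2 * v) ^+ 2 == C)%:R + ((u + 2 * v) ^+ 2 == C)%:R) =
    v * (e1%:R * (u ^+ 2 == 1)%:R + e4%:R * (u ^+ 2 == 4)%:R + e0%:R * (u ^+ 2 == 0)%:R) +
    v ^+ 3 * (d1%:R * (u ^+ 2 == 1)%:R + d4%:R * (u ^+ 2 == 4)%:R + d0%:R * (u ^+ 2 == 0)%:R)) ->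
  omega (sqw C) p = (e1%:R * a + e4%:R * b + e0%:R * c) * E + (d1%:R * a + d4%:R * b + d0%:R * c) * D.
Proof.
move=> H; rewrite -!theta_lin3; apply: omegaE => i k; rewrite expn1 !natrX /sqw.
have -> : (2 * (k%:Z - i%:Z) + 1)%:~R = (2 * k%:Z + 1)%:~R - 2 * i%:R :> F.
  by rewrite mulrBr addrAC rmorphB /= rmorphM.
have -> : (2 * (k%:Z + i%:Z) + 1)%:~R = (2 * k%:Z + 1)%:~R + 2 * i%:R :> F.
  by rewrite mulrDr addrAC rmorphD /= rmorphM.
exact: H.
Qed.

(* The coefficients of [rho] at [5 t + r] are linear in [t]; [w1] and [w4] carry the slopes. *)
Definition w1 (k : nat) : F :=
  (k %/ 5)%:R * (k %% 5 == 0)%N%:R - (k %/ 5).+1%:R * (k %% 5 == 4)%N%:R.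
Definition w4 (k : nat) : F :=
  (k %/ 5)%:R * (k %% 5 == 1)%N%:R - (k %/ 5).+1%:R * (k %% 5 == 3)%N%:R.

Lemma sqw5 (A : F) (k : nat) : sqw A (k + 5)%N = sqw A k.
Proof.
rewrite /sqw; congr (_ ^+ 2 == A)%:R.
have -> : 2 * (k + 5)%N%:Z + 1 = (2 * k%:Z + 1) + 10 by lia.
by rewrite rmorphD /= (_ : 10%:~R = 0 :> F) ?addr0 //; apply: val_inj.
Qed.

Definition rho_coef (C : F) p k : F := \sum_(l < k.+1) sqw C l%:Z * ((k - l) ^ p)%:R.

(** The five new values of [l] fill one period, so the increment depends only on [k] modulo 5 and
    [rho_coef] is linear along each class. *)
Lemma rho_coefD5 (C : F) p k : rho_coef C p (k + 5)%N = rho_coef C p k +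
  \sum_(j < 5) (((2 * k%:Z + 1)%:~R + (2 * j.+1)%:R) ^+ 2 == C)%:R * ((4 - j) ^ p)%:R.
Proof.
rewrite /rho_coef -addSn big_split_ord; congr (_ + _); apply: eq_bigr => l _ /=.
  congr (_ * _); apply: natr_mod => //.
  rewrite -modnXm -[in RHS]modnXm; congr (_ ^ _ %% _)%N.
  by rewrite addnC -addnBA ?modnDl // -ltnS.
rewrite /sqw; congr ((_ ^+ 2 == C)%:R * (_ ^ p)%:R); last lia.
have -> : 2 * (k.+1 + l)%N%:Z + 1 = (2 * k%:Z + 1) + (2 * l.+1)%N%:Z by lia.
by rewrite rmorphD.
Qed.

Lemma odd_mod5 (k : nat) : (2 * k%:Z + 1)%:~R = 2 * (k %% 5)%:R + 1 :> F.
Proof. by rewrite rmorphD rmorphM /= -pmulrn (@natr_mod 5 k (k %% 5)) ?modn_mod. Qed.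

Lemma wD5 k (u := (2 * k%:Z + 1)%:~R : F) :
  w1 (k + 5) = w1 k + ((u == 1)%:R - (u == 4)%:R) /\
  w4 (k + 5) = w4 k + ((u == 3)%:R - (u == 2)%:R).
Proof.
rewrite /u odd_mod5 /w1 /w4 modnDr divnDr // divnn -!natr1 natrD.
move: ((k %/ 5)%N%:R : F) (ltn_pmod k (isT : (0 < 5)%N)) => q.
case: (k %% 5)%N => [|[|[|[|[|//]]]]] _; elim/F5_ind: q; split; exact: val_inj.
Qed.

Lemma rho5 (C : F) p (x1 x4 y1 y4 y0 : nat) :
  (forall k : nat, (k < 5)%N -> rho_coef C p k =
    x1%:R * w1 k + x4%:R * w4 k +
    (y1%:R * sqw (1 : F) k%:Z + y4%:R * sqw (4 : F) k%:Z + y0%:R * sqw (0 : F) k%:Z)) ->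
  (forall u : F, \sum_(j < 5) ((u + (2 * j.+1)%:R) ^+ 2 == C)%:R * ((4 - j) ^ p)%:R =
    x1%:R * ((u == 1)%:R - (u == 4)%:R) + x4%:R * ((u == 3)%:R - (u == 2)%:R) :> F) ->
  rho (sqw C) p = x1%:R * theta w1 + x4%:R * theta w4 + (y1%:R * a + y4%:R * b + y0%:R * c).
Proof.
move=> base step; rewrite -theta_lin5; apply: eq_theta => k; rewrite -/(rho_coef C p k).
elim/ltn_ind: k => k IH; case: (ltnP k 5) => [/base //|k5].
rewrite -(subnK k5); move: (k - 5)%N (IH (k - 5)%N ltac:(lia)) => {k5 IH} {}k IH.
by rewrite rho_coefD5 step IH !sqw5; case: (wD5 k) => -> ->; ring.
Qed.

Ltac rho5_base := move=> [|[|[|[|[|//]]]]] _;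
  rewrite /rho_coef !big_ord_recr big_ord0 /sqw; exact: val_inj.
Ltac rho5_step := by elim/F5_ind; rewrite !big_ord_recr big_ord0; exact: val_inj.

Lemma rho_0_1 : rho (sqw (0 : F)) 1 =
  3%:R * theta w1 + 4%:R * theta w4 + (0%:R * a + 0%:R * b + 0%:R * c).
Proof. by apply: rho5; [rho5_base|rho5_step]. Qed.

Lemma rho_0_3 : rho (sqw (0 : F)) 3 =
  2%:R * theta w1 + 4%:R * theta w4 + (0%:R * a + 0%:R * b + 0%:R * c).
Proof. by apply: rho5; [rho5_base|rho5_step]. Qed.

Lemma rho_1_1 : rho (sqw (1 : F)) 1 =
  1%:R * theta w1 + 3%:R * theta w4 + (0%:R * a + 1%:R * b + 2%:R * c).
Proof. by apply: rho5; [rho5_base|rho5_step]. Qed.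

Lemma rho_1_3 : rho (sqw (1 : F)) 3 =
  1%:R * theta w1 + 4%:R * theta w4 + (0%:R * a + 1%:R * b + 3%:R * c).
Proof. by apply: rho5; [rho5_base|rho5_step]. Qed.

Lemma rho_4_1 : rho (sqw (4 : F)) 1 =
  1%:R * theta w1 + 3%:R * theta w4 + (0%:R * a + 0%:R * b + 1%:R * c).
Proof. by apply: rho5; [rho5_base|rho5_step]. Qed.

Lemma rho_4_3 : rho (sqw (4 : F)) 3 =
  2%:R * theta w1 + 2%:R * theta w4 + (0%:R * a + 0%:R * b + 1%:R * c).
Proof. by apply: rho5; [rho5_base|rho5_step]. Qed.

Lemma omega_0_1 : omega (sqw (0 : F)) 1 =
  (3%:R * a + 3%:R * b + 0%:R * c) * E + (2%:R * a + 3%:R * b + 0%:R * c) * D.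
Proof. by apply: omega5; elim/F5_ind; elim/F5_ind; exact: val_inj. Qed.

Lemma omega_0_3 : omega (sqw (0 : F)) 3 =
  (2%:R * a + 3%:R * b + 0%:R * c) * E + (3%:R * a + 3%:R * b + 0%:R * c) * D.
Proof. by apply: omega5; elim/F5_ind; elim/F5_ind; exact: val_inj. Qed.

Lemma omega_1_1 : omega (sqw (1 : F)) 1 =
  (3%:R * a + 1%:R * b + 1%:R * c) * E + (3%:R * a + 0%:R * b + 4%:R * c) * D.
Proof. by apply: omega5; elim/F5_ind; elim/F5_ind; exact: val_inj. Qed.

Lemma omega_1_3 : omega (sqw (1 : F)) 3 =
  (3%:R * a + 0%:R * b + 4%:R * c) * E + (3%:R * a + 1%:R * b + 1%:R * c) * D.
Proof. by apply: omega5; elim/F5_ind; elim/F5_ind; exact: val_inj. Qed.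

Lemma omega_4_1 : omega (sqw (4 : F)) 1 =
  (1%:R * a + 3%:R * b + 1%:R * c) * E + (0%:R * a + 2%:R * b + 1%:R * c) * D.
Proof. by apply: omega5; elim/F5_ind; elim/F5_ind; exact: val_inj. Qed.

Lemma omega_4_3 : omega (sqw (4 : F)) 3 =
  (0%:R * a + 2%:R * b + 1%:R * c) * E + (1%:R * a + 3%:R * b + 1%:R * c) * D.
Proof. by apply: omega5; elim/F5_ind; elim/F5_ind; exact: val_inj. Qed.

(** For [n = 2m] in class [x], [m = 3x] and [(m / d)^3 = m^3 d] because [d^4 = 1]; here
    [m^3 = 27 x^3 = 2 x^3]. Complementary divisors turn cubes into first powers. *)
Lemma cl_lambert5 (x : nat) : (x %% 5 != 0)%N -> cl 5 x D = (2 * x%:R ^+ 3) * cl 5 x E.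
Proof.
move=> x5; apply: fpsP => n; rewrite -natrX -natrM fpsnatM /cl.
case: eqP => nx; last by rewrite mulr0.
rewrite !lambertE; case: ifP => [_|]; first by rewrite mulr0.
move=> /negbT; rewrite negb_or => /andP[en n0].
have nE : n = (2 * n./2)%N by rewrite -[LHS]odd_double_half (negbTE en) mul2n.
have m0 : (0 < n./2)%N by move: n0; rewrite nE; lia.
rewrite sum_divisors_inv // mulr_sumr; apply: eq_big_seq => d.
rewrite -dvdn_divisors // => dm; rewrite natrM !natrX expr1.
have mE : (n./2)%:R = 3 * x%:R :> F.
  rewrite -(natr_mod (p := 5) _ nx) // [in RHS]nE natrM mulrA.
  by rewrite (_ : 3 * 2 = 1 :> F) ?mul1r //; apply: val_inj.
have x0 : x%:R != 0 :> F.
  by apply: contra_neq x5 => /(@eqmod_F 5 x 0 isT) ->.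
have K (q e y : F) : (y != 0) && (q * e == 3 * y) ==> (q ^+ 3 == 2 * y ^+ 3 * e).
  by elim/F5_ind: q; elim/F5_ind: e; elim/F5_ind: y.
have qd : (n./2 %/ d)%N%:R * d%:R = 3 * x%:R :> F by rewrite -natrM divnK.
by apply/eqP/(implyP (K _ _ _)); rewrite x0 qd eqxx.
Qed.

End Weights5.

Section RingTheory.
Variable S : comNzRingType.

Lemma comNzRing_theory : Ring_theory.ring_theory (0 : S) 1 +%R *%R (fun x y => x - y) -%R eq.
Proof.
split=> //; [exact: add0r|exact: addrC|exact: addrA|exact: mul1r|exact: mulrC|exact: mulrA|
  exact: mulrDl|exact: subrr].
Qed.

Lemma comNzRing_power :
  Ring_theory.power_theory (1 : S) *%R eq BinNat.N.to_nat (@GRing.exp S).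
Proof.
split=> r [|n] //=; elim: n => [n IH|n IH|] //=.
- by rewrite Pnat.Pos2Nat.inj_xI exprS multE mulnC exprM IH expr2.
- by rewrite Pnat.Pos2Nat.inj_xO multE mulnC exprM IH expr2.
Qed.

End RingTheory.

(** * Class parts of the equations *)

Section Rows5.
Variable R : comNzRingType.
Local Notation S := (fps R).
Local Notation sub := (fun x y : S => x - y).
Local Notation cl := (@cl R 5).
Local Notation pure := (@pure R 5).
Hypothesis char5 : 5%:R = 0 :> S.
Variables (a b c t1 t4 psi p E D m : S).
Hypotheses (a0 : pure 0 a) (b1 : pure 1 b) (c3 : pure 3 c) (t1_0 : pure 0 t1) (t4_1 : pure 1 t4).
Hypothesis psip : psi * p = 1.
Local Notation P := (@recip5 S 1 +%R *%R sub -%R (@GRing.exp S) m).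
Local Notation K := (@phi5 S 0 1 +%R *%R sub -%R (@GRing.exp S) m).
Local Notation lin := (@lin5 S 0 1 +%R *%R sub (@GRing.exp S) m).
Local Notation lint := (@lint5 S 0 1 +%R *%R (t1 * p) (t4 * p)).
Local Notation num5 := (@num5 S 0 1 +%R).
Local Notation conv := (@conv5 S +%R *%R).
Hypothesis aE : a * p = @hat_a S 1 +%R *%R sub (@GRing.exp S) m.
Hypothesis bE : b * p = @hat_b S 1 +%R *%R sub (@GRing.exp S) m.
Hypothesis cE : c * p = @hat_c S 1 +%R *%R sub (@GRing.exp S) m.
Hypothesis clp : forall n, cl n p = p * P n.
Hypothesis clDE : forall n, (n %% 5 != 0)%N -> cl n D = (2 * n%:R ^+ 3) * cl n E.

Lemma num5E k : (k < 5)%N -> num5 k = k%:R.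
Proof. by move: k => [|[|[|[|[|]]]]]. Qed.

Lemma cl_mod5 n f : cl n f = cl (n %% 5) f.
Proof. by rewrite /cl modn_mod. Qed.

Lemma cl_pureM5 d f g n : pure d f -> cl n (f * g) = f * cl (n + 4 * d) g.
Proof.
move=> fd; rewrite -(cl_pureM _ _ fd) cl_mod5 [RHS]cl_mod5.
by rewrite (_ : d + (n + 4 * d) = n + d * 5)%N ?modnMDr 1?addnC ?modnMDl //; lia.
Qed.

Lemma cl_natM k f n : cl n (k%:R * f) = k%:R * cl n f.
Proof. by apply: fpsP => i; rewrite fpsnatM /cl fpsnatM; case: ifP; rewrite ?mulr0. Qed.

Lemma cl_lin g Q y1 y4 y0 n : (y1 < 5)%N -> (y4 < 5)%N -> (y0 < 5)%N ->
  (forall n, cl n g = p * Q n) ->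
  cl n ((y1%:R * a + y4%:R * b + y0%:R * c) * g) = lin Q y1 y4 y0 n.
Proof.
move=> y1n y4n y0n gQ; rewrite !mulrDl !clD -!mulrA !cl_natM.
rewrite (cl_pureM5 _ _ a0) (cl_pureM5 _ _ b1) (cl_pureM5 _ _ c3) !gQ.
by rewrite /lin5 !num5E // -aE -bE -cE addn0; ring.
Qed.

Lemma cl_lint g Q x1 x4 n : (x1 < 5)%N -> (x4 < 5)%N ->
  (forall n, cl n g = p * Q n) ->
  cl n ((x1%:R * t1 + x4%:R * t4) * g) = lint Q x1 x4 n.
Proof.
move=> x1n x4n gQ; rewrite !mulrDl !clD -!mulrA !cl_natM.
rewrite (cl_pureM5 _ _ t1_0) (cl_pureM5 _ _ t4_1) !gQ.
by rewrite /lint5 !num5E // addn0; ring.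
Qed.

Lemma cl_conv f g Q n : (forall n, cl n g = p * Q n) ->
  cl n (f * g) = p * conv (cl ^~ f) Q n.
Proof.
move=> gQ; rewrite clM // !big_ord_recr big_ord0 /= !gQ /conv5.
by rewrite addn0; ring.
Qed.

Lemma clDD5 n : (n < 5)%N -> cl n D = @lamb5 S 0 1 +%R *%R (@GRing.exp S) (cl 0 D) (cl ^~ E) n.
Proof.
case: n => [|n] n5 //; rewrite clDE ?modn_small // -(num5E n5).
by move: n n5 => [|[|[|[|]]]].
Qed.

Lemma cl_convD g Q n : (forall n, cl n g = p * Q n) ->
  cl n (D * g) = p * conv (@lamb5 S 0 1 +%R *%R (@GRing.exp S) (cl 0 D) (cl ^~ E)) Q n.
Proof.
move=> gQ; rewrite (cl_conv _ _ gQ) /conv5; congr (_ * _).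
by rewrite (@clDD5 1) // (@clDD5 2) // (@clDD5 3) // (@clDD5 4).
Qed.

Lemma cl_om e1 e4 e0 d1 d4 d0 g (f1 f2 : nat -> S) (E1 E2 : S) n :
  [&& e1 < 5, e4 < 5, e0 < 5, d1 < 5, d4 < 5 & d0 < 5]%N ->
  (forall n, cl n (E1 * g) = p * f1 n) -> (forall n, cl n (E2 * g) = p * f2 n) ->
  cl n (((e1%:R * a + e4%:R * b + e0%:R * c) * E1 + (d1%:R * a + d4%:R * b + d0%:R * c) * E2) * g) =
  lin f1 e1 e4 e0 n + lin f2 d1 d4 d0 n.
Proof.
by case/and5P=> ? ? ? ? /andP[? ?] g1 g2; rewrite mulrDl clD -!mulrA !(cl_lin _ _ _ _ g1, cl_lin _ _ _ _ g2).
Qed.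

Lemma cl_rho x1 x4 y1 y4 y0 g Q n : [&& x1 < 5, x4 < 5, y1 < 5, y4 < 5 & y0 < 5]%N ->
  (forall n, cl n g = p * Q n) ->
  cl n ((x1%:R * t1 + x4%:R * t4 + (y1%:R * a + y4%:R * b + y0%:R * c)) * g) =
  lint Q x1 x4 n + lin Q y1 y4 y0 n.
Proof.
by case/and5P=> ? ? ? ? ? gQ; rewrite mulrDl clD (cl_lint _ _ _ gQ) // (cl_lin _ _ _ _ gQ).
Qed.

Lemma cl_der f n : cl n (der f) = n%:R * cl n f.
Proof.
apply: fpsP => i; rewrite fpsnatM /cl /der; case: eqP => [ni|]; last by rewrite mulr0.
congr (_ * _); rewrite (divn_eq i 5) (divn_eq n 5) ni !natrD !natrM.
by have := congr1 (@^~ 0%N) char5; rewrite fpsnatE fps0E /= => ->; rewrite !mulr0.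
Qed.

(** As [h] is pure, class [d + n] of [h M] is [h] times class [n] of [M]. The derivative contributes
    the factor [n], and [psi p = 1] puts [psi] next to [cl n M]. *)
Lemma row_M d h A rho om (rhoP omP : nat -> S) M n : (n < 5)%N -> pure d h ->
  h * M = A - (rho + om) * p - h * der p + 3 * h * (E * p) -> cl (d + n) A = 0 ->
  cl (d + n) (rho * p) = rhoP (d + n)%N -> cl (d + n) (om * p) = omP (d + n)%N ->
  h * p * (psi * cl n M) + rhoP (d + n)%N + omP (d + n)%N - 3 * (h * p) * conv (cl ^~ E) P n +
    num5 n * (h * p) * P n = 0.
Proof.
move=> n5 hd hM A0 rhoE omE; have := congr1 (cl (d + n)) hM.
rewrite (mulrDl rho) !(clD, clN) -mulrA (cl_natM 3) !(cl_pureM _ _ hd) A0 rhoE omE cl_der clp.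
rewrite (cl_conv _ _ clp) num5E // => E1.
transitivity (h * cl n M * (psi * p) + rhoP (d + n)%N + omP (d + n)%N -
  3 * (h * p) * conv (cl ^~ E) P n + n%:R * (h * p) * P n); first ring.
by rewrite psip mulr1 E1; ring.
Qed.

Lemma row_N d h A rho3 om3 rho om q (rho3P om3P rhoP omP : nat -> S) N n : pure d h ->
  h * N = A - 4 * ((rho3 + om3) * p) + 3 * ((rho + om) * q) -> cl (d + n) A = 0 ->
  cl (d + n) (rho3 * p) = rho3P (d + n)%N -> cl (d + n) (om3 * p) = om3P (d + n)%N ->
  cl (d + n) (rho * q) = rhoP (d + n)%N -> cl (d + n) (om * q) = omP (d + n)%N ->
  h * p * (psi * cl n N) + 4 * (rho3P (d + n)%N + om3P (d + n)%N) -
    3 * (rhoP (d + n)%N + omP (d + n)%N) = 0.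
Proof.
move=> hd hN A0 r3 o3 r o; have := congr1 (cl (d + n)) hN.
rewrite !(clD, clN) (cl_natM 4) (cl_natM 3) (mulrDl rho3) (mulrDl rho) !clD
  (cl_pureM _ _ hd) A0 r3 o3 r o => E1.
transitivity (h * cl n N * (psi * p) + 4 * (rho3P (d + n)%N + om3P (d + n)%N) -
  3 * (rhoP (d + n)%N + omP (d + n)%N)); first ring.
by rewrite psip mulr1 E1; ring.
Qed.

End Rows5.

Section Reciprocal5.
Variable R : comNzRingType.
Local Notation S := (fps R).
Local Notation sub := (fun x y : S => x - y).
Local Notation cl := (@cl R 5).
Local Notation pure := (@pure R 5).
Local Notation exp := (@GRing.exp S).
Hypothesis char5 : 5%:R = 0 :> S.
Variables (a b c psi p m : S).
Hypotheses (a0 : pure 0 a) (b1 : pure 1 b) (c3 : pure 3 c) (psi5 : pure 0 (psi ^+ 5)).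
Hypotheses (psip : psi * p = 1) (psiE : psi = a + b + c).
Local Notation P := (@recip5 S 1 +%R *%R sub -%R exp m).
Local Notation K := (@phi5 S 0 1 +%R *%R sub -%R exp m).
Local Notation num5 := (@num5 S 0 1 +%R).
Hypothesis aE : a * p = @hat_a S 1 +%R *%R sub exp m.
Hypothesis bE : b * p = @hat_b S 1 +%R *%R sub exp m.
Hypothesis cE : c * p = @hat_c S 1 +%R *%R sub exp m.

Lemma char5_sum : 1 + (1 + 1) * (1 + 1) = 0 :> S.
Proof. by rewrite -char5; ring. Qed.

Lemma pure_mod5 d e f : (d = e %[mod 5])%N -> pure d f -> pure e f.
Proof. by move=> de fd n; rewrite -de; apply: fd. Qed.

Lemma cl_parts (g : nat -> S) f r : (r < 5)%N -> f = \sum_(i < 5) g i ->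
  (forall i : 'I_5, pure i (g i)) -> cl r f = g r.
Proof.
move=> r5 -> gp; rewrite (bigD1 (Ordinal r5)) //= clD (cl_pure (gp (Ordinal r5))).
rewrite (_ : cl r _ = 0) ?addr0 //.
elim/big_rec: _ => [|i f' ir IH]; first by rewrite cl0.
rewrite clD IH (cl_pure0 (gp i)) ?addr0 // !modn_small //.
by rewrite eq_sym; apply: contraNneq ir => /= ri; apply/eqP/val_inj.
Qed.

(** [p = psi^4 p^5] with [p^5] on multiples of 5, so the monomials [a^i b^j c^k] of [(a + b + c)^4]
    are sorted by [j + 3k] modulo 5. *)
Lemma cl_reciprocal n : cl n p = p * P n.
Proof.
pose g := p ^+ 5.
have g0 : pure 0 g by apply: (pure_inv psi5); rewrite -exprMn psip expr1n.
pose f0 := a ^+ 4 + 3 * 4 * a * b ^+ 2 * c + 4 * b * c ^+ 3.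
pose f1 := 4 * a ^+ 3 * b + 4 * b ^+ 3 * c + 2 * 3 * a ^+ 2 * c ^+ 2.
pose f2 := 2 * 3 * a ^+ 2 * b ^+ 2 + 3 * 4 * a * b * c ^+ 2 + c ^+ 4.
pose f3 := 4 * a * b ^+ 3 + 4 * a ^+ 3 * c + 2 * 3 * b ^+ 2 * c ^+ 2.
pose f4 := b ^+ 4 + 3 * 4 * a ^+ 2 * b * c + 4 * a * c ^+ 3.
pose G i := [:: f0; f1; f2; f3; f4]`_i * g.
have pg : p = \sum_(i < 5) G i.
  rewrite !big_ord_recr big_ord0 /= /G /=.
  transitivity (psi ^+ 4 * g); last by rewrite psiE /f0 /f1 /f2 /f3 /f4; ring.
  by rewrite -[LHS]mul1r -(expr1n _ 4) -psip /g; ring.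
have mono i j k l d : (j + 3 * k = d %[mod 5])%N ->
    pure d (l%:R * (a ^+ i * b ^+ j * c ^+ k * g)).
  move=> e; apply: pure_nat; apply: (@pure_mod5 (i * 0 + j * 1 + k * 3 + 0)).
    by rewrite -e; congr (_ %% _)%N; lia.
  by do !apply: pureM => //; apply: pureX.
have mono3 i j k l i' j' k' l' i'' j'' k'' l'' d f :
    (j + 3 * k = d %[mod 5])%N -> (j' + 3 * k' = d %[mod 5])%N -> (j'' + 3 * k'' = d %[mod 5])%N ->
    f = l%:R * (a ^+ i * b ^+ j * c ^+ k * g) + l'%:R * (a ^+ i' * b ^+ j' * c ^+ k' * g) +
      l''%:R * (a ^+ i'' * b ^+ j'' * c ^+ k'' * g) -> pure d f.
  by move=> e e' e'' ->; apply: pureD; first apply: pureD; apply: mono.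
have h0 : pure 0 (f0 * g).
  by apply: (@mono3 4 0 0 1 1 2 1 12 0 1 3 4)%N => //; rewrite /f0; ring.
have h1 : pure 1 (f1 * g).
  by apply: (@mono3 3 1 0 4 0 3 1 4 2 0 2 6)%N => //; rewrite /f1; ring.
have h2 : pure 2 (f2 * g).
  by apply: (@mono3 2 2 0 6 1 1 2 12 0 0 4 1)%N => //; rewrite /f2; ring.
have h3 : pure 3 (f3 * g).
  by apply: (@mono3 1 3 0 4 3 0 1 4 0 2 2 6)%N => //; rewrite /f3; ring.
have h4 : pure 4 (f4 * g).
  by apply: (@mono3 0 4 0 1 2 1 1 12 1 0 3 4)%N => //; rewrite /f4; ring.
have [] := recip5E (comNzRing_theory S) (comNzRing_power S) char5_sum m.
rewrite -aE -bE -cE => E0 [E1 [E2 [E3 E4]]].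
have clE r : (r < 5)%N -> cl r p = p * P r.
  move=> r5; rewrite (cl_parts r5 pg) => [|i]; last first.
    by case: i => -[|[|[|[|[|//]]]]] /= _; [exact: h0|exact: h1|exact: h2|exact: h3|exact: h4].
  rewrite /G; move: r r5 => [|[|[|[|[|//]]]]] _ /=.
  - by rewrite -E0 /f0 /g; ring.
  - by rewrite -E1 /f1 /g; ring.
  - by rewrite -E2 /f2 /g; ring.
  - by rewrite -E3 /f3 /g; ring.
  - by rewrite -E4 /f4 /g; ring.
elim/ltn_ind: n => n IH; case: (ltnP n 5) => [/clE //|n5].
have n5' : ((n - 5) < n)%N by lia.
by rewrite -[n in cl n](subnK n5) clDl IH // -[n in RHS](subnK n5) (addnC (n - 5)%N).
Qed.

(** [p - 8 der p] is [phi2 / psi^2], because [phi2 = 8 der psi + psi]; on class [n] the operator is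
    multiplication by [1 - 8n = 1 + 2n]. *)
Lemma cl_reciprocal2 n : cl n (p - 8 * der p) = p * K n.
Proof.
rewrite clD clN (cl_natM 8) cl_der // cl_reciprocal.
have -> : n%:R = num5 n.
  elim/ltn_ind: n => n IH; case: (ltnP n 5) => [/num5E -> //|n5].
  have n5' : ((n - 5) < n)%N by lia.
  by rewrite -[n in LHS](subnK n5) natrD char5 addr0 IH // -[n in RHS](subnK n5) (addnC (n - 5)%N).
rewrite /phi5; set x := num5 n.
transitivity (p * ((1 + (1 + 1) * x) * P n) - 2 * (5 * (p * x * P n))); first ring.
by rewrite char5 mul0r mulr0 subr0.
Qed.

End Reciprocal5.

Section Elimination5.
Variable R : comNzRingType.
Local Notation S := (fps R).
Local Notation sub := (fun x y : S => x - y).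
Local Notation cl := (@cl R 5).
Local Notation pure := (@pure R 5).
Local Notation exp := (@GRing.exp S).
Hypothesis char5 : 5%:R = 0 :> S.
Variables (a b c t1 t4 psi p E D m M N : S) (A B : nat -> S).
Hypotheses (a0 : pure 0 a) (b1 : pure 1 b) (c3 : pure 3 c) (psi5 : pure 0 (psi ^+ 5)).
Hypotheses (t1_0 : pure 0 t1) (t4_1 : pure 1 t4).
Hypotheses (psip : psi * p = 1) (psiE : psi = a + b + c).
Hypothesis aE : a * p = @hat_a S 1 +%R *%R sub exp m.
Hypothesis bE : b * p = @hat_b S 1 +%R *%R sub exp m.
Hypothesis cE : c * p = @hat_c S 1 +%R *%R sub exp m.
Hypothesis clDE : forall n, (n %% 5 != 0)%N -> cl n D = (2 * n%:R ^+ 3) * cl n E.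

Local Notation lin3 y1 y4 y0 := (y1%:R * a + y4%:R * b + y0%:R * c).
Local Notation om e1 e4 e0 d1 d4 d0 := (lin3 e1 e4 e0 * E + lin3 d1 d4 d0 * D).
Local Notation rho x1 x4 y1 y4 y0 := (x1%:R * t1 + x4%:R * t4 + lin3 y1 y4 y0).

Hypothesis A0 : forall n, (0 < n < 4)%N -> cl (3 + n) (A 0%N) = 0.
Hypothesis A1 : forall n, (0 < n < 4)%N -> cl (0 + n) (A 1%N) = 0.
Hypothesis A4 : forall n, (0 < n < 4)%N -> cl (1 + n) (A 4%N) = 0.
Hypothesis B0 : forall n, (0 < n < 4)%N -> cl (3 + n) (B 0%N) = 0.
Hypothesis B1 : forall n, (0 < n < 4)%N -> cl (0 + n) (B 1%N) = 0.
Hypothesis B4 : forall n, (0 < n < 4)%N -> cl (1 + n) (B 4%N) = 0.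

Hypothesis cM : c * M = A 0%N - (rho 3 4 0 0 0 + om 3 3 0 2 3 0) * p - c * der p + 3 * c * (E * p).
Hypothesis aM : a * M = A 1%N - (rho 1 3 0 1 2 + om 3 1 1 3 0 4) * p - a * der p + 3 * a * (E * p).
Hypothesis bM : b * M = A 4%N - (rho 1 3 0 0 1 + om 1 3 1 0 2 1) * p - b * der p + 3 * b * (E * p).
Local Notation q := (p - 8 * der p).
Hypothesis cN : c * N = B 0%N - 4 * ((rho 2 4 0 0 0 + om 2 3 0 3 3 0) * p) +
  3 * ((rho 3 4 0 0 0 + om 3 3 0 2 3 0) * q).
Hypothesis aN : a * N = B 1%N - 4 * ((rho 1 4 0 1 3 + om 3 0 4 3 1 1) * p) +
  3 * ((rho 1 3 0 1 2 + om 3 1 1 3 0 4) * q).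
Hypothesis bN : b * N = B 4%N - 4 * ((rho 2 2 0 0 1 + om 0 2 1 1 3 1) * p) +
  3 * ((rho 1 3 0 0 1 + om 1 3 1 0 2 1) * q).

Local Notation rowM := (@rowM5 S 0 1 +%R *%R sub -%R exp m (cl 0 D) (t1 * p) (t4 * p)
  (cl ^~ E) (fun n => psi * cl n M)).
Local Notation rowN := (@rowN5 S 0 1 +%R *%R sub -%R exp m (cl 0 D) (t1 * p) (t4 * p)
  (cl ^~ E) (fun n => psi * cl n N)).

Let clp := cl_reciprocal char5 a0 b1 c3 psi5 psip psiE aE bE cE.
Let clq := cl_reciprocal2 char5 a0 b1 c3 psi5 psip psiE aE bE cE.
Let clEp n := cl_conv E n clp.
Let clEq n := cl_conv E n clq.
Let clDp n := cl_convD clDE n clp.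
Let clDq n := cl_convD clDE n clq.


Local Notation rhoP := (@rho5_row S 0 1 +%R *%R sub exp m (t1 * p) (t4 * p)).
Local Notation rho3P := (@rho5_row3 S 0 1 +%R *%R sub exp m (t1 * p) (t4 * p)).
Local Notation omP := (@omega5_row S 0 1 +%R *%R sub exp m).
Local Notation P := (@recip5 S 1 +%R *%R sub -%R exp m).
Local Notation K := (@phi5 S 0 1 +%R *%R sub -%R exp m).
Local Notation cvE := (@conv5 S +%R *%R (cl ^~ E)).
Local Notation cvD := (@conv5 S +%R *%R (@lamb5 S 0 1 +%R *%R exp (cl 0 D) (cl ^~ E))).

Lemma rowM0 n : (0 < n < 4)%N -> rowM 0 n = 0.
Proof.
move=> n4; have n5 : (n < 5)%N by lia.
have r k : cl k (rho 3 4 0 0 0 * p) = rhoP 0 P k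
  by exact: (cl_rho a0 b1 c3 t1_0 t4_1 aE bE cE k _ clp).
have o k : cl k (om 3 3 0 2 3 0 * p) = omP 0 (cvE P) (cvD P) k
  by exact: (cl_om a0 b1 c3 aE bE cE k _ clEp clDp).
by have := row_M char5 psip clp n5 c3 cM (A0 n4) (r _) (o _); rewrite cE.
Qed.

Lemma rowN0 n : (0 < n < 4)%N -> rowN 0 n = 0.
Proof.
move=> n4.
have r3 k : cl k (rho 2 4 0 0 0 * p) = rho3P 0 P k by exact: (cl_rho a0 b1 c3 t1_0 t4_1 aE bE cE k _ clp).
have o3 k : cl k (om 2 3 0 3 3 0 * p) = omP 0 (cvD P) (cvE P) k.
  by rewrite (addrC (_ * E)); exact: (cl_om a0 b1 c3 aE bE cE k _ clDp clEp).
have r k : cl k (rho 3 4 0 0 0 * q) = rhoP 0 K k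
  by exact: (cl_rho a0 b1 c3 t1_0 t4_1 aE bE cE k _ clq).
have o k : cl k (om 3 3 0 2 3 0 * q) = omP 0 (cvE K) (cvD K) k
  by exact: (cl_om a0 b1 c3 aE bE cE k _ clEq clDq).
by have := row_N psip c3 cN (B0 n4) (r3 _) (o3 _) (r _) (o _); rewrite cE.
Qed.

Lemma rowM1 n : (0 < n < 4)%N -> rowM 1 n = 0.
Proof.
move=> n4; have n5 : (n < 5)%N by lia.
have r k : cl k (rho 1 3 0 1 2 * p) = rhoP 1 P k
  by exact: (cl_rho a0 b1 c3 t1_0 t4_1 aE bE cE k _ clp).
have o k : cl k (om 3 1 1 3 0 4 * p) = omP 1 (cvE P) (cvD P) k
  by exact: (cl_om a0 b1 c3 aE bE cE k _ clEp clDp).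
by have := row_M char5 psip clp n5 a0 aM (A1 n4) (r _) (o _); rewrite aE.
Qed.

Lemma rowN1 n : (0 < n < 4)%N -> rowN 1 n = 0.
Proof.
move=> n4.
have r3 k : cl k (rho 1 4 0 1 3 * p) = rho3P 1 P k by exact: (cl_rho a0 b1 c3 t1_0 t4_1 aE bE cE k _ clp).
have o3 k : cl k (om 3 0 4 3 1 1 * p) = omP 1 (cvD P) (cvE P) k.
  by rewrite (addrC (_ * E)); exact: (cl_om a0 b1 c3 aE bE cE k _ clDp clEp).
have r k : cl k (rho 1 3 0 1 2 * q) = rhoP 1 K k
  by exact: (cl_rho a0 b1 c3 t1_0 t4_1 aE bE cE k _ clq).
have o k : cl k (om 3 1 1 3 0 4 * q) = omP 1 (cvE K) (cvD K) k
  by exact: (cl_om a0 b1 c3 aE bE cE k _ clEq clDq).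
by have := row_N psip a0 aN (B1 n4) (r3 _) (o3 _) (r _) (o _); rewrite aE.
Qed.

Lemma rowM4 n : (0 < n < 4)%N -> rowM 4 n = 0.
Proof.
move=> n4; have n5 : (n < 5)%N by lia.
have r k : cl k (rho 1 3 0 0 1 * p) = rhoP 4 P k
  by exact: (cl_rho a0 b1 c3 t1_0 t4_1 aE bE cE k _ clp).
have o k : cl k (om 1 3 1 0 2 1 * p) = omP 4 (cvE P) (cvD P) k
  by exact: (cl_om a0 b1 c3 aE bE cE k _ clEp clDp).
by have := row_M char5 psip clp n5 b1 bM (A4 n4) (r _) (o _); rewrite bE.
Qed.

Lemma rowN4 n : (0 < n < 4)%N -> rowN 4 n = 0.
Proof.
move=> n4.
have r3 k : cl k (rho 2 2 0 0 1 * p) = rho3P 4 P k by exact: (cl_rho a0 b1 c3 t1_0 t4_1 aE bE cE k _ clp).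
have o3 k : cl k (om 0 2 1 1 3 1 * p) = omP 4 (cvD P) (cvE P) k.
  by rewrite (addrC (_ * E)); exact: (cl_om a0 b1 c3 aE bE cE k _ clDp clEp).
have r k : cl k (rho 1 3 0 0 1 * q) = rhoP 4 K k
  by exact: (cl_rho a0 b1 c3 t1_0 t4_1 aE bE cE k _ clq).
have o k : cl k (om 1 3 1 0 2 1 * q) = omP 4 (cvE K) (cvD K) k
  by exact: (cl_om a0 b1 c3 aE bE cE k _ clEq clDq).
by have := row_N psip b1 bN (B4 n4) (r3 _) (o3 _) (r _) (o _); rewrite bE.
Qed.

Lemma cl1_torsion :
  (1 + 2 * m ^+ 5 + 3 * m ^+ 10) * (m - 1) ^+ 3 * (m - 2) * (m + 1) * (psi * cl 1 M) = 0.
Proof.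
have := certificate1 (comNzRing_theory S) (comNzRing_power S) (char5_sum char5) m (cl 0 D)
  (t1 * p) (t4 * p) (cl ^~ E) (fun n => psi * cl n M) (fun n => psi * cl n N).
by rewrite !(rowM0, rowM1, rowM4, rowN0, rowN4) // !mulr0 !addr0.
Qed.

Lemma cl3_torsion : (m - 1) ^+ 7 * (m + 2) ^+ 4 * (m + 1) ^+ 4 * (psi * cl 3 M) = 0.
Proof.
have := certificate3 (comNzRing_theory S) (comNzRing_power S) (char5_sum char5) m (cl 0 D)
  (t1 * p) (t4 * p) (cl ^~ E) (fun n => psi * cl n M) (fun n => psi * cl n N).
rewrite !(rowM0, rowM1, rowM4, rowN0, rowN1, rowN4) // !mulr0 !subr0 !addr0.
by move/eqP; rewrite oppr_eq0 => /eqP.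
Qed.

End Elimination5.

Lemma phi2E (R : comNzRingType) : phi2 R = 8 * der (psi R) + psi R.
Proof.
rewrite der_theta -thetaMn -thetaD; apply: eq_theta => k.
have -> : (2 * k + 1)%:R ^+ 2 = (8 * T k + 1)%:R :> R.
  by rewrite -natrX; congr _%:R; have := T2 k; nia.
by rewrite mulr1 natrD natrM.
Qed.

Section Normalization.
Variable R : comNzRingType.
Local Notation S := (fps R).
Local Notation sub := (fun x y : S => x - y).
Local Notation exp := (@GRing.exp S).
Variables (psi p : S).
Hypothesis psip : psi * p = 1.

Lemma der_inverse : der p = - (der psi * p ^+ 2).
Proof.
have : der (psi * p) = 0.
  by apply: fpsP => n; rewrite psip /der fps1E; case: n => [|n]; rewrite ?mul0r ?mulr0.
rewrite derM => /eqP; rewrite addrC addr_eq0 => /eqP E.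
by rewrite -[LHS]mul1r -psip mulrAC E; ring.
Qed.

Lemma normalize_M h A ro E M :
  h * psi ^+ 2 * M = psi ^+ 2 * A - psi * ro + h * (der psi + 3 * psi * E) ->
  h * M = A - ro * p - h * der p + 3 * h * (E * p).
Proof.
move=> e; transitivity (h * psi ^+ 2 * M * p ^+ 2).
  by rewrite -[LHS]mul1r -(expr1n _ 2) -psip; ring.
rewrite e der_inverse.
transitivity (A * (psi * p) ^+ 2 - ro * p * (psi * p) - h * (- (der psi * p ^+ 2)) +
  3 * h * (E * p) * (psi * p)); first ring.
by rewrite psip expr1n !mulr1.
Qed.

(** The constant [L] is the same for every weight; [N = - L / psi^2] becomes the second unknown
    series. *)
Lemma normalize_N h B ro3 ro L : psi ^+ 2 * B = 4 * psi * ro3 - 3 * (8 * der psi + psi) * ro - h * L ->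
  h * (- (L * p ^+ 2)) = B - 4 * (ro3 * p) + 3 * (ro * (p - 8 * der p)).
Proof.
move=> e; have {1}-> : B = psi ^+ 2 * B * p ^+ 2.
  by transitivity ((psi * p) ^+ 2 * B); [rewrite psip expr1n mul1r|ring].
rewrite e der_inverse.
transitivity (4 * ro3 * p * (psi * p) - 3 * 8 * der psi * ro * p ^+ 2 -
  3 * ro * p * (psi * p) - h * L * p ^+ 2 - 4 * (ro3 * p) +
  3 * (ro * (p - 8 * (- (der psi * p ^+ 2))))); last ring.
by rewrite psip; ring.
Qed.

Hypothesis char5 : 5%:R = 0 :> S.

(** [y = x psi^8] fits both relations: the first divided by [psi^2] has right side [y], and
    [y^3 = x^3 psi^24 = c / psi]. *)
Lemma hat_param (a b c : S) : psi = a + b + c ->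
  a * b + c ^+ 2 = X R 1 * psi ^+ 10 -> c = X R 3 * psi ^+ 25 ->
  exists m, [/\ a * p = @hat_a S 1 +%R *%R sub exp m, b * p = @hat_b S 1 +%R *%R sub exp m &
    c * p = @hat_c S 1 +%R *%R sub exp m].
Proof.
move=> psiE ab ce; pose y := X R 1 * psi ^+ 8.
have [i yi] : exists i, (1 - y) * i = 1.
  by apply: fps_inverse; rewrite fpsBE /y XME fps1E subr0.
have E1 : a * p + b * p + c * p = 1 by rewrite -!mulrDl -psiE.
have E2 : a * p * (b * p) + (c * p) ^+ 2 = y.
  transitivity ((a * b + c ^+ 2) * p ^+ 2); first ring.
  rewrite ab; transitivity (X R 1 * psi ^+ 8 * (psi * p) ^+ 2); first ring.
  by rewrite psip expr1n mulr1.
have E3 : y ^+ 3 = c * p.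
  rewrite ce /y; transitivity (X R 3 * psi ^+ 24 * (psi * p)); last ring.
  by rewrite psip mulr1 exprMn XX -exprM; congr (X R _ * psi ^+ _).
have [] := hatsE (comNzRing_theory S) (comNzRing_power S) (char5_sum char5)
  _ _ _ E1 E2 E3 yi (erefl _).
by move=> aE [bE cE]; exists ((a * p - b * p) * i).
Qed.

End Normalization.

Lemma fps_pow0 (R : comNzRingType) (f : fps R) k : (f ^+ k) 0%N = f 0%N ^+ k.
Proof.
by elim: k => [|k IH]; rewrite ?expr0 // !exprS fpsME big_ord1 subnn IH.
Qed.

(** Since [x^5 = x], this is [1 + 2x + 3x^2], whose discriminant [-8 = 2] is not a square modulo
    5. *)
Lemma F5_quadratic (x : 'F_5) : 1 + 2 * x ^+ 5 + 3 * x ^+ 10 != 0.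
Proof.
have -> : x ^+ 10 = (x ^+ 5) ^+ 2 by rewrite -exprM.
have -> : x ^+ 5 = x by elim/F5_ind: x; apply/eqP.
by elim/F5_ind: x.
Qed.

Section Torsion5.
Local Notation S := (fps 'F_5).
Local Notation sub := (fun x y : S => x - y).
Local Notation exp := (@GRing.exp S).
Variables (psi p b c m : S).
Hypotheses (psip : psi * p = 1) (b0 : b != 0) (c0 : c != 0).
Hypothesis bE : b * p = @hat_b S 1 +%R *%R sub exp m.
Hypothesis cE : c * p = @hat_c S 1 +%R *%R sub exp m.

(** The linear factors occur in the nonzero series [b / psi] or [c / psi]; the last factor has a
    nonzero constant coefficient. *)
Lemma hat_factors_neq0 :
  [/\ m - 1 != 0, m - 2 != 0, m + 2 != 0, m + 1 != 0 & 1 + 2 * m ^+ 5 + 3 * m ^+ 10 != 0].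
Proof.
have bp : b * p != 0 by apply: contraNneq b0 => E; rewrite -[b]mul1r -psip mulrAC -mulrA E mulr0.
have cp : c * p != 0 by apply: contraNneq c0 => E; rewrite -[c]mul1r -psip mulrAC -mulrA E mulr0.
split.
- by apply: contraNneq bp => E; rewrite bE /hat_b E !mul0r.
- by apply: contraNneq bp => E; rewrite bE /hat_b (_ : m - (1 + 1) = 0) ?mulr0 ?mul0r.
- by apply: contraNneq bp => E; rewrite bE /hat_b (_ : m + (1 + 1) = 0) ?expr0n ?mulr0.
- by apply: contraNneq cp => E; rewrite cE /hat_c E expr0n mulr0.
apply/eqP => /(congr1 (@^~ 0%N)) /eqP.
rewrite !fpsDE !fpsnatM !fps_pow0 fps0E fps1E; apply/negP.
exact: F5_quadratic.
Qed.

End Torsion5.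

Section Mod5.
Local Notation F := 'F_5.
Local Notation S := (fps F).
Local Notation psi := (psi F).
Local Notation a := (th (1 : F)).
Local Notation b := (th (4 : F)).
Local Notation c := (th (0 : F)).
Local Notation E := (lambert F 1).
Local Notation D := (lambert F 3).
Local Notation M := (Mser F).
Local Notation cl := (cl 5).
Local Notation pure := (pure 5).

Lemma pure_w1 : pure 0 (theta w1).
Proof.
apply: pure_theta => k; rewrite /w1 => kn; have := T2 k.
have : (k %% 5 == 0)%N || (k %% 5 == 4)%N.
  by apply: contraNT kn; rewrite negb_or => /andP[/negbTE -> /negbTE ->]; rewrite !mulr0 subr0.
by move=> /orP[] /eqP k5 Tk; rewrite mod0n; nia.
Qed.

Lemma pure_w4 : pure 1 (theta w4).
Proof.
apply: pure_theta => k; rewrite /w4 => kn; have := T2 k.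
have : (k %% 5 == 1)%N || (k %% 5 == 3)%N.
  by apply: contraNT kn; rewrite negb_or => /andP[/negbTE -> /negbTE ->]; rewrite !mulr0 subr0.
by move=> /orP[] /eqP k5 Tk; rewrite (modn_small (_ : 1 < 5)%N) //; nia.
Qed.

(** A nonzero square is 1 or 4, so [8n = 1 - v^2] leaves only the classes 0 and 4 for [n]; this is
    the origin of the range [0 < n < 4]. *)
Lemma F5_class (v : F) n : v != 0 -> (0 < n < 4)%N -> (8 * n)%:R + v ^+ 2 != 1.
Proof. by move: n => [|[|[|[|//]]]] //; elim/F5_ind: v. Qed.

Lemma cl_appell_sum5 (C : F) (w : nat -> F) (d n : nat) : (8 * d + 1)%:R = C ->
  (forall j : nat, (2 * j%:Z + 1)%:~R = 0 :> F -> w j = 0) ->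
  (0 < n < 4)%N -> cl (d + n) (appell_sum (sqw C) w) = 0.
Proof.
move=> dC w0 n4; apply: cl_appell_sum => // v v0; apply/eqP => vC.
case/eqP: (F5_class v0 n4); apply: (@addrI _ (8 * d)%:R).
transitivity C; last by rewrite -dC natrD.
by rewrite -vC mulnDr natrD addrA.
Qed.

Definition weight1 (k : nat) : F := (2 * k + 1)%:R.
Definition weight3 (k : nat) : F := (2 * k + 1)%:R ^+ 3.

Lemma weight1_0 (j : nat) : (2 * j%:Z + 1)%:~R = 0 :> F -> weight1 j = 0.
Proof. by move=> <-; rewrite /weight1 pmulrn; congr _%:~R; lia. Qed.

Lemma weight3_0 (j : nat) : (2 * j%:Z + 1)%:~R = 0 :> F -> weight3 j = 0.
Proof. by move=> /weight1_0; rewrite /weight3 /weight1 => ->; exact: val_inj. Qed.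

Section Equations.
Variable p : S.
Hypothesis psip : psi * p = 1.
Let L := 4 * psi * lam F 3 0 - 3 * phi2 F * lam F 1 0.

Lemma Mser_eq C ro : rho (sqw C) 1 + omega (sqw C) 1 = ro ->
  th C * M = appell_sum (sqw C) weight1 - ro * p - th C * der p + 3 * th C * (E * p).
Proof. by move=> <-; apply: (normalize_M psip); apply: (psi2_Mser (sqw_even C)). Qed.

Lemma Nser_eq C ro ro3 : rho (sqw C) 1 + omega (sqw C) 1 = ro ->
  rho (sqw C) 3 + omega (sqw C) 3 = ro3 ->
  th C * (- (L * p ^+ 2)) = appell_sum (sqw C) weight3 - 4 * (ro3 * p) +
    3 * (ro * (p - 8 * der p)).
Proof.
move=> <- <-; apply: (normalize_N psip); rewrite -phi2E.
exact: (psi_appell_sum3 (sqw_even C)).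
Qed.

End Equations.

Lemma fps_char5 : 5%:R = 0 :> S.
Proof. by have := fps_pchar (isT : prime 5) => /andP[_ /eqP]. Qed.

Lemma th_neq0 (C : F) n : th C n != 0 -> th C != 0.
Proof. by apply: contraNneq => ->. Qed.

Lemma th4_neq0 : b != 0.
Proof.
apply: (@th_neq0 _ 1); rewrite /th thetaE big_mkcond !big_ord_recr big_ord0 /sqw.
by apply/eqP.
Qed.

Lemma th0_neq0 : c != 0.
Proof.
apply: (@th_neq0 _ 3); rewrite /th thetaE big_mkcond !big_ord_recr big_ord0 /sqw.
by apply/eqP.
Qed.

Lemma Mser_mod5 : cl 1 M = 0 /\ cl 3 M = 0.
Proof.
have [p psip] := fps_inverse (psi0 F).
have [m [aE bE cE]] := hat_param psip fps_char5 psi5 theta_lattice5 th0_pow25.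
have [m1 m2 m3 m4 mq] := hat_factors_neq0 psip th4_neq0 th0_neq0 bE cE.
have psi_neq0 : psi != 0.
  by apply/eqP => /(congr1 (@^~ 0%N)) /eqP; rewrite psi0.
have psi_pow5_0 : pure 0 (psi ^+ 5).
  by move=> n n5; rewrite fps_Frobenius // ifF //; apply: contraNF n5 => /eqP ->.
have a0 : pure 0 a by apply: pure_th5.
have b1 : pure 1 b by apply: pure_th5; apply: val_inj.
have c3 : pure 3 c by apply: pure_th5; apply: val_inj.
have cC : (8 * 3 + 1)%:R = 0 :> F by apply: val_inj.
have aC : (8 * 0 + 1)%:R = 1 :> F by [].
have bC : (8 * 1 + 1)%:R = 4 :> F by apply: val_inj.
pose ap w (C : nat) := match C with
  | 0%N => appell_sum (sqw (0 : F)) w | 1%N => appell_sum (sqw (1 : F)) w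
  | _ => appell_sum (sqw (4 : F)) w end.
have eM0 := Mser_eq psip (congr2 +%R rho_0_1 omega_0_1).
have eM1 := Mser_eq psip (congr2 +%R rho_1_1 omega_1_1).
have eM4 := Mser_eq psip (congr2 +%R rho_4_1 omega_4_1).
have eN0 := Nser_eq psip (congr2 +%R rho_0_1 omega_0_1) (congr2 +%R rho_0_3 omega_0_3).
have eN1 := Nser_eq psip (congr2 +%R rho_1_1 omega_1_1) (congr2 +%R rho_1_3 omega_1_3).
have eN4 := Nser_eq psip (congr2 +%R rho_4_1 omega_4_1) (congr2 +%R rho_4_3 omega_4_3).
have A0 n := @cl_appell_sum5 0 weight1 3 n cC weight1_0.
have A1 n := @cl_appell_sum5 1 weight1 0 n aC weight1_0.
have A4 n := @cl_appell_sum5 4 weight1 1 n bC weight1_0.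
have B0 n := @cl_appell_sum5 0 weight3 3 n cC weight3_0.
have B1 n := @cl_appell_sum5 1 weight3 0 n aC weight3_0.
have B4 n := @cl_appell_sum5 4 weight3 1 n bC weight3_0.
have T1 := @cl1_torsion _ fps_char5 _ _ _ _ _ _ _ _ _ _ _ _ (ap weight1) (ap weight3)
  a0 b1 c3 psi_pow5_0 pure_w1 pure_w4 psip psi5 aE bE cE cl_lambert5
  A0 A1 A4 B0 B4 eM0 eM1 eM4 eN0 eN4.
have T3 := @cl3_torsion _ fps_char5 _ _ _ _ _ _ _ _ _ _ _ _ (ap weight1) (ap weight3)
  a0 b1 c3 psi_pow5_0 pure_w1 pure_w4 psip psi5 aE bE cE cl_lambert5
  A0 A1 A4 B0 B1 B4 eM0 eM1 eM4 eN0 eN1 eN4.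
(* Series over a field have no zero divisors, so the factors of the certificates are cancelled one
   by one. *)
split; apply: (fps_mulf_eq0 psi_neq0).
  move: T1; rewrite -3!mulrA => T1.
  apply: (fps_mulf_eq0 m4); apply: (fps_mulf_eq0 m2); apply: (fps_mulf_eq0 (fps_expf_neq0 3 m1)).
  exact: (fps_mulf_eq0 mq T1).
move: T3; rewrite -2!mulrA => T3.
apply: (fps_mulf_eq0 (fps_expf_neq0 4 m4)); apply: (fps_mulf_eq0 (fps_expf_neq0 4 m3)).
exact: (fps_mulf_eq0 (fps_expf_neq0 7 m1) T3).
Qed.

End Mod5.

Local Close Scope ring_scope.

Theorem theorem1p3 (n : nat) :
  [/\ M2spt (3 * n + 1) = 0 %[mod 3],
      M2spt (5 * n + 1) = 0 %[mod 5] &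
      M2spt (5 * n + 3) = 0 %[mod 5]].
Proof.
have [M1 M3] := Mser_mod5.
split; [apply: (M2spt_cl _ Mser_mod3)|apply: (M2spt_cl _ M1)|apply: (M2spt_cl _ M3)] => //.
all: by rewrite mulnC modnMDl.
Qed.
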